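(* Let $\{a_n\}_{n\in\mathbb{N}}$ be a sequence of complex numbers in $l_1$, i.e. $\sum_{n=1}^\infty|a_n|<\infty$, and define $$f(x)=\sum_{n=1}^\infty \frac{a_n}{\sinh(\pi n/2)}\,\mathrm{Im}\left[J_{in}\left(2\sqrt{2x}\right)\right]K_{in}\left(2\sqrt{2x}\right),\qquad x>0 .$$ For $x>0$ and $n\in\mathbb{N}$ let $$\Omega_n(x)=\int_0^\pi \mathrm{Re}\left[K_0\left(4e^{\pi i/4}\cosh^{1/2}(u)\sqrt{x}\right)\right]\sinh(u)\sin(nu)\,du .$$ Then for every $n\in\mathbb{N}$ $$a_n=-\frac{32}{\pi^2}\,\sinh(\pi n)\int_0^\infty \Omega_n(x)\,f(x)\,dx ,$$ where the integral over $(0,\infty)$ converges absolutely.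
   Context: $\mathbb{N}=\{1,2,3,\dots\}$ and $i$ is the imaginary unit. $J_\nu(z)$ is the Bessel function of the first kind, $J_\nu(z)=\sum_{k=0}^\infty\frac{(-1)^k (z/2)^{\nu+2k}}{k!\,\Gamma(\nu+k+1)}$ for $z>0$, used with purely imaginary order. $K_\nu(z)$ is the modified Bessel function of the second kind (principal branch), $K_\nu(z)=\int_0^\infty e^{-z\cosh t}\cosh(\nu t)\,dt$ for $\mathrm{Re}\,z>0$. *)

(* Defs.v *)
From HB Require Import structures.
From mathcomp Require Import all_boot all_order all_algebra.
From mathcomp Require Import complex.
From mathcomp Require Import all_classical all_reals all_analysis.

Set Implicit Arguments.
Unset Strict Implicit.
Unset Printing Implicit Defensive.

Import Order.TTheory GRing.Theory Num.Theory.
Import numFieldNormedType.Exports.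

Local Open Scope classical_set_scope.
Local Open Scope ring_scope.
Local Open Scope complex_scope.

Section Functions.
Variable R : realType.
Notation mu := (@lebesgue_measure R).
Implicit Types (x t u : R) (z s nu : R[i]).

Definition sinh x : R := (expR x - expR (- x)) / 2.

Definition cosh x : R := (expR x + expR (- x)) / 2.

Definition cexp z : R[i] :=
  (expR (complex.Re z) * cos (complex.Im z))
    +i* (expR (complex.Re z) * sin (complex.Im z)).

Definition ccosh z : R[i] := (cexp z + cexp (- z)) / 2.

(* Lebesgue integral of a complex-valued function, taken componentwise; a
   complex function is integrable iff both components are, equivalently iff it
   is measurable with an integrable modulus. *)
Definition cintegrable (D : set R) (f : R -> R[i]) : Prop :=
  mu.-integrable D (fun x => (complex.Re (f x))%:E) /\
  mu.-integrable D (fun x => (complex.Im (f x))%:E).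

Definition cintegral (D : set R) (f : R -> R[i]) : R[i] :=
  (\int[mu]_(x in D) complex.Re (f x))
    +i* (\int[mu]_(x in D) complex.Im (f x)).

(* The type R[i]^o carries the topology of the complex modulus. *)
Definition csummable (m : nat) (v : nat -> R[i]) : Prop :=
  cvgn (fun N : nat => \sum_(m <= n < N) v n : R[i]^o).

Definition csum (m : nat) (v : nat -> R[i]) : R[i] :=
  limn (fun N : nat => \sum_(m <= n < N) v n : R[i]^o).

(* Principal power with positive base. *)
Definition rcpow x z : R[i] := cexp (z * (ln x)%:C).

(* Euler's integral, hence the Gamma function for Re s > 0 only; for a purely
   imaginary order nu the Bessel series below needs just Re s >= 1. *)
Definition Gamma s : R[i] :=
  cintegral `]0, +oo[ (fun t => rcpow t (s - 1) * (expR (- t))%:C).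

(* Meaningful for Re nu > -1 (see [Gamma]) and x > 0. *)
Definition besselJ nu x : R[i] :=
  csum 0 (fun k : nat =>
    (-1) ^+ k * rcpow (x / 2) (nu + (2 * k)%:R)
      / ((k`!)%:R * Gamma (nu + k%:R + 1))).

(* Meaningful for Re z > 0. *)
Definition besselK nu z : R[i] :=
  cintegral `[0, +oo[ (fun t => cexp (- z * (cosh t)%:C) * ccosh (nu * t%:C)).

Definition f_term (a : nat -> R[i]) x (n : nat) : R[i] :=
  let y := 2 * Num.sqrt (2 * x) in
  a n / (sinh (pi * n%:R / 2))%:C
    * (complex.Im (besselJ ('i * n%:R) y))%:C * besselK ('i * n%:R) y%:C.

(* The value [a 0] is irrelevant: sequences are indexed by n >= 1. *)
Definition f_series (a : nat -> R[i]) x : R[i] :=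
  csum 1 (f_term a x).

Definition Omega (n : nat) x : R :=
  \int[mu]_(u in `[0, pi]) (
    complex.Re (besselK 0 (4 * cexp (pi / 4)*i
                             * (Num.sqrt (cosh u))%:C * (Num.sqrt x)%:C))
      * sinh u * sin (n%:R * u)).

End Functions.

(* Main.v *)
(* Put y = 2 sqrt(2x) and w = exp(i pi/4). Integral representations of
   K_0(4 w sqrt(c x)) and, after rotating the contour by exp(- i pi/4), of
   K_(i tau)(y) turn the integral of K_0 J_(i tau) K_(i tau) over x > 0 into a triple
   integral whose x-integral is Weber's exponential integral of J_(i tau), evaluated
   term by term from the power series. Two of the remaining three integrations are
   elementary; since K_(i tau)(y) is real and J_(- i tau)(y) is conjugate to
   J_(i tau)(y), this yields, with c = cosh u,
     int Re K_0(4 w sqrt(c x)) Im J_(i tau)(y) K_(i tau)(y) dx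
       = - (1/16) int_(t > 0) sin(tau t) sinh t / (sinh^2 t + cosh^2 u) dt.
   As sinh u sinh t / (sinh^2 t + cosh^2 u) is half of sech(t - u) - sech(t + u), the
   Fourier transform of sech evaluates sinh u times this integral to
   - (pi/32) sin(tau u) / cosh(pi tau/2), and the orthogonality of the sines on [0, pi]
   isolates a_n. The series is integrated termwise by dominated convergence: the bound
   n! <= |Gamma(n + 1 + i tau)| sqrt(cosh(pi tau)) makes
   Im J_(i m)(y) K_(i m)(y) / sinh(pi m/2) bounded uniformly in m. *)

Require Import Defs.
From mathcomp Require Import all_boot all_order all_algebra.
From mathcomp Require Import complex ring lra.
From mathcomp Require Import all_classical all_reals all_analysis measurable_realfun.

Set Implicit Arguments.
Unset Strict Implicit.
Unset Printing Implicit Defensive.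

Import Order.TTheory GRing.Theory Num.Theory.
Import numFieldNormedType.Exports.

Local Open Scope classical_set_scope.
Local Open Scope ring_scope.
Local Open Scope complex_scope.

Local Notation CRe := (@complex.Re _).
Local Notation CIm := (@complex.Im _).

(** * Complex-valued functions of a real variable *)

Section ComplexBasics.
Variable R : realType.
Implicit Types (z w : R[i]) (x y t : R).

(** Every exchange of integrals or limits rests on absolute convergence, yet the power series bounds
    [J] only by a multiple of exp(y). This growth must be absorbed by the integrands of the two
    functions K, which on the rotated rays keep only the fraction Re w = cos(pi/4) of their decay.
    [exponent_le] shows that even the cruder Re w >= 1/2 suffices. What is left,
    [dexp x p * dexp x q], involves neither [c] nor the order, so the same dominators serve the
    triple integral, the integral over u and the limit of the partial sums. The angle of the
    rotation is forced by the argument of K_0: after it, both exponents depend on x through a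
    positive multiple of - w x, and they merge into one exponential exp(- w z x) with z > 0.
    Translations of the integration variables make this dependence linear in x rather than in
    sqrt(x); they also supply the second half of the power (2x)^(i tau) in Weber's integral.
    Integrals are taken over the whole line in logarithmic variables. There the rotation of a ray is
    the shift of a horizontal line, scaling is translation, and the one function sech(s/2) dominates
    all contour integrands. *)

Definition cabs z : R := CRe `|z|.

Lemma cabsE z : cabs z = Num.sqrt (CRe z ^+ 2 + CIm z ^+ 2).
Proof. by rewrite /cabs normc_def. Qed.

Lemma cabsC z : `|z| = (cabs z)%:C.
Proof. by rewrite /cabs normc_def. Qed.

Lemma cabs_ge0 z : 0 <= cabs z.
Proof. by rewrite cabsE sqrtr_ge0. Qed.

Lemma cabsM z w : cabs (z * w) = cabs z * cabs w.
Proof. by apply: complexI; rewrite -cabsC normrM !cabsC rmorphM. Qed.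

Lemma cabsD z w : cabs (z + w) <= cabs z + cabs w.
Proof. by rewrite -lecR rmorphD /= -!cabsC ler_normD. Qed.

Lemma cabsN z : cabs (- z) = cabs z.
Proof. by rewrite /cabs normrN. Qed.

Lemma cabsB z w : cabs (z - w) <= cabs z + cabs w.
Proof. by rewrite (le_trans (cabsD _ _))// cabsN. Qed.

Lemma cabsV z : cabs z^-1 = (cabs z)^-1.
Proof. by apply: complexI; rewrite -cabsC normfV !cabsC fmorphV. Qed.

Lemma cabs_real x : cabs x%:C = `|x|.
Proof. by rewrite cabsE/= expr0n addr0 sqrtr_sqr. Qed.

Lemma cabs0 : cabs 0 = 0. Proof. by rewrite (cabs_real 0) normr0. Qed.
Lemma cabs1 : cabs 1 = 1. Proof. by rewrite (cabs_real 1) normr1. Qed.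

Lemma cabsX z n : cabs (z ^+ n) = cabs z ^+ n.
Proof. by elim: n => [|n ih]; rewrite ?expr0 ?cabs1// !exprS cabsM ih. Qed.

Lemma cabs_conj z : cabs z^* = cabs z.
Proof. by rewrite /cabs normcJ. Qed.

Lemma Re_le_cabs z : `|CRe z| <= cabs z.
Proof. by rewrite -lecR -cabsC normc_ge_Re. Qed.

Lemma Im_le_cabs z : `|CIm z| <= cabs z.
Proof.
by rewrite cabsE -sqrtr_sqr ler_wsqrtr// lerDr sqr_ge0.
Qed.

Lemma cabs_le z : cabs z <= `|CRe z| + `|CIm z|.
Proof.
rewrite -(@ler_pXn2r _ 2)// ?nnegrE ?cabs_ge0 ?addr_ge0//.
rewrite cabsE sqr_sqrtr ?addr_ge0 ?sqr_ge0// sqrrD !real_normK ?num_real//.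
by rewrite lerD2r lerDl mulrn_wge0 ?mulr_ge0.
Qed.

Lemma cabs_eq0 z : (cabs z == 0) = (z == 0).
Proof. by rewrite -(inj_eq (@complexI R)) -cabsC normr_eq0. Qed.

Lemma cabs_gt0 z : (0 < cabs z) = (z != 0).
Proof. by rewrite lt_neqAle cabs_ge0 andbT eq_sym cabs_eq0. Qed.

Lemma eqC z w : CRe z = CRe w -> CIm z = CIm w -> z = w.
Proof. by case: z w => a b [c d] /= -> ->. Qed.

Lemma ReD z w : CRe (z + w) = CRe z + CRe w. Proof. by case: z w => ? ? [? ?]. Qed.
Lemma ImD z w : CIm (z + w) = CIm z + CIm w. Proof. by case: z w => ? ? [? ?]. Qed.
Lemma ReN z : CRe (- z) = - CRe z. Proof. by case: z. Qed.
Lemma ImN z : CIm (- z) = - CIm z. Proof. by case: z. Qed.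
Lemma ReM z w : CRe (z * w) = CRe z * CRe w - CIm z * CIm w.
Proof. by case: z w => ? ? [? ?]. Qed.
Lemma ImM z w : CIm (z * w) = CRe z * CIm w + CIm z * CRe w.
Proof. by case: z w => ? ? [? ?]. Qed.
Lemma ReZ x z : CRe (x%:C * z) = x * CRe z.
Proof. by rewrite ReM /= mul0r subr0. Qed.
Lemma ImZ x z : CIm (x%:C * z) = x * CIm z.
Proof. by rewrite ImM /= mul0r addr0. Qed.
Lemma ReV z : CRe z^-1 = CRe z / (CRe z ^+ 2 + CIm z ^+ 2).
Proof. by case: z => a b. Qed.
Lemma ImV z : CIm z^-1 = - CIm z / (CRe z ^+ 2 + CIm z ^+ 2).
Proof. by case: z => a b/=; rewrite mulNr. Qed.
Definition ReImE := (ReD, ImD, ReN, ImN, ReM, ImM, ReV, ImV).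

Lemma ReIm_sq z : cabs z ^+ 2 = CRe z ^+ 2 + CIm z ^+ 2.
Proof. by rewrite cabsE sqr_sqrtr// addr_ge0// sqr_ge0. Qed.

Lemma Re_sum (I : Type) (r : seq I) (P : pred I) (F : I -> R[i]) :
  CRe (\sum_(k <- r | P k) F k) = \sum_(k <- r | P k) CRe (F k).
Proof. by elim/big_rec2: _ => //= k z w _ <-; rewrite ReD. Qed.

Lemma Im_sum (I : Type) (r : seq I) (P : pred I) (F : I -> R[i]) :
  CIm (\sum_(k <- r | P k) F k) = \sum_(k <- r | P k) CIm (F k).
Proof. by elim/big_rec2: _ => //= k z w _ <-; rewrite ImD. Qed.

Lemma cabs_sum (I : Type) (r : seq I) (P : pred I) (F : I -> R[i]) :
  cabs (\sum_(k <- r | P k) F k) <= \sum_(k <- r | P k) cabs (F k).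
Proof.
elim/big_rec2: _ => [|k z w _ h]; first by rewrite cabs0.
by rewrite (le_trans (cabsD _ _))// lerD2l.
Qed.

Lemma cexpD z w : cexp (z + w) = cexp z * cexp w.
Proof.
by rewrite /cexp ReD ImD expRD cosD sinD; apply: eqC => /=; ring.
Qed.

Lemma cexp_real x : cexp x%:C = (expR x)%:C.
Proof. by rewrite /cexp/= cos0 sin0 mulr1 mulr0. Qed.

Lemma cexp0 : cexp 0 = 1 :> R[i].
Proof. by rewrite (cexp_real 0) expR0. Qed.

Lemma cabs_cexp z : cabs (cexp z) = expR (CRe z).
Proof.
rewrite cabsE /= !exprMn -mulrDr cos2Dsin2 mulr1 sqrtr_sqr ger0_norm//.
Qed.

Lemma cexp_neq0 z : cexp z != 0.
Proof. by rewrite -cabs_gt0 cabs_cexp expR_gt0. Qed.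

Lemma cexpN z : cexp (- z) = (cexp z)^-1.
Proof.
apply: (mulIf (cexp_neq0 z)); rewrite -cexpD addNr cexp0 mulVf//.
exact: cexp_neq0.
Qed.

Lemma cexpB z w : cexp (z - w) = cexp z / cexp w.
Proof. by rewrite cexpD cexpN. Qed.

Lemma cexpMn z n : cexp (z *+ n) = cexp z ^+ n.
Proof. by elim: n => [|n ih]; rewrite ?mulr0n ?cexp0// mulrS cexpD ih exprS. Qed.

Lemma cexp_conj z : cexp z^* = (cexp z)^*.
Proof. by case: z => a b; rewrite /cexp /= cosN sinN mulrN. Qed.

Lemma realC_expr x n : (x ^+ n)%:C = x%:C ^+ n.
Proof. by rewrite rmorphXn. Qed.

Lemma realCM x y : (x * y)%:C = x%:C * y%:C.
Proof. by rewrite rmorphM. Qed.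
Lemma realCD x y : (x + y)%:C = x%:C + y%:C.
Proof. by rewrite rmorphD. Qed.
Lemma realCN x : (- x)%:C = - x%:C.
Proof. by rewrite rmorphN. Qed.
Lemma realCV x : (x^-1)%:C = (x%:C)^-1.
Proof. by rewrite fmorphV. Qed.
Lemma realCn n : (n%:R : R)%:C = n%:R.
Proof. by rewrite rmorph_nat. Qed.

(** Only derivatives along a real parameter occur. Holomorphy of an integrand is expressed by its
    two partial derivatives, which differ by the factor ['i], see [cI_shift]. *)
Definition cder (f : R -> R[i]) x (l : R[i]) : Prop :=
  is_derive x 1 (CRe \o f) (CRe l) /\ is_derive x 1 (CIm \o f) (CIm l).

Lemma cder_eq f x l l' : cder f x l -> l = l' -> cder f x l'.
Proof. by move=> h <-. Qed.

Lemma cder_ext f g x l : f =1 g -> cder f x l -> cder g x l.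
Proof. by move=> /funext ->. Qed.

Lemma cder_cst c x : cder (fun=> c) x 0.
Proof. by split; exact: is_derive_cst. Qed.

Lemma cder_real (u : R -> R) x l :
  is_derive x 1 u l -> cder (fun t => (u t)%:C) x l%:C.
Proof. by move=> h; split => //; exact: is_derive_cst. Qed.

Lemma cderD f g x l k : cder f x l -> cder g x k ->
  cder (fun t => f t + g t) x (l + k).
Proof.
move=> [f1 f2] [g1 g2]; split.
- rewrite ReD (_ : _ \o _ = (CRe \o f) + (CRe \o g)); first exact: is_deriveD.
  by apply/funext => t /=; rewrite ReD.
- rewrite ImD (_ : _ \o _ = (CIm \o f) + (CIm \o g)); first exact: is_deriveD.
  by apply/funext => t /=; rewrite ImD.
Qed.

Lemma cderN f x l : cder f x l -> cder (fun t => - f t) x (- l).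
Proof.
move=> [f1 f2]; split.
- rewrite ReN (_ : _ \o _ = - (CRe \o f)); first exact: is_deriveN.
  by apply/funext => t /=; rewrite ReN.
- rewrite ImN (_ : _ \o _ = - (CIm \o f)); first exact: is_deriveN.
  by apply/funext => t /=; rewrite ImN.
Qed.

Lemma cderM f g x l k : cder f x l -> cder g x k ->
  cder (fun t => f t * g t) x (l * g x + f x * k).
Proof.
move=> [f1 f2] [g1 g2]; split.
- rewrite (_ : _ \o _ = (CRe \o f) * (CRe \o g) - (CIm \o f) * (CIm \o g)).
    apply: is_derive_eq; rewrite !ReImE /= /GRing.scale/=; ring.
  by apply/funext => t /=; rewrite ReM.
- rewrite (_ : _ \o _ = (CRe \o f) * (CIm \o g) + (CIm \o f) * (CRe \o g)).
    apply: is_derive_eq; rewrite !ReImE /= /GRing.scale/=; ring.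
  by apply/funext => t /=; rewrite ImM.
Qed.

Lemma cderZ c f x l : cder f x l -> cder (fun t => c * f t) x (c * l).
Proof.
by move=> h; apply: (cder_eq (cderM (cder_cst c x) h)); rewrite mul0r add0r.
Qed.

Lemma cder_cexp f x l : cder f x l -> cder (fun t => cexp (f t)) x (l * cexp (f x)).
Proof.
move=> [f1 f2]; split.
- rewrite (_ : _ \o _ = (expR \o (CRe \o f)) * (cos \o (CIm \o f))); last first.
    by apply/funext.
  apply: is_derive_eq; rewrite !ReImE /= /GRing.scale/=; ring.
- rewrite (_ : _ \o _ = (expR \o (CRe \o f)) * (sin \o (CIm \o f))); last first.
    by apply/funext.
  apply: is_derive_eq; rewrite !ReImE /= /GRing.scale/=; ring.
Qed.

Lemma sqReIm_neq0 z : z != 0 -> CRe z ^+ 2 + CIm z ^+ 2 != 0.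
Proof. by rewrite -ReIm_sq expf_eq0/= cabs_eq0. Qed.

Lemma cderV f x l : f x != 0 -> cder f x l ->
  cder (fun t => (f t)^-1) x (- l / f x ^+ 2).
Proof.
move=> f0 [f1 f2].
have N0 := sqReIm_neq0 f0.
have dN : is_derive x 1 (fun t => CRe (f t) ^+ 2 + CIm (f t) ^+ 2)
    (2 * CRe (f x) * CRe l + 2 * CIm (f x) * CIm l).
  rewrite (_ : (fun _ => _) = (CRe \o f) ^+ 2 + (CIm \o f) ^+ 2).
    apply: is_derive_eq; rewrite /GRing.scale/= expr1; ring.
  by apply/funext => t.
have dV := @is_deriveV R (fun t => CRe (f t) ^+ 2 + CIm (f t) ^+ 2) x _ 1 N0 dN.
have Hr : CRe (- l / f x ^+ 2) =
    (CRe l * (CRe (f x) ^+ 2 + CIm (f x) ^+ 2)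
     - CRe (f x) * (2 * CRe (f x) * CRe l + 2 * CIm (f x) * CIm l)) /
     (CRe (f x) ^+ 2 + CIm (f x) ^+ 2) ^+ 2.
  rewrite expr2 invfM !ReImE; field; exact: N0.
have Hi : CIm (- l / f x ^+ 2) =
    - (CIm l * (CRe (f x) ^+ 2 + CIm (f x) ^+ 2)
     - CIm (f x) * (2 * CRe (f x) * CRe l + 2 * CIm (f x) * CIm l)) /
     (CRe (f x) ^+ 2 + CIm (f x) ^+ 2) ^+ 2.
  rewrite expr2 invfM !ReImE; field; exact: N0.
split.
- rewrite Hr (_ : _ \o _ =
      (CRe \o f) * (fun t => (CRe (f t) ^+ 2 + CIm (f t) ^+ 2)^-1)).
    apply: is_derive_eq; rewrite /GRing.scale/=; field; exact: N0.
  by apply/funext => t /=; rewrite ReV.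
- rewrite Hi (_ : _ \o _ =
      (- (CIm \o f)) * (fun t => (CRe (f t) ^+ 2 + CIm (f t) ^+ 2)^-1)).
    apply: is_derive_eq; rewrite /GRing.scale/= !fctE; field; exact: N0.
  by apply/funext => t /=; rewrite ImV.
Qed.

Definition ccont (f : R -> R[i]) := continuous (CRe \o f) /\ continuous (CIm \o f).

Lemma is_derive_continuous (f : R -> R) x l : is_derive x 1 f l -> {for x, continuous f}.
Proof.
move=> h; have /derivable1_diffP : derivable f x 1 by exact: ex_derive.
exact: differentiable_continuous.
Qed.

Lemma cder_ccont f (l : R -> R[i]) : (forall x, cder f x (l x)) -> ccont f.
Proof.
move=> h; split => x; have [h1 h2] := h x.
- exact: is_derive_continuous h1.
- exact: is_derive_continuous h2.
Qed.

End ComplexBasics.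

(** * Measurability of complex-valued functions *)

Section Measurability.
Context d (T : measurableType d) (R : realType).
Implicit Types (f g : T -> R[i]) (u v : T -> R).

Definition cmeas f := measurable_fun setT (CRe \o f) /\ measurable_fun setT (CIm \o f).

Lemma cmeas_cst c : cmeas (fun=> c).
Proof. by split; exact: measurable_cst. Qed.

Lemma cmeas_real u : measurable_fun setT u -> cmeas (fun t => (u t)%:C).
Proof. by move=> h; split => //; exact: measurable_cst. Qed.

Lemma cmeasD f g : cmeas f -> cmeas g -> cmeas (fun t => f t + g t).
Proof.
move=> [f1 f2] [g1 g2]; split.
- by rewrite (_ : _ \o _ = (CRe \o f) \+ (CRe \o g)); [exact: measurable_funD|
    apply/funext => t /=; rewrite ReD].
- by rewrite (_ : _ \o _ = (CIm \o f) \+ (CIm \o g)); [exact: measurable_funD|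
    apply/funext => t /=; rewrite ImD].
Qed.

Lemma cmeasN f : cmeas f -> cmeas (fun t => - f t).
Proof.
move=> [f1 f2]; split.
- by rewrite (_ : _ \o _ = \- (CRe \o f)); [exact: measurable_funN|
    apply/funext => t /=; rewrite ReN].
- by rewrite (_ : _ \o _ = \- (CIm \o f)); [exact: measurable_funN|
    apply/funext => t /=; rewrite ImN].
Qed.

Lemma cmeasM f g : cmeas f -> cmeas g -> cmeas (fun t => f t * g t).
Proof.
move=> [f1 f2] [g1 g2]; split.
- rewrite (_ : _ \o _ = ((CRe \o f) \* (CRe \o g)) \- ((CIm \o f) \* (CIm \o g))).
    by apply: measurable_funB; exact: measurable_funM.
  by apply/funext => t /=; rewrite ReM.
- rewrite (_ : _ \o _ = ((CRe \o f) \* (CIm \o g)) \+ ((CIm \o f) \* (CRe \o g))).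
    by apply: measurable_funD; exact: measurable_funM.
  by apply/funext => t /=; rewrite ImM.
Qed.

(** The real power with exponent -1 is the inverse on nonnegative arguments, so it is applied to the
    square of [u]. At a zero of [u] both sides vanish because [0^-1 = 0]. *)
Lemma measurable_funV u : measurable_fun setT u -> measurable_fun setT (fun t => (u t)^-1).
Proof.
move=> mu; rewrite (_ : (fun _ => _) = u \* ((@powR R ^~ (-1)) \o (fun t => u t ^+ 2))).
  apply: measurable_funM => //; apply: measurableT_comp; first exact: measurable_powR.
  exact: measurable_funX.
apply/funext => t /=; rewrite powR_inv1 ?sqr_ge0//.
have [->|u0] := eqVneq (u t) 0; first by rewrite mul0r invr0.
by field.
Qed.

Lemma cmeasV f : cmeas f -> cmeas (fun t => (f t)^-1).
Proof.
move=> [f1 f2].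
have mN : measurable_fun setT (fun t => (CRe (f t) ^+ 2 + CIm (f t) ^+ 2)^-1).
  apply: measurable_funV; apply: measurable_funD; exact: measurable_funX.
split.
- rewrite (_ : _ \o _ = (CRe \o f) \* (fun t => (CRe (f t) ^+ 2 + CIm (f t) ^+ 2)^-1)).
    exact: measurable_funM.
  by apply/funext => t /=; rewrite ReV.
- rewrite (_ : _ \o _ = (\- (CIm \o f)) \*
      (fun t => (CRe (f t) ^+ 2 + CIm (f t) ^+ 2)^-1)).
    by apply: measurable_funM => //; exact: measurable_funN.
  by apply/funext => t /=; rewrite ImV.
Qed.

Lemma measurable_cos : measurable_fun setT (@cos R).
Proof. by apply: continuous_measurable_fun; exact: continuous_cos. Qed.
Lemma measurable_sin : measurable_fun setT (@sin R).
Proof. by apply: continuous_measurable_fun; exact: continuous_sin. Qed.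

Lemma measurable_funexpR u : measurable_fun setT u -> measurable_fun setT (fun t => expR (u t)).
Proof. by move=> ?; apply: measurableT_comp => //; exact: measurable_expR. Qed.
Lemma measurable_funln u : measurable_fun setT u -> measurable_fun setT (fun t => ln (u t)).
Proof. by move=> ?; apply: measurableT_comp => //; exact: measurable_ln. Qed.

Lemma cmeas_cexp f : cmeas f -> cmeas (fun t => cexp (f t)).
Proof.
move=> [f1 f2]; split.
- apply: measurable_funM; first exact: measurable_funexpR.
  by apply: measurableT_comp => //; exact: measurable_cos.
- apply: measurable_funM; first exact: measurable_funexpR.
  by apply: measurableT_comp => //; exact: measurable_sin.
Qed.

Lemma measurable_cabs f : cmeas f -> measurable_fun setT (fun t => cabs (f t)).
Proof.
move=> [f1 f2].
rewrite (_ : (fun _ => _) = (@powR R ^~ (2^-1)) \o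
     (fun t => CRe (f t) ^+ 2 + CIm (f t) ^+ 2)).
  apply: measurableT_comp; first exact: measurable_powR.
  by apply: measurable_funD; exact: measurable_funX.
by apply/funext => t /=; rewrite cabsE powR12_sqrt// addr_ge0 ?sqr_ge0.
Qed.

End Measurability.

Lemma cmeas_comp d (T : measurableType d) d' (T' : measurableType d') (R : realType)
  (f : T' -> R[i]) (h : T -> T') :
  cmeas f -> measurable_fun setT h -> cmeas (fun t => f (h t)).
Proof. by move=> [f1 f2] mh; split; [apply: (measurableT_comp f1)|apply: (measurableT_comp f2)]. Qed.

(** * Integrals over the line and Fubini's theorem *)

Section RealIntegral.
Context d (T : measurableType d) (R : realType) (m : {measure set T -> \bar R}).
Implicit Types (f g : T -> R).

Definition rint f := m.-integrable setT (EFin \o f).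

Lemma rint_meas f : rint f -> measurable_fun setT f.
Proof. by move=> /integrableP[/measurable_EFinP]. Qed.

Lemma rint_dom f g : measurable_fun setT f -> (forall x, `|f x| <= g x) ->
  rint g -> rint f.
Proof.
move=> mf fg ig; apply: le_integrable ig => //; first exact/measurable_EFinP.
move=> x _ /=; rewrite lee_fin (le_trans (fg x))// ler_norm//.
Qed.

Lemma rint_abs f : rint f -> rint (fun x => `|f x|).
Proof. by move=> h; have := integrable_norm h. Qed.

Lemma rintD f g : rint f -> rint g -> rint (fun x => f x + g x).
Proof. by move=> hf hg; have := integrableD measurableT hf hg. Qed.

Lemma rintZ f k : rint f -> rint (fun x => k * f x).
Proof. by move=> hf; have := integrableZl measurableT k hf. Qed.

Lemma rintN f : rint f -> rint (fun x => - f x).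
Proof. by move=> /(rintZ (-1)); congr rint; apply/funext => x; rewrite mulN1r. Qed.

Lemma rintB f g : rint f -> rint g -> rint (fun x => f x - g x).
Proof. by move=> hf /rintN; exact: rintD. Qed.

Lemma rint0 : rint (fun=> 0).
Proof. exact: integrable0. Qed.

Lemma rint_sum (I : Type) (r : seq I) (F : I -> T -> R) :
  (forall k, rint (F k)) -> rint (fun x => \sum_(k <- r) F k x).
Proof.
move=> h; elim: r => [|k r ih].
  by under [X in rint X]funext do rewrite big_nil; exact: rint0.
by under [X in rint X]funext do rewrite big_cons; exact: rintD.
Qed.

Lemma rI_Z k f : rint f -> \int[m]_x (k * f x) = k * \int[m]_x f x.
Proof. by move=> h; rewrite RintegralZl. Qed.
Lemma rI_D f g : rint f -> rint g ->
  \int[m]_x (f x + g x) = \int[m]_x f x + \int[m]_x g x.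
Proof. by move=> h1 h2; rewrite RintegralD. Qed.
Lemma rI_B f g : rint f -> rint g ->
  \int[m]_x (f x - g x) = \int[m]_x f x - \int[m]_x g x.
Proof. by move=> h1 h2; rewrite RintegralB. Qed.
Lemma rI_N f : rint f -> \int[m]_x (- f x) = - \int[m]_x f x.
Proof.
by move=> h; rewrite -mulN1r -rI_Z//; apply: eq_Rintegral => x _; rewrite mulN1r.
Qed.
Lemma rI_le f g : rint f -> rint g -> (forall x, f x <= g x) ->
  \int[m]_x f x <= \int[m]_x g x.
Proof. by move=> h1 h2 h; rewrite le_Rintegral. Qed.
Lemma rI_0 : \int[m]_(x in setT) (0 : R) = 0.
Proof. by rewrite /Rintegral integral0. Qed.

Lemma rI_sum (I : Type) (r : seq I) (F : I -> T -> R) :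
  (forall k, rint (F k)) ->
  \int[m]_x (\sum_(k <- r) F k x) = \sum_(k <- r) \int[m]_x F k x.
Proof.
move=> h; elim: r => [|k r ih].
  rewrite big_nil; under eq_Rintegral do rewrite big_nil; exact: rI_0.
rewrite big_cons; under eq_Rintegral do rewrite big_cons.
by rewrite rI_D ?ih//; exact: rint_sum.
Qed.

Lemma rI_EFin f : rint f -> (\int[m]_x (f x)%:E)%E = (\int[m]_x f x)%:E.
Proof. by move=> h; rewrite /Rintegral fineK//; exact: integrable_fin_num. Qed.

(** Fubini's theorem controls almost all sections only. On the others the extended integral [F] may
    be infinite while its real version [f] takes a default value; this does not affect
    integrability. *)
Lemma rint_ae (F : T -> \bar R) f : measurable_fun setT f -> m.-integrable setT F ->
  {ae m, forall x, setT x -> F x = (f x)%:E} -> rint f.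
Proof.
move=> mf /integrableP[mF iF] ae; apply/integrableP; split; first exact/measurable_EFinP.
rewrite (_ : (\int[m]_x _ = \int[m]_x `|F x|)%E)//.
apply: ae_eq_integral => //.
- by apply: measurableT_comp => //; exact/measurable_EFinP.
- exact: measurableT_comp.
- by apply: filterS ae => x hx _ /=; rewrite hx.
Qed.

Lemma rdct (f_ : nat -> T -> R) f g :
  (forall n, measurable_fun setT (f_ n)) ->
  (forall x, f_ ^~ x @ \oo --> f x) -> rint g ->
  (forall n x, `|f_ n x| <= g x) ->
  rint f /\ (fun n => \int[m]_x f_ n x) @ \oo --> \int[m]_x f x.
Proof.
move=> mf_ cf ig fg.
have mf : measurable_fun setT f by exact: (@measurable_fun_cvg _ _ _ _ f_).
have [i1 _ i2] : [/\ m.-integrable setT (EFin \o f),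
    [sequence (\int[m]_x `|(f_ n x)%:E - (f x)%:E|)%E]_n @ \oo --> 0%E &
    [sequence (\int[m]_x (f_ n x)%:E)%E]_n @ \oo --> (\int[m]_x (f x)%:E)%E].
  apply: (@dominated_convergence _ T R m setT measurableT
    (fun n => EFin \o f_ n) (EFin \o f) (EFin \o g)).
  - by move=> n; exact/measurable_EFinP.
  - exact/measurable_EFinP.
  - by apply: aeW => x _; apply: cvg_EFin; [exact: nearW|exact: cf].
  - exact: ig.
  - by apply: aeW => x n _ /=; rewrite lee_fin.
split => //.
have if_ n : rint (f_ n) by exact: rint_dom ig.
apply/fine_cvg; rewrite -rI_EFin//.
Qed.

End RealIntegral.

(** * Tonelli and Fubini theorems for real integrands *)

Section Product.
Context d1 d2 (T1 : measurableType d1) (T2 : measurableType d2) (R : realType).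
Variables (m1 : {sigma_finite_measure set T1 -> \bar R})
          (m2 : {sigma_finite_measure set T2 -> \bar R}).
Implicit Types (f : T1 * T2 -> R).

(** Tonelli's theorem gives measurability for the positive and the negative part, and [fine] is
    measurable; sections with an infinite integral are thereby covered. *)
Lemma measurable_param f : measurable_fun setT f ->
  measurable_fun setT (fun x => \int[m2]_y f (x, y)).
Proof.
move=> mf; rewrite /Rintegral.
apply: measurableT_comp; first exact: fine_measurable.
have mE : measurable_fun setT (EFin \o f) by exact/measurable_EFinP.
rewrite (_ : (fun x => _) = (fun x => fubini_F m2 (EFin \o f)^\+ x
    - fubini_F m2 (EFin \o f)^\- x)%E); last first.
  apply/funext => x; rewrite integralE.
  by congr (_ - _)%E; apply: eq_integral => y _; rewrite ?funeposE ?funenegE.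
apply: emeasurable_funB.
- exact: (@measurable_fun_fubini_tonelli_F _ _ _ _ _ m2 _
    (measurable_funepos mE) (fun x => funepos_ge0 _ x)).
- exact: (@measurable_fun_fubini_tonelli_F _ _ _ _ _ m2 _
    (measurable_funeneg mE) (fun x => funeneg_ge0 _ x)).
Qed.

Lemma measurable_param2 f : measurable_fun setT f ->
  measurable_fun setT (fun y => \int[m1]_x f (x, y)).
Proof.
move=> mf; rewrite /Rintegral.
apply: measurableT_comp; first exact: fine_measurable.
have mE : measurable_fun setT (EFin \o f) by exact/measurable_EFinP.
rewrite (_ : (fun y => _) = (fun y => fubini_G m1 (EFin \o f)^\+ y
    - fubini_G m1 (EFin \o f)^\- y)%E); last first.
  apply/funext => x; rewrite integralE.
  by congr (_ - _)%E; apply: eq_integral => y _; rewrite ?funeposE ?funenegE.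
apply: emeasurable_funB.
- exact: (@measurable_fun_fubini_tonelli_G _ _ _ _ _ m1 _
    (measurable_funepos mE) (fun x => funepos_ge0 _ x)).
- exact: (@measurable_fun_fubini_tonelli_G _ _ _ _ _ m1 _
    (measurable_funeneg mE) (fun x => funeneg_ge0 _ x)).
Qed.

Lemma rint_prod12 f (G : T1 -> R) : measurable_fun setT f ->
  (forall x, rint m2 (fun y => f (x, y))) ->
  (forall x, \int[m2]_y `|f (x, y)| <= G x) -> rint m1 G ->
  rint (m1 \x m2)%E f.
Proof.
move=> mf fi fG iG; apply/(integrable12ltyP m1 m2).
  exact/measurable_EFinP.
apply: le_lt_trans (integrable_lty measurableT iG).
apply: ge0_le_integral => //.
- by move=> x _; apply: integral_ge0.
- have mE : measurable_fun setT (fun z => `|(f z)%:E|%E).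
    by apply: measurableT_comp => //; exact/measurable_EFinP.
  exact: (@measurable_fun_fubini_tonelli_F _ _ _ _ _ m2 _ mE).
- exact/measurable_EFinP/(rint_meas iG).
- move=> x _ /=.
  by rewrite rI_EFin ?lee_fin//; exact: rint_abs.
Qed.

Lemma rint_prod21 f (G : T2 -> R) : measurable_fun setT f ->
  (forall y, rint m1 (fun x => f (x, y))) ->
  (forall y, \int[m1]_x `|f (x, y)| <= G y) -> rint m2 G ->
  rint (m1 \x m2)%E f.
Proof.
move=> mf fi fG iG; apply/(integrable21ltyP m1 m2).
  exact/measurable_EFinP.
apply: le_lt_trans (integrable_lty measurableT iG).
apply: ge0_le_integral => //.
- by move=> x _; apply: integral_ge0.
- have mE : measurable_fun setT (fun z => `|(f z)%:E|%E).
    by apply: measurableT_comp => //; exact/measurable_EFinP.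
  exact: (@measurable_fun_fubini_tonelli_G _ _ _ _ _ m1 _ mE).
- exact/measurable_EFinP/(rint_meas iG).
- move=> x _ /=.
  by rewrite rI_EFin ?lee_fin//; exact: rint_abs.
Qed.

Lemma rfubini1 f : rint (m1 \x m2)%E f ->
  rint m1 (fun x => \int[m2]_y f (x, y)) /\
  \int[m1]_x \int[m2]_y f (x, y) = \int[(m1 \x m2)%E]_z f z.
Proof.
move=> h; have mf := rint_meas h.
have iF := integrable_fubini_F h.
have mI := measurable_param mf.
have ae : {ae m1, forall x, setT x ->
    fubini_F m2 (EFin \o f) x = (\int[m2]_y f (x, y))%:E}.
  apply: filterS (ae_integrable1 h) => x hx _.
  by rewrite /fubini_F/= rI_EFin.
have mF : measurable_fun setT (fubini_F m2 (EFin \o f)) by case/integrableP: iF.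
split.
  exact: rint_ae ae.
rewrite [RHS]/Rintegral -integral12_prod_meas1// /Rintegral; congr fine.
apply: ae_eq_integral => //; first exact/measurable_EFinP.
by apply: filterS ae => x hx _; rewrite hx.
Qed.

Lemma rfubini2 f : rint (m1 \x m2)%E f ->
  rint m2 (fun y => \int[m1]_x f (x, y)) /\
  \int[m2]_y \int[m1]_x f (x, y) = \int[(m1 \x m2)%E]_z f z.
Proof.
move=> h; have mf := rint_meas h.
have mE : measurable_fun setT (EFin \o f) by exact/measurable_EFinP.
have mA : measurable_fun setT (fun z => `|(f z)%:E|%E) by exact: measurableT_comp.
have iF : m2.-integrable setT (fubini_G m1 (EFin \o f)).
  apply/integrableP; split; first exact: (measurable_fubini_G h).
  apply: le_lt_trans ((integrable21ltyP m1 m2 mE).1 h).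
  apply: ge0_le_integral => //.
  - apply: measurableT_comp => //; exact: (measurable_fubini_G h).
  - exact: (@measurable_fun_fubini_tonelli_G _ _ _ _ _ m1 _ mA).
  - move=> y _; apply: le_abse_integral => //.
    exact: measurableT_comp mE _.
have mI := measurable_param2 mf.
have ae : {ae m2, forall y, setT y ->
    fubini_G m1 (EFin \o f) y = (\int[m1]_x f (x, y))%:E}.
  apply: filterS (ae_integrable2 h) => x hx _.
  by rewrite /fubini_G/= rI_EFin.
have mF : measurable_fun setT (fubini_G m1 (EFin \o f)) by case/integrableP: iF.
split; first exact: rint_ae ae.
rewrite [RHS]/Rintegral -integral21_prod_meas1// /Rintegral; congr fine.
apply: ae_eq_integral => //; first exact/measurable_EFinP.
by apply: filterS ae => x hx _; rewrite hx.
Qed.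

End Product.

(** * Integrals of complex-valued functions *)

Section ComplexIntegral.
Context d (T : measurableType d) (R : realType) (m : {measure set T -> \bar R}).
Implicit Types (f g : T -> R[i]).

Definition cin f := rint m (CRe \o f) /\ rint m (CIm \o f).
Definition cI f : R[i] := (\int[m]_x CRe (f x)) +i* (\int[m]_x CIm (f x)).

Lemma cin_meas f : cin f -> cmeas f.
Proof. by move=> [/rint_meas ? /rint_meas]. Qed.

Lemma eq_cI f g : f =1 g -> cI f = cI g.
Proof. by move=> /funext ->. Qed.

Lemma cin_dom f (g : T -> R) : cmeas f -> (forall x, cabs (f x) <= g x) ->
  rint m g -> cin f.
Proof.
move=> [m1 m2] fg ig; split; apply: rint_dom ig => // x /=;
  apply: le_trans (fg x); [exact: Re_le_cabs|exact: Im_le_cabs].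
Qed.

Lemma cin_cabs f : cin f -> rint m (fun x => cabs (f x)).
Proof.
move=> h; have [i1 i2] := h.
apply: rint_dom (rintD (rint_abs i1) (rint_abs i2)).
  exact: measurable_cabs (cin_meas h).
by move=> x; rewrite ger0_norm ?cabs_ge0//; exact: cabs_le.
Qed.

Lemma cin_real (u : T -> R) : rint m u -> cin (fun x => (u x)%:C).
Proof. by move=> h; split => //; exact: rint0. Qed.

Lemma cI_real (u : T -> R) : cI (fun x => (u x)%:C) = (\int[m]_x u x)%:C.
Proof. by rewrite /cI/= rI_0. Qed.

Lemma cI_D f g : cin f -> cin g -> cI (fun x => f x + g x) = cI f + cI g.
Proof.
move=> [f1 f2] [g1 g2]; apply: eqC => /=.
- by under eq_Rintegral do rewrite ReD; exact: rI_D.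
- by under eq_Rintegral do rewrite ImD; exact: rI_D.
Qed.

Lemma cinZ k f : cin f -> cin (fun x => k * f x).
Proof.
move=> [f1 f2]; split.
- under [X in rint _ X]funext do rewrite /= ReM.
  by apply: rintB; exact: rintZ.
- under [X in rint _ X]funext do rewrite /= ImM.
  by apply: rintD; exact: rintZ.
Qed.

Lemma cI_Z k f : cin f -> cI (fun x => k * f x) = k * cI f.
Proof.
move=> [f1 f2]; have [z1 z2] := (rintZ (CRe k) f1, rintZ (CIm k) f1).
have [z3 z4] := (rintZ (CRe k) f2, rintZ (CIm k) f2).
apply: eqC => /=; rewrite ?ReM ?ImM /=.
- under eq_Rintegral do rewrite ReM.
  by rewrite (rI_B z1 z4) (rI_Z _ f1) (rI_Z _ f2).
- under eq_Rintegral do rewrite ImM.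
  by rewrite (rI_D z3 z2) (rI_Z _ f1) (rI_Z _ f2).
Qed.

Lemma cinN f : cin f -> cin (fun x => - f x).
Proof.
by move=> /(cinZ (-1)); congr cin; apply/funext => x; rewrite mulN1r.
Qed.

Lemma cI_N f : cin f -> cI (fun x => - f x) = - cI f.
Proof.
by move=> h; rewrite -mulN1r -cI_Z//; apply: eq_cI => x; rewrite mulN1r.
Qed.

Lemma cI_B f g : cin f -> cin g -> cI (fun x => f x - g x) = cI f - cI g.
Proof. by move=> h1 h2; rewrite (cI_D h1 (cinN h2)) cI_N. Qed.

Lemma cin_sum (I : Type) (r : seq I) (F : I -> T -> R[i]) :
  (forall k, cin (F k)) -> cin (fun x => \sum_(k <- r) F k x).
Proof.
move=> h; split; [under [X in rint _ X]funext do rewrite /= Re_sum|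
   under [X in rint _ X]funext do rewrite /= Im_sum].
- by apply: rint_sum => k; case: (h k).
- by apply: rint_sum => k; case: (h k).
Qed.

Lemma cI_sum (I : Type) (r : seq I) (F : I -> T -> R[i]) :
  (forall k, cin (F k)) -> cI (fun x => \sum_(k <- r) F k x) = \sum_(k <- r) cI (F k).
Proof.
move=> h; apply: eqC; rewrite ?Re_sum ?Im_sum/=.
- under eq_Rintegral do rewrite Re_sum.
  by rewrite rI_sum// => k; case: (h k).
- under eq_Rintegral do rewrite Im_sum.
  by rewrite rI_sum// => k; case: (h k).
Qed.

(* Multiplying [f] by a unimodular constant makes its integral a nonnegative real. *)
Lemma cabs_cI f : cin f -> cabs (cI f) <= \int[m]_x cabs (f x).
Proof.
move=> h; have [->|z0] := eqVneq (cI f) 0.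
  rewrite cabs0; apply: Rintegral_ge0 => x _; exact: cabs_ge0.
rewrite -(@ler_pM2l _ (cabs (cI f))) ?cabs_gt0//.
have -> : cabs (cI f) * cabs (cI f) = CRe ((cI f)^* * cI f).
  by rewrite -expr2 ReIm_sq ReM; case: (cI f) => a b /=; ring.
rewrite -cI_Z//= -rI_Z; last exact: cin_cabs.
apply: rI_le.
- by case: (cinZ (cI f)^* h).
- by apply: rintZ; exact: cin_cabs.
- move=> x; apply: le_trans (le_trans (ler_norm _) (Re_le_cabs _)) _.
  by rewrite cabsM cabs_conj.
Qed.

Lemma cI_conj f : cin f -> cI (fun x => (f x)^*) = (cI f)^*.
Proof.
move=> [h1 h2]; apply: eqC => /=.
- by congr Rintegral; apply/funext => x; case: (f x).
- by rewrite -(rI_N h2); congr Rintegral; apply/funext => x /=; case: (f x).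
Qed.

Lemma cdct (f_ : nat -> T -> R[i]) f (g : T -> R) :
  (forall n, cmeas (f_ n)) ->
  (forall x, (fun n => CRe (f_ n x)) @ \oo --> CRe (f x)) ->
  (forall x, (fun n => CIm (f_ n x)) @ \oo --> CIm (f x)) ->
  rint m g -> (forall n x, cabs (f_ n x) <= g x) ->
  [/\ cin f, (fun n => CRe (cI (f_ n))) @ \oo --> CRe (cI f) &
     (fun n => CIm (cI (f_ n))) @ \oo --> CIm (cI f)].
Proof.
move=> mf_ c1 c2 ig fg.
have [i1 l1] := rdct (fun n => proj1 (mf_ n)) c1 ig
   (fun n x => le_trans (Re_le_cabs _) (fg n x)).
have [i2 l2] := rdct (fun n => proj2 (mf_ n)) c2 ig
   (fun n x => le_trans (Im_le_cabs _) (fg n x)).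
by split => //; split.
Qed.

End ComplexIntegral.

Section ComplexFubini.
Context d1 d2 (T1 : measurableType d1) (T2 : measurableType d2) (R : realType).
Variables (m1 : {sigma_finite_measure set T1 -> \bar R})
          (m2 : {sigma_finite_measure set T2 -> \bar R}).
Implicit Types (f : T1 * T2 -> R[i]).

Lemma cfubini1 f : cin (m1 \x m2)%E f ->
  cin m1 (fun x => cI m2 (fun y => f (x, y))) /\
  cI m1 (fun x => cI m2 (fun y => f (x, y))) = cI (m1 \x m2)%E f.
Proof.
by move=> [h1 h2]; have [? e1] := rfubini1 h1; have [? e2] := rfubini1 h2;
  split; [split|apply: eqC].
Qed.

Lemma cfubini2 f : cin (m1 \x m2)%E f ->
  cin m2 (fun y => cI m1 (fun x => f (x, y))) /\
  cI m2 (fun y => cI m1 (fun x => f (x, y))) = cI (m1 \x m2)%E f.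
Proof.
by move=> [h1 h2]; have [? e1] := rfubini2 h1; have [? e2] := rfubini2 h2;
  split; [split|apply: eqC].
Qed.

Lemma cmeas_param f : cmeas f -> cmeas (fun x => cI m2 (fun y => f (x, y))).
Proof.
by move=> [h1 h2]; split; [exact: (measurable_param m2 h1)|exact: (measurable_param m2 h2)].
Qed.

End ComplexFubini.

Lemma cvgn_uniq (R : realType) (u : nat -> R) (a b : R) :
  u @ \oo --> a -> u @ \oo --> b -> a = b.
Proof. exact: (cvg_unique (@Rhausdorff R)). Qed.

(** * Substitution on the real line *)

Section RealLine.
Variable R : realType.
Local Notation leb := (@lebesgue_measure R).
Implicit Types (f F G : R -> R) (x y : R).

Lemma itvn_cover x : exists N, forall n, (N <= n)%N -> x \in `[- n%:R, n%:R].
Proof.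
exists `|Num.ceil `|x| |%N => n hn; rewrite in_itv/= -ler_norml.
apply: le_trans (Num.Theory.ceil_ge _) _.
rewrite -(ler_nat R) in hn; apply: le_trans hn.
rewrite -[leRHS]/((`|Num.ceil `|x| |%N)%:~R) ler_int; exact: lez_abs.
Qed.

Lemma cvg_int_itv f : rint leb f ->
  (fun n => \int[leb]_(x in `[- n%:R, n%:R]) f x) @ \oo --> \int[leb]_x f x.
Proof.
move=> hf.
have [_ ] : rint leb f /\ (fun n => \int[leb]_x (f \_ `[- n%:R, n%:R]) x) @ \oo -->
    \int[leb]_x f x.
  apply: (rdct _ _ (rint_abs hf)).
  - move=> n; apply/measurable_restrict => //; apply: measurable_funTS; exact: rint_meas hf.
  - move=> x; have [N hN] := itvn_cover x; apply: cvg_near_cst.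
    exists N => // n /= /hN xn; rewrite patchE ifT// inE//.
  - move=> n x; rewrite patchE; case: ifP => // _; rewrite normr0//.
by under eq_fun do rewrite -Rintegral_mkcond.
Qed.

Lemma deriv_oo F F' a b : (forall x, is_derive x 1 F (F' x)) -> derivable_oo_LRcontinuous F a b.
Proof.
move=> h; have cF : continuous F by move=> x; exact: is_derive_continuous (h x).
split => [x _||].
- exact: ex_derive.
- exact/cvg_at_right_filter/cF.
- exact/cvg_at_left_filter/cF.
Qed.

Lemma ftc_itv f F a b : a < b -> continuous f -> (forall x, is_derive x 1 F (f x)) ->
  \int[leb]_(x in `[a, b]) f x = F b - F a.
Proof.
move=> ab cf hF; rewrite /Rintegral (continuous_FTC2 ab (continuous_subspaceT cf) (deriv_oo _ _ hF))//.
by move=> x _; rewrite derive1E; have := hF x => ?; exact: derive_val.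
Qed.

Lemma ftc_R f F l l' : rint leb f -> continuous f ->
  (forall x, is_derive x 1 F (f x)) ->
  (fun n => F n%:R) @ \oo --> l -> (fun n => F (- n%:R)) @ \oo --> l' ->
  \int[leb]_x f x = l - l'.
Proof.
move=> hf cf hF h1 h2.
have := cvg_int_itv hf; rewrite -(cvg_shiftn 1) => c1.
have : (fun n => F n%:R - F (- n%:R)) @ \oo --> l - l' by exact: cvgB.
rewrite -(cvg_shiftn 1) => c2.
apply: (cvgn_uniq c1); move: c2; apply: cvg_trans; apply: near_eq_cvg.
near=> n => /=; rewrite (@ftc_itv f F)// addn1 -subr_gt0 opprK addr_gt0//.
Unshelve. all: end_near. Qed.

Section Substitution.
Variables (F F' : R -> R) (D : set R).
Hypothesis hF : forall x, is_derive x 1 F (F' x).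
Hypothesis cF' : continuous F'.
Hypothesis incF : {homo F : x y / x < y}.
Hypothesis DE : D = \bigcup_n `[F (- n%:R), F n%:R]%classic.

Let mD : measurable D.
Proof. by rewrite DE; apply: bigcupT_measurable => n. Qed.

Let F'E : (derive1 F) = F'.
Proof. by apply/funext => x; rewrite derive1E; have := hF x => ?; exact: derive_val. Qed.

Let cF : continuous F.
Proof. by move=> x; exact: is_derive_continuous (hF x). Qed.

Let DF x : D (F x).
Proof.
have [N /(_ N (leqnn _))] := itvn_cover x; rewrite DE in_itv/= => /andP[h1 h2].
by exists N => //=; rewrite in_itv/=; apply/andP; split; exact: (ltW_homo incF).
Qed.

Let F'ge0 x : 0 <= F' x.
Proof.
rewrite -F'E; apply: (@incr_derive1_ge0 _ _ setT).
- by move=> z _; have := hF z => ?; exact: ex_derive.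
- by move=> ? ? _ _; exact: incF.
- by rewrite interiorT.
Qed.

(** The substitution is made on the compact intervals [[- n, n]], and monotone convergence is
    applied on both sides. This is why [D], the image of the line under [F], is given as an
    increasing union of intervals. *)
Lemma subst_ge0 G : (forall x, D x -> {for x, continuous G}) -> (forall x, 0 <= G x) ->
  (\int[leb]_(x in D) (G x)%:E = \int[leb]_x (G (F x) * F' x)%:E)%E.
Proof.
move=> cG G0.
have mGF : measurable_fun setT (fun x => G (F x) * F' x).
  apply: continuous_measurable_fun => x; apply: cvgM; last exact: cF'.
  apply: continuous_comp; [exact: cF|exact/cG/DF].
have sub n : `[F (- n%:R), F n%:R]%classic `<=` D by by rewrite DE => z hz; exists n.
have cGn n : {within `[F (- n%:R), F n%:R], continuous G}.
  by apply: continuous_in_subspaceT => x /set_mem/sub/cG.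
have e n : (\int[leb]_(x in `[F (- n%:R)%R, F n%:R%R]) (G x)%:E =
    \int[leb]_(x in `[(- n%:R)%R, n%:R%R]) (G (F x) * F' x)%:E)%E.
  rewrite integration_by_substitution_increasing//.
  - by rewrite F'E.
  - by rewrite -subr_ge0 opprK addr_ge0.
  - by move=> x y _ _; exact: incF.
  - by rewrite F'E => x _; exact: cF'.
  - by rewrite F'E; apply/cvg_ex; exists (F' (- n%:R)); exact/cvg_at_right_filter/cF'.
  - by rewrite F'E; apply/cvg_ex; exists (F' n%:R); exact/cvg_at_left_filter/cF'.
  - exact: deriv_oo hF.
have c1 : (fun n => \int[leb]_(x in `[F (- n%:R)%R, F n%:R%R]) (G x)%:E)%E @ \oo -->
    (\int[leb]_(x in D) (G x)%:E)%E.
  rewrite DE; apply: ge0_nondecreasing_set_cvg_integral => //.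
  - move=> n k nk; apply/subsetPset; apply: subset_itv; rewrite bnd_simp;
     apply: (ltW_homo incF); rewrite ?lerN2 ler_nat//.
  - move=> n; apply/measurable_EFinP; apply: subspace_continuous_measurable_fun => //.
  - by move=> n x _; rewrite lee_fin.
have c2 : (fun n => \int[leb]_(x in `[(- n%:R)%R, n%:R%R]) (G (F x) * F' x)%:E)%E @ \oo -->
    (\int[leb]_x (G (F x) * F' x)%:E)%E.
  rewrite (_ : setT = \bigcup_n `[(- n%:R)%R, n%:R%R]%classic :> set R).
    apply: ge0_nondecreasing_set_cvg_integral => //.
    - move=> n k nk; apply/subsetPset; apply: subset_itv; rewrite bnd_simp ?lerN2 ler_nat//.
    - by move=> n; apply/measurable_EFinP; apply: measurable_funTS.
    - by move=> n x _; rewrite lee_fin mulr_ge0.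
  by rewrite eqEsubset; split => // x _; have [N /(_ N (leqnn _))] := itvn_cover x; exists N.
apply: (cvg_unique (@ereal_hausdorff R) c1) => /=.
have -> : (fun n => \int[leb]_(x in `[F (- n%:R)%R, F n%:R%R]) (G x)%:E)%E =
   (fun n => \int[leb]_(x in `[(- n%:R)%R, n%:R%R]) (G (F x) * F' x)%:E)%E.
  by apply/funext.
exact: c2.
Qed.

Let subst_meas G : (forall x, D x -> {for x, continuous G}) ->
  measurable_fun D G.
Proof.
move=> cG; rewrite DE; apply/measurable_fun_bigcup => // n.
apply: subspace_continuous_measurable_fun => //.
apply: continuous_in_subspaceT => x /set_mem h; apply: cG; rewrite DE; exists n => //.
Qed.

(** Integrability is known for the pulled-back integrand and passes to [G] by [subst_ge0] for [|G|];
    the value follows from the positive and negative parts. *)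
Lemma subst_rint G : (forall x, D x -> {for x, continuous G}) ->
  rint leb (fun x => G (F x) * F' x) ->
  leb.-integrable D (EFin \o G) /\ \int[leb]_(x in D) G x = \int[leb]_x (G (F x) * F' x).
Proof.
move=> cG iG.
have cabs x : D x -> {for x, continuous (fun x => `|G x|)}.
  by move=> /cG c; apply: (@cvg_norm _ _ _ _ _ G).
have cp x : D x -> {for x, continuous G^\+}.
  by move=> /cG c; apply: (@continuous_max _ _ G (cst 0)) => //; exact: cvg_cst.
have cn x : D x -> {for x, continuous G^\-}.
  by move=> /cG c; apply: (@continuous_max _ _ (- G) (cst 0)) => //; [exact: cvgN|exact: cvg_cst].
have mG := subst_meas cG.
split.
  apply/integrableP; split; first exact/measurable_EFinP.
  move/integrableP : iG => [_]; congr (_ < _)%E.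
  rewrite [RHS](subst_ge0 cabs)//.
  by apply: eq_integral => x _ /=; rewrite normrM (ger0_norm (F'ge0 x)).
rewrite /Rintegral; congr fine; rewrite integralE [RHS]integralE; congr (_ - _)%E.
- transitivity (\int[leb]_(x in D) (G^\+ x)%:E)%E.
    by apply: eq_integral => x _; rewrite funeposE /= -EFin_max.
  rewrite subst_ge0//; apply: eq_integral => x _; rewrite funeposE /= -EFin_max /funrpos maxr_pMl//.
  by rewrite mul0r.
- transitivity (\int[leb]_(x in D) (G^\- x)%:E)%E.
    by apply: eq_integral => x _; rewrite funenegE /= -EFin_max.
  rewrite subst_ge0//; apply: eq_integral => x _; rewrite funenegE /= -EFin_max /funrneg maxr_pMl//.
  by rewrite mul0r mulNr.
Qed.

End Substitution.
End RealLine.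

(** * Hyperbolic functions and elementary inequalities *)

Section Hyperbolic.
Variable R : realType.
Implicit Types x y : R.

Lemma coshN x : cosh (- x) = cosh x.
Proof. by rewrite /cosh opprK addrC. Qed.

Lemma cosh0 : cosh 0 = 1 :> R.
Proof. by rewrite /cosh oppr0 expR0; field. Qed.

Lemma cosh_sq x : cosh x ^+ 2 = 1 + sinh x ^+ 2.
Proof.
have e : expR x * expR (- x) = 1 by rewrite -expRD subrr expR0.
by rewrite /cosh /sinh; field: e.
Qed.

Lemma cosh_gt0 x : 0 < cosh x.
Proof. by rewrite /cosh divr_gt0// addr_gt0 ?expR_gt0. Qed.

Lemma cosh_neq0 x : cosh x != 0.
Proof. by rewrite gt_eqF// cosh_gt0. Qed.

Lemma cosh_ge1 x : 1 <= cosh x.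
Proof.
by rewrite -(@ler_pXn2r _ 2)// ?nnegrE ?ler01 ?(ltW (cosh_gt0 x))// cosh_sq expr1n lerDl sqr_ge0.
Qed.

Lemma is_derive_expRN x : is_derive x 1 (fun t : R => expR (- t)) (- expR (- x)).
Proof.
rewrite (_ : (fun t : R => expR (- t)) = expR \o -%R)//.
by apply: is_derive_eq; rewrite /GRing.scale/= mulrN1.
Qed.

Lemma is_derive_cosh x : is_derive x 1 (@cosh R) (sinh x).
Proof.
rewrite (_ : @cosh R = (fun t => 2^-1 * (expR t + expR (- t)))); last first.
  by apply/funext => t; rewrite /cosh mulrC.
have h := is_derive_expRN x.
apply: is_derive_eq; rewrite /sinh /GRing.scale/=; ring.
Qed.

Lemma is_derive_sinh x : is_derive x 1 (@sinh R) (cosh x).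
Proof.
rewrite (_ : @sinh R = (fun t => 2^-1 * (expR t - expR (- t)))); last first.
  by apply/funext => t; rewrite /sinh mulrC.
have h := is_derive_expRN x.
apply: is_derive_eq; rewrite /cosh /GRing.scale/=; ring.
Qed.

Lemma continuous_cosh : continuous (@cosh R).
Proof. by move=> x; exact: is_derive_continuous (is_derive_cosh x). Qed.
Lemma continuous_sinh : continuous (@sinh R).
Proof. by move=> x; exact: is_derive_continuous (is_derive_sinh x). Qed.

Lemma cosh_ge_expR x : expR `|x| <= 2 * cosh x.
Proof.
have [h|h] := ler0P x; rewrite /cosh mulrC divfK//.
  by rewrite lerDr expR_ge0.
by rewrite lerDl expR_ge0.
Qed.

Lemma MVT_derive (f f' : R -> R) x y : x <= y -> (forall t : R, is_derive t 1 f (f' t)) ->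
  exists c, f y - f x = f' c * (y - x).
Proof.
move=> xy h.
have cf : continuous f by move=> t; exact: is_derive_continuous (h t).
by have [c _ e] := @MVT_segment R f f' x y xy (fun t _ => h t) (continuous_subspaceT cf); exists c.
Qed.

Lemma sinh0 : sinh 0 = 0 :> R.
Proof. by rewrite /sinh oppr0 subrr mul0r. Qed.

Lemma sinhN x : sinh (- x) = - sinh x.
Proof. by rewrite /sinh opprK -mulNr opprB. Qed.

Lemma sinh_ge x : 0 <= x -> x <= sinh x.
Proof.
move=> x0; have [c] := MVT_derive x0 is_derive_sinh.
by rewrite sinh0 !subr0 => ->; rewrite ler_peMl// cosh_ge1.
Qed.

Lemma sqr_le_sinh x : x ^+ 2 <= sinh x ^+ 2.
Proof.
wlog x0 : x / 0 <= x => [h|]; last by rewrite lerXn2r ?nnegrE ?sinh_ge// (le_trans x0 (sinh_ge x0)).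
have [/h//|/ltW] := leP 0 x; rewrite -oppr_ge0 => /h.
by rewrite sinhN !sqrrN.
Qed.

Lemma sqr_sin_le x : sin x ^+ 2 <= x ^+ 2.
Proof.
wlog x0 : x / 0 <= x => [h|].
  have [/h//|/ltW] := leP 0 x; rewrite -oppr_ge0 => /h.
  by rewrite sinN !sqrrN.
have [c] := MVT_derive x0 (fun t => is_derive_sin t).
rewrite sin0 !subr0 => ->; rewrite exprMn ler_piMl ?sqr_ge0//.
Qed.

Lemma oneB_cos_le x : 1 - cos x <= x ^+ 2 / 2.
Proof.
have -> : x = x / 2 + x / 2 by field.
rewrite cosD -!expr2; have := cos2Dsin2 (x / 2); have := sqr_sin_le (x / 2).
set a := sin _ ^+ 2; set b := cos _ ^+ 2; set c := (x / 2) ^+ 2 => h1 h2.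
have -> : (x / 2 + x / 2) ^+ 2 / 2 = 2 * c by rewrite /c; field.
lra.
Qed.

End Hyperbolic.

(** * The fundamental theorem of calculus on the line; substitutions for the half-line *)

Section LineIntegrals.
Variable R : realType.
Local Notation leb := (@lebesgue_measure R).
Implicit Types (f F G : R -> R) (x y : R).

(** For a nonnegative integrand the existence of both limits of a primitive already yields
    integrability, by monotone convergence. *)
Lemma ftc_ge0_R f F l l' : (forall x, 0 <= f x) -> continuous f ->
  (forall x, is_derive x 1 F (f x)) ->
  (fun n => F n%:R) @ \oo --> l -> (fun n => F (- n%:R)) @ \oo --> l' ->
  rint leb f /\ \int[leb]_x f x = l - l'.
Proof.
move=> f0 cf hF h1 h2.
have mf : measurable_fun setT f by exact: continuous_measurable_fun.
suff hi : rint leb f by split => //; exact: ftc_R h1 h2.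
have c2 : (fun n => \int[leb]_(x in `[(- n%:R)%R, n%:R%R]) (f x)%:E)%E @ \oo -->
    (\int[leb]_x (f x)%:E)%E.
  rewrite (_ : setT = \bigcup_n `[(- n%:R)%R, n%:R%R]%classic :> set R).
    apply: ge0_nondecreasing_set_cvg_integral => //.
    - move=> n k nk; apply/subsetPset; apply: subset_itv; rewrite bnd_simp ?lerN2 ler_nat//.
    - by move=> n; apply/measurable_EFinP; apply: measurable_funTS.
    - by move=> n x _; rewrite lee_fin.
  by rewrite eqEsubset; split => // x _; have [N /(_ N (leqnn _))] := itvn_cover x; exists N.
have c1 : (fun n => \int[leb]_(x in `[(- n%:R)%R, n%:R%R]) (f x)%:E)%E @ \oo -->
    (l - l')%:E.
  have : (fun n => (F n%:R - F (- n%:R))%:E) @ \oo --> (l - l')%:E.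
    by apply: cvg_EFin; [exact: nearW|exact: cvgB].
  apply: cvg_trans; apply: near_eq_cvg; exists 1%N => // n /= n1.
  rewrite (continuous_FTC2 (_ : - n%:R < n%:R) (continuous_subspaceT cf) (deriv_oo _ _ hF))//.
    by rewrite -subr_gt0 opprK addr_gt0 // ltr0n.
  by move=> x _; rewrite derive1E; have := hF x => ?; exact: derive_val.
have e := cvg_unique (@ereal_hausdorff R) c2 c1.
apply/integrableP; split; first exact/measurable_EFinP.
have -> : (fun x => `|(EFin \o f) x|%E) = (fun x => (f x)%:E).
  by apply/funext => x /=; rewrite ger0_norm.
by rewrite e ltry.
Qed.

Lemma rint_shift f a : continuous f -> rint leb f ->
  rint leb (fun x => f (x + a)) /\ \int[leb]_x f (x + a) = \int[leb]_x f x.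
Proof.
move=> cf hf.
have h x : is_derive x 1 (fun x => x - a) 1.
  by apply: is_derive_eq; rewrite ?oppr0 ?addr0 ?subr0.
have [] := @subst_rint R (fun x => x - a) (fun=> 1) setT h _ _ _ (fun x => f (x + a)).
- by move=> x; exact: cvg_cst.
- by move=> x y xy; rewrite ltrD2r.
- rewrite eqEsubset; split => // x _.
  have [N hN] := itvn_cover x; have [M hM] := itvn_cover a.
  have /hN := leq_addr M N; have /hM := leq_addl N M.
  exists (N + M + N + M)%N => //=; rewrite in_itv/=.
  move: (hN N (leqnn _)) (hM M (leqnn _)); rewrite !in_itv/= !natrD.
  by move=> /andP[? ?] /andP[? ?]; apply/andP; split; lra.
- move=> x _; apply: continuous_comp; last exact: cf.
  by apply: cvgD; [exact: cvg_id|exact: cvg_cst].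
- by move: hf; congr rint; apply/funext => x; rewrite mulr1 subrK.
move=> h1 ->; split => //.
by apply: eq_Rintegral => x _; rewrite mulr1 subrK.
Qed.

Lemma rintT f : leb.-integrable `]0, +oo[ (EFin \o f) <->
  rint leb (fun x => f x * \1_(`]0, +oo[%classic) x).
Proof.
have -> : (fun x => f x * \1_(`]0, +oo[%classic) x) = f \_ `]0, +oo[.
  by rewrite patch_indic.
have e : EFin \o (f \_ `]0, +oo[) = (EFin \o f) \_ `]0, +oo[.
  by apply/funext => x /=; rewrite !patchE; case: ifP.
rewrite /rint e; exact: integrable_mkcond.
Qed.

Lemma RintT f : \int[leb]_(x in `]0, +oo[) f x = \int[leb]_x (f x * \1_(`]0, +oo[%classic) x).
Proof. by rewrite Rintegral_mkcond patch_indic. Qed.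

Lemma cover_pos F : (forall x, 0 < F x) -> {homo F : x y / x < y} ->
  (forall y, 0 < y -> exists z, F z = y) ->
  `]0, +oo[%classic = \bigcup_n `[F (- n%:R), F n%:R]%classic.
Proof.
move=> F0 incF surF; rewrite eqEsubset; split => [y|y [n _]] /=; rewrite !in_itv/= ?andbT.
  move=> /surF[z <-]; have [N /(_ N (leqnn _))] := itvn_cover z.
  rewrite in_itv/= => /andP[h1 h2]; exists N => //=; rewrite in_itv/=.
  by apply/andP; split; exact: (ltW_homo incF).
by move=> /andP[h _]; exact: lt_le_trans (F0 _) h.
Qed.

Lemma cover_expR : `]0, +oo[%classic = \bigcup_n `[expR (- n%:R), expR n%:R]%classic :> set R.
Proof.
apply: cover_pos => [x|x y|y y0]; [exact: expR_gt0|by rewrite ltr_expR|].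
by exists (ln y); rewrite lnK.
Qed.

Lemma subst_expR G : (forall x, 0 < x -> {for x, continuous G}) ->
  rint leb (fun x => G (expR x) * expR x) ->
  leb.-integrable `]0, +oo[ (EFin \o G) /\
  \int[leb]_(x in `]0, +oo[) G x = \int[leb]_x (G (expR x) * expR x).
Proof.
move=> cG; apply: (@subst_rint R expR expR _ (fun x => is_derive_expR x)
  (@continuous_expR R) _ cover_expR).
- by move=> x y; rewrite ltr_expR.
- by move=> x /=; rewrite in_itv/= andbT; exact: cG.
Qed.

End LineIntegrals.

Section Basic.
Variable R : realType.
Local Notation leb := (@lebesgue_measure R).

Lemma cvg_expRn (k : R) : 0 < k -> (fun n => expR (k * n%:R)) @ \oo --> +oo.
Proof.
move=> k0; apply/cvgryPge => A.
exists `|Num.ceil (A / k)|%N => // n /= hn.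
apply: le_trans (expR_ge1Dx _); rewrite (le_trans _ (ler_wpDl ler01 (lexx _)))//.
rewrite mulrC -ler_pdivrMr//; apply: le_trans (Num.Theory.ceil_ge _) _.
rewrite -(ler_nat R) in hn; apply: le_trans hn.
rewrite -[leRHS]/((`|Num.ceil (A / k)|%N)%:~R) ler_int; exact: lez_abs.
Qed.

Lemma cvgV0 (u : nat -> R) : (forall n, 0 < u n) -> u @ \oo --> +oo ->
  (fun n => (u n)^-1) @ \oo --> 0.
Proof. by move=> u0 /(gtr0_cvgV0 (nearW _ u0)). Qed.

Lemma cvg_expRNn (k : R) : 0 < k -> (fun n => expR (k * - n%:R)) @ \oo --> 0.
Proof.
move=> k0.
rewrite (_ : (fun n => _) = (fun n => (expR (k * n%:R))^-1)); last first.
  by apply/funext => n /=; rewrite mulrN expRN.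
by apply: cvgV0 => [n|]; [exact: expR_gt0|exact: cvg_expRn].
Qed.

Lemma sech_int (k : R) : 0 < k ->
  rint leb (fun s => (cosh (k * s))^-1) /\ \int[leb]_s (cosh (k * s))^-1 = pi / k.
Proof.
move=> k0.
have d (s : R) : is_derive s 1 (fun s => 2 / k * atan (expR (k * s))) (cosh (k * s))^-1.
  have h1 : is_derive s 1 (fun s : R => expR (k * s)) (k * expR (k * s)).
    rewrite (_ : (fun s => _) = expR \o ( *%R k))//.
    by apply: is_derive_eq; rewrite /GRing.scale/=; ring.
  have h2 : is_derive s 1 (atan \o (fun s : R => expR (k * s)))
      (k * expR (k * s) / (1 + expR (k * s) ^+ 2)).
    by apply: is_derive_eq; rewrite /GRing.scale/=; ring.
  have := is_deriveZ (2 / k) h2.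
  rewrite /GRing.scale/=; move=> h3.
  apply: is_derive_eq; rewrite /cosh expRN.
  have e0 : expR (k * s) != 0 by rewrite gt_eqF ?expR_gt0.
  have e1 : 1 + expR (k * s) ^+ 2 != 0 by rewrite gt_eqF// ltr_wpDr ?sqr_ge0.
  by field; rewrite -expr2 addrC e0 e1 gt_eqF.
have -> : pi / k = 2 / k * (pi / 2) - 2 / k * 0 :> R by field; rewrite gt_eqF.
apply: (ftc_ge0_R _ _ d).
- by move=> s; rewrite invr_ge0 ltW// cosh_gt0.
- move=> s; apply: cvgV; first exact: cosh_neq0.
  apply: continuous_comp; last exact: continuous_cosh.
  exact: mulrl_continuous.
- apply: cvgMl_tmp; apply: (cvg_comp _ _ (cvg_expRn k0)); exact: cvgy_atan.
- apply: cvgMl_tmp; rewrite -[0 in X in _ --> X]atan0; apply: continuous_cvg; first exact: continuous_atan.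
  exact: cvg_expRNn.
Qed.

Lemma exp_int (k : R) : 0 < k ->
  rint leb (fun x => expR (- (k * x)) * \1_(`]0, +oo[%classic) x) /\
  \int[leb]_x (expR (- (k * x)) * \1_(`]0, +oo[%classic) x) = k^-1.
Proof.
move=> k0.
have d1 (s : R) : is_derive s 1 (fun s : R => - k^-1 * expR (- (k * expR s)))
    (expR (- (k * expR s)) * expR s).
  have h2 : is_derive s 1 (expR \o (fun s : R => - (k * expR s)))
     (expR (- (k * expR s)) * - (k * expR s)).
    apply: is_derive_eq; rewrite /GRing.scale/=; ring.
  have h3 := is_deriveZ (- k^-1) h2.
  apply: is_derive_eq; rewrite /GRing.scale/=; field; by rewrite gt_eqF.
have [i1 i2] : rint leb (fun s => expR (- (k * expR s)) * expR s) /\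
    \int[leb]_s (expR (- (k * expR s)) * expR s) = - k^-1 * 0 - (- k^-1 * 1).
  apply: (ftc_ge0_R _ _ d1).
  - by move=> s; rewrite mulr_ge0 ?expR_ge0.
  - move=> s; apply: cvgM; last exact: continuous_expR.
    apply: continuous_comp; last exact: continuous_expR.
    by apply: cvgN; apply: cvgMl_tmp; exact: continuous_expR.
  - apply: cvgMl_tmp.
    have := cvg_expRn ltr01; under eq_fun do rewrite mul1r; move=> h.
    have h2 : (fun n => (expR (k * expR n%:R))^-1) @ \oo --> (0:R).
      apply: cvgV0 => [n|]; first exact: expR_gt0.
      apply/cvgryPge => A; have /cvgryPge/(_ (A / k)) := h.
      apply: filterS => n hn; apply: le_trans (expR_ge1Dx _).
      rewrite (le_trans _ (ler_wpDl ler01 (lexx _)))//.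
      by rewrite mulrC -ler_pdivrMr.
    rewrite (_ : (fun n => _) = (fun n => (expR (k * expR n%:R))^-1))//.
    by apply/funext => n; rewrite expRN.
  - apply: cvgMl_tmp; have := cvg_expRNn ltr01; under eq_fun do rewrite mul1r; move=> h.
    have h2 : (fun n => - (k * expR (- n%:R))) @ \oo --> (0:R).
      by rewrite -[0]oppr0 -(mulr0 k); apply: cvgN; apply: cvgMl_tmp.
    have := continuous_cvg _ (@continuous_expR R 0) h2.
    by rewrite expR0; apply.
have [||h1 h2] := @subst_expR R (fun x => expR (- (k * x))); last 1 first.
- split; first exact/rintT.
  by rewrite -RintT h2 i2; ring.
- move=> x _; apply: continuous_comp; last exact: continuous_expR.
  by apply: cvgN; exact: mulrl_continuous.
- exact: i1.
Qed.

End Basic.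

(** * Shifting a line of integration *)

Section Shift.
Variable R : realType.
Local Notation leb := (@lebesgue_measure R).

(** The common dominator of the contour integrands. The half argument is dictated by Euler's
    integrand at real part 1/2, which decays at minus infinity only like exp(s/2). *)
Definition bsech (s : R) := (cosh (2^-1 * s))^-1.

Lemma bsech_gt0 s : 0 < bsech s.
Proof. by rewrite invr_gt0 cosh_gt0. Qed.

Lemma rint_bsech : rint leb bsech.
Proof. by have [] := @sech_int R 2^-1; rewrite ?invr_gt0. Qed.

Lemma bsechN s : bsech (- s) = bsech s.
Proof. by rewrite /bsech mulrN coshN. Qed.

Lemma cvg_bsech : (fun n => bsech n%:R) @ \oo --> 0.
Proof.
apply: cvgV0 => [n|]; first exact: cosh_gt0.
apply/cvgryPge => A.
have h0 : 0 < 2^-1 :> R by rewrite invr_gt0.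
have /cvgryPge h := cvg_expRn h0; have {h} := h (2 * A).
apply: filterS => n h; rewrite -(@ler_pM2l _ 2)//.
apply: (le_trans h); apply: le_trans (cosh_ge_expR _).
by rewrite ler_expR ler_norm.
Qed.

Lemma cvg_bsech_dom (u : R -> R) C : (forall s, `|u s| <= C * bsech s) ->
  ((fun n => u n%:R) @ \oo --> 0) /\ ((fun n => u (- n%:R)) @ \oo --> 0).
Proof.
move=> h.
have c1 : (fun n => C * bsech n%:R) @ \oo --> 0.
  by rewrite -(mulr0 C); apply: cvgMl_tmp; exact: cvg_bsech.
have c2 : (fun n => - (C * bsech n%:R)) @ \oo --> 0.
  by rewrite -[0]oppr0; exact: cvgN.
split; apply: (squeeze_cvgr _ c2 c1); apply: nearW => n; rewrite -ler_norml//.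
by apply: le_trans (h _) _; rewrite bsechN.
Qed.

(** The derivative is assumed only between [A] and [B] because the integrand [sexp] has poles at the
    heights pi/2 and - pi/2. *)
Lemma ftc_oo (f F : R -> R) A B a b : A < a -> a < b -> b < B ->
  (forall t : R, A < t < B -> is_derive t 1 F (f t)) ->
  (forall t, A < t < B -> {for t, continuous f}) ->
  \int[leb]_x (f x * \1_(`[a, b]%classic) x) = F b - F a.
Proof.
move=> Aa ab bB d c.
have sub t : t \in `[a, b] -> A < t < B.
  by rewrite in_itv/= => /andP[h1 h2]; rewrite (lt_le_trans Aa h1) (le_lt_trans h2 bB).
have cF t : A < t < B -> {for t, continuous F}.
  by move=> h; exact: is_derive_continuous (d _ h).
have cw : {within `[a, b], continuous f}.
  by apply: continuous_in_subspaceT => t /set_mem /sub /c.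
have dF : derivable_oo_LRcontinuous F a b.
  split => [x xab||].
  - have := d x; rewrite sub; last exact: subset_itv_oo_cc xab.
    by move=> /(_ isT) ?; exact: ex_derive.
  - by apply/cvg_at_right_filter/cF/sub; rewrite in_itv/= lexx ltW.
  - by apply/cvg_at_left_filter/cF/sub; rewrite in_itv/= lexx ltW.
have := continuous_FTC2 ab cw dF.
rewrite (_ : \int[leb]_x _ = \int[leb]_(x in `[a, b]) f x); last first.
  by rewrite [RHS]Rintegral_mkcond patch_indic.
rewrite /Rintegral => ->// x xab; rewrite derive1E.
have := d x; rewrite sub; last exact: subset_itv_oo_cc xab.
by move=> /(_ isT) ?; exact: derive_val.
Qed.

Lemma cI_derive (f f' : R -> R[i]) C : (forall s, cder f s (f' s)) -> ccont f' ->
  cin leb f' -> (forall s, cabs (f s) <= C * bsech s) -> cI leb f' = 0.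
Proof.
move=> h [c1 c2] [i1 i2] fC.
have [l1 l2] := cvg_bsech_dom (fun s => le_trans (Re_le_cabs _) (fC s)).
have [l3 l4] := cvg_bsech_dom (fun s => le_trans (Im_le_cabs _) (fC s)).
apply: eqC => /=.
- by rewrite (ftc_R i1 c1 (fun s => proj1 (h s)) l1 l2) subrr.
- by rewrite (ftc_R i2 c2 (fun s => proj2 (h s)) l3 l4) subrr.
Qed.

(* The real segment is moved to the parallel one at height [b]: the difference
   of the two integrals is the double integral of [i f'], whose horizontal
   integrals vanish. *)
Lemma cI_shift (f f' : R -> R -> R[i]) (A B a b C : R) :
  A < a -> a < b -> b < B ->
  (forall s t, A < t < B -> cder (f s) t ('i * f' s t)) ->
  (forall s t, A < t < B -> cder (f^~ t) s (f' s t)) ->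
  (forall t, A < t < B -> ccont (f'^~ t)) ->
  (forall s t, A < t < B -> {for t, continuous (CRe \o f' s)} /\
                            {for t, continuous (CIm \o f' s)}) ->
  cmeas (fun z : R * R => f' z.1 z.2) ->
  (forall t, cmeas (f^~ t)) ->
  (forall s t, A < t < B -> cabs (f s t) <= C * bsech s) ->
  (forall s t, A < t < B -> cabs (f' s t) <= C * bsech s) ->
  cI leb (f^~ a) = cI leb (f^~ b).
Proof.
move=> Aa ab bB d1 d2 c2 c1 mf' mf bf bf'.
have AaB : A < a < B by rewrite Aa (lt_trans ab bB).
have AbB : A < b < B by rewrite bB (lt_trans Aa ab).
have sub t : t \in `[a, b] -> A < t < B.
  by rewrite in_itv/= => /andP[h1 h2]; rewrite (lt_le_trans Aa h1) (le_lt_trans h2 bB).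
pose I : R -> R := \1_(`[a, b]%classic).
have mI : measurable_fun setT I by exact: measurable_indic.
have I01 t : I t = 0 \/ (I t = 1 /\ t \in `[a, b]).
  rewrite /I indicE; case: (boolP (t \in _)) => h; [right|by left].
  by split => //; move: h; rewrite inE.
pose g (z : R * R) : R[i] := (I z.2)%:C * f' z.1 z.2.
have mg : cmeas g.
  apply: cmeasM => //; apply: cmeas_real; exact: measurableT_comp mI _.
have iI : rint leb I by exact: integrable_indic_itv.
have bg z : cabs (g z) <= C * bsech z.1 * I z.2.
  rewrite /g cabsM cabs_real; have [->|[-> h]] := I01 z.2.
    by rewrite normr0 mul0r mulr0.
  by rewrite normr1 mul1r mulr1; exact/bf'/sub.
have ig : cin (leb \x leb)%E g.
  apply: (@cin_dom _ _ _ (leb \x leb)%E g (fun z => C * bsech z.1 * I z.2) mg bg).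
  have iC := rintZ C rint_bsech.
  have C0 : 0 <= C.
    have := le_trans (cabs_ge0 _) (bf 0 a AaB).
    by rewrite pmulr_lge0 ?bsech_gt0.
  apply: (@rint_prod12 _ _ _ _ _ leb leb _ (fun s => C * bsech s * \int[leb]_t I t)).
  - apply: measurable_funM; last exact: measurableT_comp mI _.
    by apply: measurableT_comp (rint_meas iC) _.
  - by move=> x /=; exact: rintZ.
  - move=> x /=; rewrite (_ : (fun y => _) = (fun y => C * bsech x * I y)).
      by rewrite rI_Z.
    apply/funext => y; have I0 : 0 <= I y by have [->|[->]] := I01 y.
    by rewrite ger0_norm// !mulr_ge0// ltW// bsech_gt0.
  - by under [X in rint _ X]funext do rewrite mulrC; exact: rintZ.
have [_ e1] := cfubini1 ig; have [_ e2] := cfubini2 ig.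
have z2 : cI leb (fun t => cI leb (fun s => g (s, t))) = 0.
  rewrite (_ : (fun t => _) = (fun=> 0)); first by apply: eqC; rewrite /= rI_0.
  apply/funext => t; rewrite /g/=; have [->|[-> h]] := I01 t.
    under [fun s => _]funext do rewrite mul0r.
    by apply: eqC; rewrite /= rI_0.
  under [fun s => _]funext do rewrite mul1r.
  apply: (cI_derive (f := f^~ t)) => [s|||].
  - exact/d2/sub.
  - exact/c2/sub.
  - apply: (@cin_dom _ _ _ leb _ (fun s => C * bsech s)).
    + by apply: (cmeas_comp mf' (h := fun s => (s, t))).
    + by move=> s; exact/bf'/sub.
    + exact: rintZ rint_bsech.
  - by move=> s; exact/bf/sub.
have C0 : 0 <= C.
  have := le_trans (cabs_ge0 _) (bf 0 a AaB).
  by rewrite pmulr_lge0 ?bsech_gt0.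
have igs s : cin leb (fun t => g (s, t)).
  apply: (@cin_dom _ _ _ leb _ (fun t => C * bsech s * I t)).
  - apply: (cmeas_comp mg (h := fun t => (s, t))); exact: (pair1_measurable s).
  - by move=> t; exact: bg (s, t).
  - exact: rintZ.
have z1 s : 'i * cI leb (fun t => g (s, t)) = f s b - f s a.
  rewrite -cI_Z//; apply: eqC; rewrite /= ?ReD ?ImD ?ReN ?ImN.
  - rewrite -(ftc_oo Aa ab bB (fun t h => proj1 (d1 s t h))).
      by apply: eq_Rintegral => t _; rewrite /g mulrCA ReZ mulrC.
    move=> t h; rewrite (_ : (fun t => _) = (fun t => - CIm (f' s t))).
      by apply: cvgN; case: (c1 s t h).
    by apply/funext => u; rewrite ReM /= mul0r mul1r sub0r.
  - rewrite -(ftc_oo Aa ab bB (fun t h => proj2 (d1 s t h))).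
      by apply: eq_Rintegral => t _; rewrite /g mulrCA ImZ mulrC.
    move=> t h; rewrite (_ : (fun t => _) = (fun t => CRe (f' s t))).
      by case: (c1 s t h).
    by apply/funext => u; rewrite ImM /= mul0r mul1r add0r.
have cf t : A < t < B -> cin leb (f^~ t).
  move=> h; apply: (@cin_dom _ _ _ leb _ (fun s => C * bsech s)); first exact: mf.
    by move=> s; exact: bf.
  exact: rintZ rint_bsech.
apply/esym/eqP; rewrite -subr_eq0 -cI_B; [|exact: cf..].
under eq_cI do rewrite -z1.
rewrite cI_Z; last by case: (cfubini1 ig).
by rewrite e1 -e2 z2 mulr0.
Qed.
End Shift.

(** * Growth bounds for the integrands of Euler and Macdonald *)

Section Contours.
Variable R : realType.
Local Notation leb := (@lebesgue_measure R).
Implicit Types (s t x tau : R) (c : R[i]).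

Lemma poly_exp_bound n (k : R) : 0 < k ->
  exists C, forall x, 0 <= x -> (1 + x) ^+ n * expR (- (k * x)) <= C.
Proof.
(* With this [d], d (1 + x) <= 1 + k x / (n + 1) <= exp(k x / (n + 1)), whose n-th power is at most
   exp(k x). The denominator n + 1 admits n = 0. *)
move=> k0; pose d : R := Num.min 1 (k / n.+1%:R).
have d0 : 0 < d by rewrite lt_min ltr01 divr_gt0.
exists (d ^- n) => x x0.
rewrite expRN -ler_pdivlMr ?invr_gt0 ?expR_gt0// invrK.
have h : (d * (1 + x)) ^+ n <= expR (k * x).
  apply: (@le_trans _ _ (expR (k / n.+1%:R * x) ^+ n)).
    rewrite lerXn2r ?nnegrE ?expR_ge0 ?mulr_ge0 ?(ltW d0) ?addr_ge0//.
    apply: le_trans (expR_ge1Dx _); rewrite mulrDr mulr1 lerD//.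
      by rewrite ge_min lexx.
    by rewrite ler_wpM2r// ge_min lexx orbT.
  rewrite -expRM_natl ler_expR.
  have -> : n%:R * (k / n.+1%:R * x) = (n%:R / n.+1%:R) * (k * x) by ring.
  rewrite ler_piMl ?mulr_ge0 ?(ltW k0)//.
  by rewrite ler_pdivrMr ?ltr0n// mul1r ler_nat.
by rewrite mulrC ler_pdivlMr ?exprn_gt0// mulrC -exprMn.
Qed.

Lemma cosh_half s : cosh (2^-1 * s) <= cosh s.
Proof.
have -> : cosh s = 2 * cosh (2^-1 * s) ^+ 2 - 1.
  rewrite /cosh; have -> : expR s = expR (2^-1 * s) ^+ 2.
    by rewrite -expRM_natl; congr expR; field.
  have -> : expR (- s) = expR (- (2^-1 * s)) ^+ 2.
    by rewrite -expRM_natl; congr expR; field.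
  have e : expR (2^-1 * s) * expR (- (2^-1 * s)) = 1 by rewrite -expRD subrr expR0.
  by field: e.
have := cosh_ge1 (2^-1 * s); nra.
Qed.

Lemma sech_le_bsech s : (cosh s)^-1 <= bsech s.
Proof. by rewrite lef_pV2 ?posrE ?cosh_gt0// cosh_half. Qed.

(** In the strip |t| < 1 the bound cos t >= 1/2 halves the decay, hence [2^-1]. The factor in front
    of the exponential pays for the logarithmic derivative of [mexp], and [g] is the real part of
    the linear coefficient. *)
Definition mdom (a b g : R) := exists C, forall s,
  (1 + (a * expR s + b * expR (- s))) *
   expR (- (2^-1 * (a * expR s + b * expR (- s))) + g * s) <= C * bsech s.

(** A second factor 1 + X is absorbed by exp(- X/2) as well, which leaves C / (1 + X), and X
    dominates a multiple of cosh s. *)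
Lemma mdom_pos a b : 0 < a -> 0 < b -> mdom a b 0.
Proof.
move=> a0 b0.
have h0 : 0 < 2^-1 :> R by rewrite invr_gt0.
have [C hC] := poly_exp_bound 2 h0.
pose m := Num.min a b; have m0 : 0 < m by rewrite lt_min a0.
exists (C / (2 * m)) => s; rewrite mul0r addr0.
set X := a * _ + _.
have X0 : 0 <= X by rewrite addr_ge0// mulr_ge0 ?expR_ge0 ?ltW.
have hX : 2 * m * cosh s <= X.
  have -> : 2 * m * cosh s = m * expR s + m * expR (- s) by rewrite /cosh; field.
  by rewrite lerD// ler_wpM2r ?expR_ge0// ge_min lexx ?orbT.
have X1 : 0 < 1 + X by lra.
have h := hC X X0.
apply: (@le_trans _ _ (C / (1 + X))).
  by rewrite ler_pdivlMr// mulrC mulrA -expr2.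
have C0 : 0 <= C by apply: le_trans h; rewrite mulr_ge0 ?expR_ge0 ?sqr_ge0.
rewrite -mulrA ler_wpM2l// -[bsech s]invrK -invfM lef_pV2 ?posrE//; last first.
  by rewrite !mulr_gt0// invr_gt0 bsech_gt0.
rewrite /bsech invrK; apply: le_trans (_ : X <= _); last by lra.
by apply: le_trans hX; rewrite ler_wpM2l ?cosh_half// mulr_ge0 ?ltW.
Qed.

Lemma expRM_le (g : R) s n : 0 <= g -> g <= n%:R -> expR (g * s) <= (1 + expR s) ^+ n.
Proof.
move=> g0 gn; have [s0|s0] := leP s 0.
  apply: (@le_trans _ _ 1); first by rewrite -expR0 ler_expR mulr_ge0_le0.
  by rewrite exprn_ege1// lerDl expR_ge0.
apply: (@le_trans _ _ (expR s ^+ n)).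
  by rewrite -expRM_natl ler_expR ler_wpM2r// ltW.
by rewrite lerXn2r ?nnegrE ?expR_ge0 ?addr_ge0 ?expR_ge0// lerDr.
Qed.

(** Multiplication by cosh(s/2) changes the exponent [g] into g + 1/2 and g - 1/2. Both are
    nonnegative, so both exponentials are at most a power of 1 + exp s, hence of 1 + X, and exp(-
    X/2) absorbs it. *)
Lemma mdom_gamma a g : 0 < a -> 2^-1 <= g -> mdom a 0 g.
Proof.
move=> a0 g0.
pose n := (`|Num.ceil (g + 1)|)%N.
have hn : g + 1 <= n%:R.
  apply: le_trans (Num.Theory.ceil_ge _) _.
  by rewrite -[leRHS]/(n%:~R) ler_int; exact: lez_abs.
have h0 : 0 < 2^-1 :> R by rewrite invr_gt0.
have [C hC] := poly_exp_bound n.+1 h0.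
pose K := 1 + a^-1.
have K0 : 0 < K by rewrite addr_gt0// invr_gt0.
exists (C * K ^+ n) => s; rewrite mul0r addr0.
set X := a * _.
have X0 : 0 <= X by rewrite mulr_ge0 ?expR_ge0 ?ltW.
have hK : 1 + expR s <= K * (1 + X).
  rewrite /K /X mulrDl !mul1r mulrDr mulr1 mulrA mulVf ?gt_eqF// mul1r.
  have := mulr_ge0 (ltW a0) (expR_ge0 s); have := expR_ge0 s.
  have : 0 <= a^-1 by rewrite invr_ge0 ltW.
  lra.
have hKn : (1 + expR s) ^+ n <= K ^+ n * (1 + X) ^+ n.
  rewrite -exprMn lerXn2r ?nnegrE ?addr_ge0 ?expR_ge0 ?mulr_ge0 ?(ltW K0) ?addr_ge0//.
rewrite ler_pdivlMr ?cosh_gt0// expRD.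
have -> : (1 + X) * (expR (- (2^-1 * X)) * expR (g * s)) * cosh (2^-1 * s) =
   (1 + X) * expR (- (2^-1 * X)) *
    ((expR ((g + 2^-1) * s) + expR ((g - 2^-1) * s)) / 2).
  have -> : (g + 2^-1) * s = g * s + 2^-1 * s by ring.
  have -> : (g - 2^-1) * s = g * s + - (2^-1 * s) by ring.
  rewrite !expRD /cosh; ring.
have h : (expR ((g + 2^-1) * s) + expR ((g - 2^-1) * s)) / 2 <= K ^+ n * (1 + X) ^+ n.
  apply: le_trans hKn.
  have h1 : expR ((g + 2^-1) * s) <= (1 + expR s) ^+ n by apply: expRM_le; lra.
  have h2 : expR ((g - 2^-1) * s) <= (1 + expR s) ^+ n by apply: expRM_le; lra.
  lra.
apply: le_trans (ler_wpM2l _ h) _; first by rewrite mulr_ge0 ?expR_ge0// addr_ge0.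
have := hC X X0; rewrite exprS => hh.
have -> : (1 + X) * expR (- (2^-1 * X)) * (K ^+ n * (1 + X) ^+ n) =
   (1 + X) * (1 + X) ^+ n * expR (- (2^-1 * X)) * K ^+ n by ring.
by rewrite ler_wpM2r// exprn_ge0// ltW.
Qed.

End Contours.

(** * Rotation of the ray of integration *)

Section Rotation.
Variable R : realType.
Local Notation leb := (@lebesgue_measure R).
Implicit Types (s t x tau : R) (c z : R[i]).

Definition cpt s t : R[i] := s%:C + 'i * t%:C.

Lemma cder_cpt1 s t : cder (cpt^~ t) s 1.
Proof.
apply: (cder_eq (cderD (cder_real (is_derive_id s 1)) (cder_cst ('i * t%:C) s))).
by rewrite addr0.
Qed.

Lemma cder_cpt2 s t : cder (cpt s) t 'i.
Proof.
apply: (cder_eq (cderD (cder_cst s%:C t) (cderZ 'i (cder_real (is_derive_id t 1))))).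
by rewrite add0r mulr1.
Qed.

Lemma Re_cpt s t : CRe (cpt s t) = s.
Proof. rewrite /cpt !ReImE/=; ring. Qed.
Lemma Im_cpt s t : CIm (cpt s t) = t.
Proof. rewrite /cpt !ReImE/=; ring. Qed.
Lemma cpt0 s : cpt s 0 = s%:C.
Proof. by rewrite /cpt mulr0 addr0. Qed.

Lemma cmeas_cpt : cmeas (fun z : R * R => cpt z.1 z.2).
Proof.
apply: cmeasD; first by apply: cmeas_real; exact: measurable_fst.
by apply: cmeasM; [exact: cmeas_cst|apply: cmeas_real; exact: measurable_snd].
Qed.

Section Mexp.
Variables (a b : R) (c : R[i]).
Hypotheses (a0 : 0 < a) (b0 : 0 <= b).

(* [mexp] covers both Euler's integrand (b = 0) and that of Macdonald's function. *)
Definition mexp z := cexp (- (a%:C * cexp z) - b%:C * cexp (- z) + c * z).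
Definition mexp' z := (- (a%:C * cexp z) + b%:C * cexp (- z) + c) * mexp z.

Lemma cder_mexp (u : R -> R[i]) x l : cder u x l ->
  cder (fun x => mexp (u x)) x (l * mexp' (u x)).
Proof.
move=> h; rewrite /mexp.
have h1 := cderN (cderZ a%:C (cder_cexp h)).
have h2 := cderN (cderZ b%:C (cder_cexp (cderN h))).
have h3 := cderZ c h.
apply: (cder_eq (cder_cexp (cderD (cderD h1 h2) h3))).
rewrite /mexp' /mexp; ring.
Qed.

Lemma cmeas_mexp d (T : measurableType d) (u : T -> R[i]) :
  cmeas u -> cmeas (fun w => mexp (u w)) /\ cmeas (fun w => mexp' (u w)).
Proof.
move=> mu_.
have m1 : cmeas (fun w => a%:C * cexp (u w)).
  by apply: cmeasM; [exact: cmeas_cst|exact: cmeas_cexp].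
have m2 : cmeas (fun w => b%:C * cexp (- u w)).
  by apply: cmeasM; [exact: cmeas_cst|apply: cmeas_cexp; exact: cmeasN].
have m3 : cmeas (fun w => mexp (u w)).
  apply: cmeas_cexp; apply: cmeasD.
    by apply: cmeasD; apply: cmeasN.
  by apply: cmeasM; [exact: cmeas_cst|].
split => //; apply: cmeasM => //; apply: cmeasD; last exact: cmeas_cst.
by apply: cmeasD => //; exact: cmeasN.
Qed.

Lemma cabs_mexp s t : cabs (mexp (cpt s t)) =
  expR (- ((a * expR s + b * expR (- s)) * cos t) + (CRe c * s - CIm c * t)).
Proof.
rewrite cabs_cexp; congr expR.
move: (cpt s t) (Re_cpt s t) (Im_cpt s t) => z <- <-.
rewrite !ReImE /cexp/= !ReImE cosN sinN; ring.
Qed.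

Lemma cos_ge_half t : -1 < t < 1 -> 2^-1 <= cos t.
Proof.
move=> h; have := oneB_cos_le t.
have : t ^+ 2 <= 1 by nra.
lra.
Qed.

Lemma cabs_mexp_le s t : -1 < t < 1 -> cabs (mexp (cpt s t)) <=
  expR `|CIm c| * expR (- (2^-1 * (a * expR s + b * expR (- s))) + CRe c * s).
Proof.
move=> h; rewrite cabs_mexp -expRD ler_expR.
have := cos_ge_half h.
have : 0 <= a * expR s + b * expR (- s) by rewrite addr_ge0// mulr_ge0 ?expR_ge0// ltW.
set X := _ + _ => X0 hc.
have h1 : - (CIm c * t) <= `|CIm c|.
  apply: le_trans (ler_norm _) _; rewrite normrN normrM ler_piMr//.
  by rewrite ler_norml; move/andP: h => [/ltW -> /ltW ->].
have : 2^-1 * X <= X * cos t by rewrite mulrC ler_wpM2l.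
lra.
Qed.

Hypothesis dom : mdom a b (CRe c).

Lemma mexp_bound : exists C, forall s t, -1 < t < 1 ->
  cabs (mexp (cpt s t)) <= C * bsech s /\ cabs (mexp' (cpt s t)) <= C * bsech s.
Proof.
have [C hC] := dom.
pose K := (1 + cabs c) * expR `|CIm c|.
exists (K * C) => s t h.
have h1 := cabs_mexp_le s h; have h2 := hC s.
move: h1 h2; set X := a * expR s + b * expR (- s); set E := expR (_ + _ * s) => h1 h2.
have X0 : 0 <= X by rewrite addr_ge0// mulr_ge0 ?expR_ge0// ltW.
have E0 : 0 <= E by exact: expR_ge0.
have I0 : 0 <= expR `|CIm c| by exact: expR_ge0.
have c0 := cabs_ge0 c.
have main : K * (1 + X) * E <= K * C * bsech s.
  rewrite -[K * (1 + X) * E]mulrA -[K * C * _]mulrA ler_wpM2l// mulr_ge0 ?addr_ge0//.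
have hf : cabs (mexp (cpt s t)) <= K * E.
  apply: le_trans h1 _; rewrite /K ler_wpM2r//.
  by rewrite ler_peMl// lerDl.
have K0 : 0 <= K by rewrite mulr_ge0 ?addr_ge0.
split.
  apply: le_trans hf (le_trans _ main).
  by rewrite ler_wpM2r// ler_peMr// lerDl.
apply: le_trans main.
rewrite /mexp' cabsM.
have h3 : cabs (- (a%:C * cexp (cpt s t)) + b%:C * cexp (- cpt s t) + c) <= X + cabs c.
  apply: le_trans (cabsD _ _) _; rewrite lerD2r; apply: le_trans (cabsD _ _) _.
  by rewrite cabsN !cabsM !cabs_real !cabs_cexp ReN Re_cpt !ger0_norm// ltW.
apply: (@le_trans _ _ ((X + cabs c) * (expR `|CIm c| * E))).
  by apply: ler_pM => //; exact: cabs_ge0.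
rewrite mulrA ler_wpM2r// /K mulrAC ler_wpM2r//.
nra.
Qed.

Lemma cin_mexp t : -1 < t < 1 -> cin leb (fun s => mexp (cpt s t)).
Proof.
move=> h; have [C hC] := mexp_bound.
apply: (@cin_dom _ _ _ leb _ (fun s => C * bsech s)).
- have := (cmeas_mexp cmeas_cpt).1 => m1.
  by apply: (cmeas_comp m1 (h := fun s => (s, t))).
- by move=> s; case: (hC s t h).
- exact: (rintZ C (@rint_bsech R)).
Qed.

(** Under the exponential map horizontal lines become rays from the origin, so moving the line to
    height [t] rotates the path of Euler's or Macdonald's integral by the angle [t]. *)
Lemma mexp_rot t : -1 < t < 1 ->
  cI leb (fun s => mexp (cpt s t)) = cI leb (fun s => mexp s%:C).
Proof.
move=> h.
under [in RHS]eq_cI do rewrite -cpt0.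
have [C hC] := mexp_bound.
have [m1 m2] := cmeas_mexp cmeas_cpt.
have cont (u : R -> R[i]) (l : R[i]) : (forall x, cder u x l) -> ccont (fun x => mexp' (u x)).
  move=> hu; rewrite /mexp'.
  have h1 x := cderN (cderZ a%:C (cder_cexp (hu x))).
  have h2 x := cderZ b%:C (cder_cexp (cderN (hu x))).
  exact: (cder_ccont (fun x => cderM (cderD (cderD (h1 x) (h2 x)) (cder_cst c x))
     (cder_mexp (hu x)))).
have key a1 b1 : -1 < a1 -> a1 < b1 -> b1 < 1 ->
    cI leb (fun s => mexp (cpt s a1)) = cI leb (fun s => mexp (cpt s b1)).
  move=> ha hab hb.
  apply: (@cI_shift R (fun s t => mexp (cpt s t)) (fun s t => mexp' (cpt s t)) (-1) 1 a1 b1 C) => //.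
  - move=> s t' _; exact: cder_mexp (cder_cpt2 s t').
  - move=> s t' _; rewrite -[mexp' _]mul1r; exact: cder_mexp (cder_cpt1 s t').
  - move=> t' _; exact: (cont _ _ (fun s => cder_cpt1 s t')).
  - move=> s t' _; have [c1 c2] := cont _ _ (fun t => cder_cpt2 s t).
    by split; [exact: c1|exact: c2].
  - by move=> t'; apply: (cmeas_comp m1 (h := fun s => (s, t'))).
  - by move=> s t' /(hC s)[].
  - by move=> s t' /(hC s)[].
have [t0|t0|->//] := ltgtP t 0.
- apply: key => //; by move/andP : h => [].
- apply/esym; apply: key => //; by move/andP : h => [].
Qed.

End Mexp.
End Rotation.

(** * The Fourier transform of the hyperbolic secant *)

Section SechFourier.
Variable R : realType.
Local Notation leb := (@lebesgue_measure R).
Implicit Types (s t x tau : R) (c z : R[i]).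

Definition csinh z : R[i] := (cexp z - cexp (- z)) / 2.

Lemma divC2 z : z / 2 = (2^-1)%:C * z.
Proof. by rewrite mulrC realCV realCn. Qed.

Lemma ReIm_ccosh s t : ccosh (cpt s t) = (cosh s * cos t) +i* (sinh s * sin t).
Proof.
apply: eqC; rewrite /ccosh divC2; move: (cpt s t) (Re_cpt s t) (Im_cpt s t) => z <- <-;
 rewrite ?ReZ ?ImZ !ReImE /cexp/= !ReImE ?cosN ?sinN /cosh /sinh; ring.
Qed.

Lemma ReIm_csinh s t : csinh (cpt s t) = (sinh s * cos t) +i* (cosh s * sin t).
Proof.
apply: eqC; rewrite /csinh divC2; move: (cpt s t) (Re_cpt s t) (Im_cpt s t) => z <- <-;
 rewrite ?ReZ ?ImZ !ReImE /cexp/= !ReImE ?cosN ?sinN /cosh /sinh; ring.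
Qed.

Lemma cabs_ccosh s t : cabs (ccosh (cpt s t)) ^+ 2 = sinh s ^+ 2 + cos t ^+ 2.
Proof.
rewrite ReIm_sq ReIm_ccosh /=; have := cosh_sq s; have := cos2Dsin2 t; nra.
Qed.

Lemma cabs_ccosh_ge s t d : 0 < d -> d <= cos t -> d * cosh s <= cabs (ccosh (cpt s t)).
Proof.
move=> d0 dc.
rewrite -(@ler_pXn2r _ 2)// ?nnegrE ?cabs_ge0 ?mulr_ge0 ?(ltW d0) ?(ltW (cosh_gt0 _))//.
rewrite cabs_ccosh exprMn cosh_sq.
have : cos t ^+ 2 <= 1 by have := cos2Dsin2 t; have := sqr_ge0 (sin t); lra.
have : d ^+ 2 <= cos t ^+ 2 by rewrite lerXn2r// ?nnegrE ltW// (lt_le_trans d0).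
have := sqr_ge0 (sinh s); nra.
Qed.

Lemma cabs_csinh s t : cabs (csinh (cpt s t)) <= cosh s.
Proof.
rewrite -(@ler_pXn2r _ 2)// ?nnegrE ?cabs_ge0 ?(ltW (cosh_gt0 _))//.
rewrite ReIm_sq ReIm_csinh/= [(sinh s * _) ^+ 2]exprMn [(cosh s * _) ^+ 2]exprMn !cosh_sq.
have := cos2Dsin2 t; have := sqr_ge0 (sinh s); nra.
Qed.

Lemma cder_ccosh (u : R -> R[i]) x l : cder u x l -> cder (fun x => ccosh (u x)) x (l * csinh (u x)).
Proof.
move=> h; have := cderM (cderD (cder_cexp h) (cder_cexp (cderN h))) (cder_cst 2^-1 x).
by move/cder_eq; apply; rewrite /csinh; ring.
Qed.

Lemma cder_csinh (u : R -> R[i]) x l : cder u x l -> cder (fun x => csinh (u x)) x (l * ccosh (u x)).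
Proof.
move=> h; have := cderM (cderD (cder_cexp h) (cderN (cder_cexp (cderN h)))) (cder_cst 2^-1 x).
by move/cder_eq; apply; rewrite /ccosh; ring.
Qed.

Section Fix.
Variable tau : R.

Definition sexp z := cexp ('i * tau%:C * z) * (ccosh z)^-1.
Definition sexp' z := ('i * tau%:C - csinh z * (ccosh z)^-1) * sexp z.

Lemma cder_sexp (u : R -> R[i]) x l : ccosh (u x) != 0 -> cder u x l ->
  cder (fun x => sexp (u x)) x (l * sexp' (u x)).
Proof.
move=> n0 h; have := cderM (cder_cexp (cderZ ('i * tau%:C) h)) (cderV n0 (cder_ccosh h)).
by move/cder_eq; apply; rewrite /sexp' /sexp; field.
Qed.

Lemma cder_sexp' (u : R -> R[i]) x l : ccosh (u x) != 0 -> cder u x l ->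
  exists k, cder (fun x => sexp' (u x)) x k.
Proof.
move=> n0 h.
have h1 := cderM (cder_csinh h) (cderV n0 (cder_ccosh h)).
by eexists; exact: (cderM (cderD (cder_cst ('i * tau%:C) x) (cderN h1)) (cder_sexp n0 h)).
Qed.

Lemma cmeas_sexp d (T : measurableType d) (u : T -> R[i]) :
  cmeas u -> cmeas (fun w => sexp (u w)) /\ cmeas (fun w => sexp' (u w)).
Proof.
move=> m.
have m1 := cmeas_cexp m; have m2 := cmeas_cexp (cmeasN m).
have mc : cmeas (fun w => (ccosh (u w))^-1).
  by apply: cmeasV; apply: cmeasM; [exact: cmeasD|exact: cmeas_cst].
have ms : cmeas (fun w => csinh (u w)).
  by apply: cmeasM; [apply: cmeasD => //; exact: cmeasN|exact: cmeas_cst].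
have mx : cmeas (fun w => sexp (u w)).
  apply: cmeasM => //; apply: cmeas_cexp; apply: cmeasM => //; exact: cmeas_cst.
split; first exact: mx.
apply: cmeasM mx; apply: cmeasD; first exact: cmeas_cst.
by apply: cmeasN; exact: cmeasM.
Qed.

Lemma cos_ge_in x t : 0 < x -> x < pi / 2 -> - x < t < x -> cos x <= cos t.
Proof.
move=> x0 x1 tx.
have -> : cos t = cos `|t|.
  by have [|] := ler0P t; rewrite ?cosN.
have tx' : `|t| < x by rewrite ltr_norml.
rewrite ltW// ltr_cos// in_itv/= ?normr_ge0 ?(ltW x0)/=.
- by apply: le_trans (ltW tx') _; have := pi_gt0 R; lra.
- by have := pi_gt0 R; lra.
Qed.

Lemma sexp_bound x : 0 < x -> x < pi / 2 -> exists C, forall s t, - x < t < x ->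
  [/\ ccosh (cpt s t) != 0, cabs (sexp (cpt s t)) <= C * bsech s &
      cabs (sexp' (cpt s t)) <= C * bsech s].
Proof.
move=> x0 x1; set d := cos x.
have d0 : 0 < d by apply: cos_gt0_pihalf; rewrite x1 andbT; have := pi_gt0 R; lra.
pose K := expR (`|tau| * x) / d.
exists ((1 + `|tau| + d^-1) * K) => s t tx.
have hc := cabs_ccosh_ge s d0 (cos_ge_in x0 x1 tx).
have c0 := cosh_gt0 s.
have p0 : 0 < d * cosh s by rewrite mulr_gt0.
have a0 : 0 < cabs (ccosh (cpt s t)) by apply: lt_le_trans hc.
have K0 : 0 <= K by rewrite divr_ge0 ?expR_ge0// ltW.
have hi : (cabs (ccosh (cpt s t)))^-1 <= d^-1 / cosh s.
  by rewrite -invfM lef_pV2 ?posrE.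
have he : cabs (sexp (cpt s t)) <= K * bsech s.
  rewrite /sexp cabsM cabsV cabs_cexp /K.
  apply: (@le_trans _ _ (expR (`|tau| * x) * (d^-1 / cosh s))).
    apply: ler_pM => //.
      by rewrite invr_ge0 cabs_ge0.
    have -> : CRe ('i * tau%:C * cpt s t) = - (tau * t).
      by move: (cpt s t) (Im_cpt s t) => z <-; rewrite !ReImE/=; ring.
    rewrite ler_expR.
    have : `|tau * t| <= `|tau| * x.
      by rewrite normrM ler_wpM2l// ltW// ltr_norml.
    rewrite ler_norml => /andP[h1 h2]; lra.
  rewrite -mulrA ler_wpM2l ?expR_ge0// ler_wpM2l ?invr_ge0 ?(ltW d0)//.
  exact: sech_le_bsech.
have B0 := ltW (bsech_gt0 s).
have d1 : 0 <= d^-1 by rewrite invr_ge0 ltW.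
have KB : 0 <= K * bsech s by rewrite mulr_ge0.
split.
- by rewrite -cabs_gt0.
- apply: le_trans he _; rewrite -[leRHS]mulrA ler_peMl//.
  by have := normr_ge0 tau; lra.
- rewrite /sexp' cabsM -[leRHS]mulrA; apply: ler_pM => //; try exact: cabs_ge0.
  apply: le_trans (cabsB _ _) _; apply: lerD.
    rewrite cabsM cabs_real; have -> : cabs ('i : R[i]) = 1.
      by rewrite cabsE/= expr0n/= add0r expr1n sqrtr1.
    by rewrite mul1r lerDr.
  rewrite cabsM cabsV; apply: le_trans (ler_pM (cabs_ge0 _) _ (cabs_csinh _ _) hi) _.
    by rewrite invr_ge0 cabs_ge0.
  by rewrite mulrCA mulfV ?mulr1// gt_eqF.
Qed.

Lemma sexp_shift x : 0 < x -> x < pi / 2 ->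
  [/\ cin leb (fun s => sexp (cpt s x)), cin leb (fun s => sexp (cpt s (- x))),
   cin leb (fun s => sexp (cpt s 0)),
   cI leb (fun s => sexp (cpt s x)) = cI leb (fun s => sexp (cpt s 0)) &
   cI leb (fun s => sexp (cpt s (- x))) = cI leb (fun s => sexp (cpt s 0))].
Proof.
(* The midpoint of [x] and pi/2 gives an open strip, free of poles, that contains both lines at
   heights [x] and [- x]. *)
move=> x0 x1; pose y := (x + pi / 2) / 2.
have xy : x < y by rewrite /y; lra.
have y0 : 0 < y by rewrite (lt_trans x0).
have y1 : y < pi / 2 by rewrite /y; lra.
have [C hC] := sexp_bound y0 y1.
have [m1 m2] := cmeas_sexp (@cmeas_cpt R).
have key a1 b1 : - y < a1 -> a1 < b1 -> b1 < y ->
    cI leb (fun s => sexp (cpt s a1)) = cI leb (fun s => sexp (cpt s b1)).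
  move=> ha hab hb.
  apply: (@cI_shift R (fun s t => sexp (cpt s t)) (fun s t => sexp' (cpt s t)) (- y) y a1 b1 C ha hab hb).
  - by move=> s t' /(hC s)[n0 _ _]; exact: (@cder_sexp (cpt s) t' 'i n0 (cder_cpt2 s t')).
  - move=> s t' /(hC s)[n0 _ _]; have := @cder_sexp (fun s => cpt s t') s 1 n0 (cder_cpt1 s t'); rewrite mul1r; exact.
  - move=> t' ht; split => s; have [n0 _ _] := hC s t' ht;
     have [k [k1 k2]] := @cder_sexp' (fun s => cpt s t') s 1 n0 (cder_cpt1 s t').
    + exact: is_derive_continuous k1.
    + exact: is_derive_continuous k2.
  - move=> s t' ht; have [n0 _ _] := hC s t' ht.
    have [k [k1 k2]] := @cder_sexp' (cpt s) t' 'i n0 (cder_cpt2 s t').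
    by split; [exact: is_derive_continuous k1|exact: is_derive_continuous k2].
  - exact: m2.
  - by move=> t'; apply: (cmeas_comp m1 (h := fun s => (s, t'))).
  - by move=> s t' /(hC s)[].
  - by move=> s t' /(hC s)[].
have ci t : - y < t < y -> cin leb (fun s => sexp (cpt s t)).
  move=> ht; apply: (@cin_dom _ _ _ leb _ (fun s => C * bsech s)).
  - by apply: (cmeas_comp m1 (h := fun s => (s, t))).
  - by move=> s; case: (hC s t ht).
  - exact: (rintZ C (@rint_bsech R)).
split; [apply: ci; lra|apply: ci; lra|apply: ci; lra|apply/esym/key; lra|apply: key; lra].
Qed.

End Fix.
End SechFourier.

Section SechValue.
Variable R : realType.
Local Notation leb := (@lebesgue_measure R).
Implicit Types (s t x tau : R) (c z : R[i]).

Lemma ReIm_sexp tau s t (N := sinh s ^+ 2 + cos t ^+ 2) :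
  CRe (sexp tau (cpt s t)) = expR (- (tau * t)) *
    (cos (tau * s) * (cosh s * cos t / N) + sin (tau * s) * (sinh s * sin t / N)).
Proof.
have hN : N = CRe (ccosh (cpt s t)) ^+ 2 + CIm (ccosh (cpt s t)) ^+ 2.
  by rewrite /N -ReIm_sq cabs_ccosh.
have e : 'i * tau%:C * cpt s t = (- (tau * t)) +i* (tau * s).
  by apply: eqC; move: (cpt s t) (Re_cpt s t) (Im_cpt s t) => z <- <-; rewrite !ReImE/=; ring.
rewrite /sexp e ReM ReV ImV -hN ReIm_ccosh /cexp/=; ring.
Qed.

Lemma rint_cos_sech tau : rint leb (fun s => cos (tau * s) / cosh s).
Proof.
have [h _] := @sech_int R 1 ltr01.
have h' : rint leb (fun s => (cosh s)^-1).
  by move: h; congr rint; apply/funext => s; rewrite mul1r.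
apply: rint_dom h'.
- apply: measurable_funM; last first.
    by apply: measurable_funV; apply: continuous_measurable_fun; exact: continuous_cosh.
  apply: measurableT_comp; first exact: measurable_cos.
  exact: mulrl_measurable.
- move=> s; rewrite normrM normfV (gtr0_norm (cosh_gt0 s)) ler_piMl ?cos_max//.
  by rewrite invr_ge0 ltW// cosh_gt0.
Qed.

Section Value.
Variable tau : R.
Let F := \int[leb]_s (cos (tau * s) / cosh s).
(** A Poisson-type kernel. Its mass is pi for every [x], and it concentrates at s = 0 as [x] tends
    to pi/2; it replaces the residue of sech at the pole i pi/2. *)
Let P x s := cosh s * cos x / (sinh s ^+ 2 + cos x ^+ 2).

Let half : (0 : R) < pi / 2. Proof. by rewrite divr_gt0// pi_gt0. Qed.

Let cos0 x : 0 < x -> x < pi / 2 -> 0 < cos x.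
Proof. by move=> x0 x1; apply: cos_gt0_pihalf; rewrite x1 andbT; lra. Qed.

Let Nneq0 x s : 0 < x -> x < pi / 2 -> 0 < sinh s ^+ 2 + cos x ^+ 2.
Proof.
move=> x0 x1; apply: ltr_wpDl; first exact: sqr_ge0.
by rewrite exprn_gt0// cos0.
Qed.

Let F0 : CRe (cI leb (fun s => sexp tau (cpt s 0))) = F.
Proof.
apply: eq_Rintegral => s _; rewrite ReIm_sexp mulr0 oppr0 expR0 trigo.cos0 sin0.
rewrite expr1n [sinh s ^+ 2 + 1]addrC -cosh_sq.
have h := cosh_neq0 s.
by field.
Qed.

Let poisson x : 0 < x -> x < pi / 2 ->
  rint leb (P x) /\ \int[leb]_s P x s = pi.
Proof.
move=> x0 x1; have c0 := cos0 x0 x1.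
have d s : is_derive s 1 (fun s => atan ((cos x)^-1 * sinh s)) (P x s).
  have h1 := is_deriveZ (cos x)^-1 (is_derive_sinh s).
  have h2 : is_derive s 1 (atan \o ((cos x)^-1 \*: @sinh R))
      (((cos x)^-1 *: cosh s) / (1 + ((cos x)^-1 * sinh s) ^+ 2)).
    by apply: is_derive_eq; rewrite /GRing.scale/=; ring.
  have e : ((cos x)^-1 *: cosh s) / (1 + ((cos x)^-1 * sinh s) ^+ 2) = P x s.
    rewrite /P /GRing.scale/=; have := Nneq0 s x0 x1 => N0.
    have e2 : 1 + ((cos x)^-1 * sinh s) ^+ 2 = (sinh s ^+ 2 + cos x ^+ 2) / cos x ^+ 2.
      by field; rewrite gt_eqF.
    by rewrite e2; field; rewrite !gt_eqF.
  by rewrite -e.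
have lim : (fun n => (cos x)^-1 * sinh n%:R) @ \oo --> +oo.
  apply/cvgryPge => A; near=> n.
  rewrite mulrC ler_pdivlMr//.
  apply: (@le_trans _ _ n%:R); last by rewrite sinh_ge.
  by near: n; exact: nbhs_infty_ger.
have -> : pi = pi / 2 - - (pi / 2) :> R by field.
apply: (ftc_ge0_R _ _ d).
- move=> s; rewrite /P divr_ge0 ?(ltW (Nneq0 _ _ _))// mulr_ge0 ?(ltW c0)//.
  by rewrite ltW// cosh_gt0.
- move=> s; apply: cvgM.
    by apply: cvgM; [exact: continuous_cosh|exact: cvg_cst].
  apply: cvgV; first by rewrite gt_eqF// Nneq0.
  apply: cvgD; last exact: cvg_cst.
  by apply: cvgM; exact: continuous_sinh.
- exact: (cvg_comp _ _ lim (@cvgy_atan R)).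
- rewrite (_ : (fun n => _) = (fun n => - atan ((cos x)^-1 * sinh n%:R))); last first.
    by apply/funext => n; rewrite sinhN mulrN atanN.
  by apply: cvgN; exact: (cvg_comp _ _ lim (@cvgy_atan R)).
Unshelve. all: end_near. Qed.

Let P0 x s : 0 < x -> x < pi / 2 -> 0 <= P x s.
Proof.
move=> x0 x1.
rewrite /P divr_ge0 ?(ltW (Nneq0 _ _ _))// mulr_ge0 ?(ltW (cosh_gt0 _))//.
exact: ltW (cos0 x0 x1).
Qed.

(** The integrals over the lines at heights [x] and [- x] agree with [F]. Weighted with exp(tau x)
    and exp(- tau x), their sine terms cancel and the cosine terms add up. *)
Let F_P x : 0 < x -> x < pi / 2 -> rint leb (fun s => cos (tau * s) * P x s) /\
  cosh (tau * x) * F = \int[leb]_s (cos (tau * s) * P x s).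
Proof.
move=> x0 x1; have [i1 i2 i0 e1 e2] := sexp_shift tau x0 x1.
have [iP _] := poisson x0 x1.
have iC : rint leb (fun s => cos (tau * s) * P x s).
  apply: (rint_dom _ _ iP).
    apply: measurable_funM; last exact: rint_meas iP.
    by apply: measurableT_comp; [exact: measurable_cos|exact: mulrl_measurable].
  by move=> s; rewrite normrM (ger0_norm (P0 s x0 x1)) ler_piMl ?P0// cos_max.
split => //.
have h1 := congr1 CRe e1; have h2 := congr1 CRe e2.
move: h1 h2; rewrite F0 => h1 h2.
have j1 : rint leb (fun s => CRe (sexp tau (cpt s x))) by case: i1.
have j2 : rint leb (fun s => CRe (sexp tau (cpt s (- x)))) by case: i2.
have k1 := rintZ (expR (tau * x)) j1; have k2 := rintZ (expR (- (tau * x))) j2.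
have -> : cosh (tau * x) * F = 2^-1 * (expR (tau * x) * F + expR (- (tau * x)) * F).
  by rewrite /cosh; field.
rewrite -{1}h1 -h2 /cI/=.
transitivity (2^-1 * \int[leb]_s (expR (tau * x) * CRe (sexp tau (cpt s x)) +
    expR (- (tau * x)) * CRe (sexp tau (cpt s (- x))))).
  by rewrite (rI_D k1 k2) (rI_Z _ j1) (rI_Z _ j2).
rewrite -(rI_Z _ (rintD k1 k2)).
apply: eq_Rintegral => s _.
rewrite !ReIm_sexp cosN sinN mulrN opprK !mulrA -!expRD subrr addNr expR0 /P.
by field; rewrite gt_eqF// Nneq0.
Qed.

(** The kernel peaks at 0, where 1 - cos(tau s) vanishes to second order; their product is therefore
    at most a constant times cos x / cosh s. *)
Let F_bound x : 0 < x -> x < pi / 2 ->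
  `|cosh (tau * x) * F - pi| <= cos x * ((tau ^+ 2 / 2 + 2) * pi).
Proof.
move=> x0 x1; have [iC ->] := F_P x0 x1; have [iP ePi] := poisson x0 x1.
have c0 := cos0 x0 x1.
have [iS eS] := @sech_int R 1 ltr01.
rewrite -{1}ePi -rI_B//; apply: le_trans (le_normr_Rintegral _ _) _ => //.
  exact: rintB.
rewrite divr1 in eS; rewrite -eS.
rewrite -!rI_Z//; last exact: rintZ.
apply: rI_le.
- by apply: rint_abs; exact: rintB.
- by do 2!apply: rintZ.
move=> s; rewrite mul1r -{2}[P x s]mul1r -mulrBl normrM distrC.
rewrite (@ger0_norm _ (1 - _)) ?subr_ge0 ?cos_le1//.
rewrite ger0_norm ?P0//.
have C0 := cosh_gt0 s; have S0 := sqr_ge0 (sinh s); have ch := cosh_sq s.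
have N0 := Nneq0 s x0 x1.
have b1 := oneB_cos_le (tau * s); have b2 := sqr_le_sinh s.
have b3 : 1 - cos (tau * s) <= 2 by have := cos_geN1 (tau * s); lra.
have b0 : 0 <= 1 - cos (tau * s) by rewrite subr_ge0 cos_le1.
have key : (1 - cos (tau * s)) * cosh s ^+ 2 <= (tau ^+ 2 / 2 + 2) * (sinh s ^+ 2 + cos x ^+ 2).
  have h : 1 - cos (tau * s) <= tau ^+ 2 / 2 * sinh s ^+ 2.
    apply: le_trans b1 _; rewrite exprMn mulrAC ler_wpM2l// divr_ge0 ?sqr_ge0//.
  have h2 : (1 - cos (tau * s)) * sinh s ^+ 2 <= 2 * sinh s ^+ 2 by rewrite ler_wpM2r.
  have h3 : 0 <= (tau ^+ 2 / 2 + 2) * cos x ^+ 2.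
    by rewrite mulr_ge0 ?sqr_ge0// addr_ge0// divr_ge0 ?sqr_ge0.
  rewrite ch mulrDr mulr1 mulrDr mulrDl.
  lra.
rewrite /P; have -> : (1 - cos (tau * s)) * (cosh s * cos x / (sinh s ^+ 2 + cos x ^+ 2)) =
   cos x * ((1 - cos (tau * s)) * cosh s / (sinh s ^+ 2 + cos x ^+ 2)) by field; rewrite gt_eqF.
rewrite ler_wpM2l ?(ltW c0)// ler_pdivrMr// mulrAC ler_pdivlMr//.
by rewrite -mulrA -expr2.
Qed.

Lemma sech_fourier : \int[leb]_s (cos (tau * s) / cosh s) = pi / cosh (tau * (pi / 2)).
Proof.
rewrite -/F; apply: (mulfI (cosh_neq0 (tau * (pi / 2)))).
rewrite [RHS]mulrCA mulfV ?cosh_neq0// mulr1.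
apply/eqP; rewrite -subr_eq0 -normr_le0.
(* The shift by 2 in the denominator keeps [u n] strictly between 0 and pi/2 for every n, including
   0. *)
pose u n : R := pi / 2 - (pi / 2) * n.+2%:R^-1.
have un : u @ \oo --> pi / 2.
  rewrite -[X in _ --> X]subr0; apply: cvgB; first exact: cvg_cst.
  rewrite -(mulr0 (pi / 2)); apply: cvgMl_tmp.
  apply: cvgV0 => [n|]; first by rewrite ltr0n.
  apply/cvgryPge => A; near=> n; apply: (@le_trans _ _ n%:R); last by rewrite ler_nat -addn2 leq_addr.
  by near: n; exact: nbhs_infty_ger.
have u0 n : 0 < u n.
  by rewrite subr_gt0 ltr_pdivrMr ?ltr0n// ltr_pMr// ltr1n.
have u1 n : u n < pi / 2 by rewrite ltrBlDr ltrDl divr_gt0// ltr0n.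
have c1 : (fun n => `|cosh (tau * u n) * F - pi|) @ \oo --> `|cosh (tau * (pi / 2)) * F - pi|.
  apply: cvg_norm; apply: cvgB; last exact: cvg_cst.
  apply: cvgMr_tmp; apply: continuous_cvg; first exact: continuous_cosh.
  exact: cvgMl_tmp.
have c2 : (fun n => cos (u n) * ((tau ^+ 2 / 2 + 2) * pi)) @ \oo --> 0.
  rewrite -(mul0r ((tau ^+ 2 / 2 + 2) * pi)); apply: cvgMr_tmp.
  rewrite -[X in _ --> X](@cos_pihalf R); apply: continuous_cvg => //; exact: continuous_cos.
apply: (ler_cvg_to c1 c2); apply: nearW => n; exact: F_bound.
Unshelve. all: end_near. Qed.

End Value.
End SechValue.

(** * The Gamma function on vertical lines *)

Section GammaFunction.
Variable R : realType.
Local Notation leb := (@lebesgue_measure R).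
Implicit Types (s t x tau : R) (c z : R[i]).

Lemma cin_shift (f : R -> R[i]) a : ccont f -> cin leb f ->
  cin leb (fun s => f (s + a)) /\ cI leb (fun s => f (s + a)) = cI leb f.
Proof.
move=> [c1 c2] [i1 i2].
have [j1 e1] := rint_shift a c1 i1; have [j2 e2] := rint_shift a c2 i2.
by split; [split|apply: eqC].
Qed.

Lemma csubst_expR (G : R -> R[i]) (l : R -> R[i]) : (forall x, 0 < x -> cder G x (l x)) ->
  cin leb (fun s => G (expR s) * (expR s)%:C) ->
  cintegrable `]0, +oo[ G /\ cintegral `]0, +oo[ G = cI leb (fun s => G (expR s) * (expR s)%:C).
Proof.
move=> dG [i1 i2].
have c1 x : 0 < x -> {for x, continuous (CRe \o G)}.
  by move=> /dG[h _]; exact: is_derive_continuous h.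
have k1 : rint leb (fun s => (CRe \o G) (expR s) * expR s).
  by move: i1; congr rint; apply/funext => s /=; rewrite [RHS]mulrC -ReZ mulrC.
have [j1 e1] := subst_expR c1 k1.
have c2 x : 0 < x -> {for x, continuous (CIm \o G)}.
  by move=> /dG[_ h]; exact: is_derive_continuous h.
have k2 : rint leb (fun s => (CIm \o G) (expR s) * expR s).
  by move: i2; congr rint; apply/funext => s /=; rewrite [RHS]mulrC -ImZ mulrC.
have [j2 e2] := subst_expR c2 k2.
split; first by split.
apply: eqC; rewrite /cintegral/cI/=.
- by rewrite e1; apply: eq_Rintegral => s _ /=; rewrite mulrC -ReZ mulrC.
- by rewrite e2; apply: eq_Rintegral => s _ /=; rewrite mulrC -ImZ mulrC.
Qed.

Lemma ccont_mexp a b c t : ccont (fun s => mexp a b c (cpt s t)).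
Proof. exact: (cder_ccont (fun s => cder_mexp a b c (cder_cpt1 s t))). Qed.

Lemma ccont_mexp0 a b c : ccont (fun s => mexp a b c s%:C).
Proof.
have := ccont_mexp a b c 0; congr ccont; apply/funext => s; by rewrite cpt0.
Qed.

(* Euler's integral in the variable [s = ln t]. *)
Definition gam c := cI leb (fun s => mexp 1 0 c s%:C).

Lemma mexpE0 a c z : mexp a 0 c z = cexp (c * z - a%:C * cexp z).
Proof. by rewrite /mexp mul0r subr0 addrC. Qed.

Lemma cin_mexp0 a c t : 0 < a -> 2^-1 <= CRe c -> -1 < t < 1 ->
  cin leb (fun s => mexp a 0 c (cpt s t)).
Proof. by move=> a0 hc ht; apply: cin_mexp => //; exact: mdom_gamma. Qed.

Lemma cin_gam a c : 0 < a -> 2^-1 <= CRe c -> cin leb (fun s => mexp a 0 c s%:C).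
Proof.
move=> a0 hc; have := @cin_mexp0 a c 0 a0 hc; rewrite ltrN10 ltr01 => /(_ isT).
by congr cin; apply/funext => s; rewrite cpt0.
Qed.

Lemma gam_scale a c : 0 < a -> 2^-1 <= CRe c ->
  cI leb (fun s => mexp a 0 c s%:C) = cexp (- (c * (ln a)%:C)) * gam c.
Proof.
move=> a0 hc.
have [_ <-] := cin_shift (- ln a) (ccont_mexp0 a 0 c) (cin_gam a0 hc).
rewrite -cI_Z; last exact: cin_gam.
apply: eq_cI => s; rewrite !mexpE0 -cexpD; congr cexp.
by rewrite !cexp_real expRD expRN lnK ?posrE// !realCM !realCD realCN realCV mulrCA mulfV
  ?mulr1 ?mul1r; [ring|rewrite fmorph_eq0 gt_eqF].
Qed.

Lemma gam_ray a c t : 0 < a -> 2^-1 <= CRe c -> -1 < t < 1 ->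
  cin leb (fun s => cexp (c * s%:C - (a * expR s)%:C * cexp ('i * t%:C))) /\
  cI leb (fun s => cexp (c * s%:C - (a * expR s)%:C * cexp ('i * t%:C))) =
  cexp (- (c * ((ln a)%:C + 'i * t%:C))) * gam c.
Proof.
move=> a0 hc ht.
have e s : cexp (c * s%:C - (a * expR s)%:C * cexp ('i * t%:C)) =
    cexp (- (c * ('i * t%:C))) * mexp a 0 c (cpt s t).
  rewrite mexpE0 -cexpD; congr cexp; rewrite /cpt cexpD cexp_real realCM; ring.
rewrite (_ : (fun s => _) = (fun s => cexp (- (c * ('i * t%:C))) * mexp a 0 c (cpt s t)));
  last exact/funext.
have ci := cin_mexp0 a0 hc ht.
split; first exact: cinZ.
rewrite (cI_Z _ ci) (mexp_rot a0 (lexx 0) (mdom_gamma a0 hc) ht).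
by rewrite (gam_scale a0 hc) mulrA -cexpD; congr (cexp _ * _); ring.
Qed.

(** Integration by parts: the derivative of exp(c s - exp s) is [c] times the integrand for [c]
    minus the integrand for [c + 1], and it integrates to 0. *)
Lemma gamS c : 2^-1 <= CRe c -> gam (c + 1) = c * gam c.
Proof.
move=> hc.
have dom := mdom_gamma ltr01 hc.
have [C hC] := mexp_bound ltr01 (lexx 0) dom.
have h01 : -1 < (0 : R) < 1 by rewrite ltrN10 ltr01.
have hc1 : 2^-1 <= CRe (c + 1) by rewrite ReD/=; lra.
have z : cI leb (fun s => mexp' 1 0 c (cpt s 0)) = 0.
  apply: (@cI_derive R (fun s => mexp 1 0 c (cpt s 0)) _ C).
  - by move=> s; have := cder_mexp 1 0 c (cder_cpt1 s 0); rewrite mul1r.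
  - have h1 s := cderN (cderZ (1%:C : R[i]) (cder_cexp (cder_cpt1 s 0))).
    have h2 s := cderZ (0%:C : R[i]) (cder_cexp (cderN (cder_cpt1 s 0))).
    exact: (cder_ccont (fun s => cderM (cderD (cderD (h1 s) (h2 s)) (cder_cst c s))
     (cder_mexp 1 0 c (cder_cpt1 s 0)))).
  - apply: (@cin_dom _ _ _ leb _ (fun s => C * bsech s)).
    + have [_ m2] := cmeas_mexp 1 0 c (@cmeas_cpt R).
      by apply: (cmeas_comp m2 (h := fun s : R => (s, 0 : R))).
    + by move=> s; case: (hC s 0 h01).
    + exact: (rintZ C (@rint_bsech R)).
  - by move=> s; case: (hC s 0 h01).
have e s : mexp' 1 0 c (cpt s 0) = c * mexp 1 0 c s%:C - mexp 1 0 (c + 1) s%:C.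
  rewrite /mexp' cpt0 !mexpE0.
  have -> : cexp ((c + 1) * s%:C - 1%:C * cexp s%:C) =
      cexp s%:C * cexp (c * s%:C - 1%:C * cexp s%:C).
    by rewrite -cexpD; congr cexp; ring.
  have -> : (0 : R)%:C = 0 :> R[i] by [].
  have -> : (1 : R)%:C = 1 :> R[i] by [].
  ring.
move: z; under eq_cI do rewrite e.
rewrite cI_B; [|by apply: cinZ; exact: cin_gam|exact: cin_gam].
by rewrite cI_Z; [move/eqP; rewrite subr_eq0 => /eqP|exact: cin_gam].
Qed.

Lemma gam1 : gam 1 = 1.
Proof.
have e s : mexp 1 0 1 s%:C = (expR (s - expR s))%:C.
  by rewrite mexpE0 -cexp_real; congr cexp; rewrite !mul1r cexp_real realCD realCN.
rewrite /gam; under eq_cI do rewrite e.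
rewrite cI_real.
have [h1 h2] := @exp_int R 1 ltr01.
have [] := @subst_expR R (fun x => expR (- (1 * x))).
- move=> x _; apply: continuous_comp; last exact: continuous_expR.
  by apply: cvgN; exact: mulrl_continuous.
- have h0 : 2^-1 <= CRe (1 : R[i]) by rewrite /=; lra.
  have [i1 _] := cin_gam ltr01 h0.
  by move: i1; congr rint; apply/funext => s; rewrite [LHS]/comp e/= mul1r mulrC -expRD.
move=> _ h; congr (_%:C); rewrite RintT h2 invr1 in h.
by rewrite h; apply: eq_Rintegral => s _; rewrite mul1r mulrC -expRD.
Qed.

End GammaFunction.

Section ComplexTonelli.
Context d1 d2 (T1 : measurableType d1) (T2 : measurableType d2) (R : realType).
Variables (m1 : {sigma_finite_measure set T1 -> \bar R})
          (m2 : {sigma_finite_measure set T2 -> \bar R}).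
Implicit Types (f : T1 * T2 -> R[i]).

Lemma cin_prod12 f (G : T1 -> R) : cmeas f ->
  (forall x, rint m2 (fun y => cabs (f (x, y)))) ->
  (forall x, \int[m2]_y cabs (f (x, y)) <= G x) -> rint m1 G ->
  cin (m1 \x m2)%E f.
Proof.
move=> mf fi fG iG.
apply: (@cin_dom _ _ _ (m1 \x m2)%E f (fun z => cabs (f z)) mf (fun z => lexx _)).
apply: (@rint_prod12 _ _ _ _ _ m1 m2 _ G) => //; first exact: measurable_cabs.
move=> x; apply: le_trans (fG x).
by rewrite le_eqVlt; apply/orP; left; apply/eqP; apply: eq_Rintegral => y _; rewrite ger0_norm// cabs_ge0.
Qed.

Lemma cin_prod21 f (G : T2 -> R) : cmeas f ->
  (forall y, rint m1 (fun x => cabs (f (x, y)))) ->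
  (forall y, \int[m1]_x cabs (f (x, y)) <= G y) -> rint m2 G ->
  cin (m1 \x m2)%E f.
Proof.
move=> mf fi fG iG.
apply: (@cin_dom _ _ _ (m1 \x m2)%E f (fun z => cabs (f z)) mf (fun z => lexx _)).
apply: (@rint_prod21 _ _ _ _ _ m1 m2 _ G) => //; first exact: measurable_cabs.
move=> x; apply: le_trans (fG x).
by rewrite le_eqVlt; apply/orP; left; apply/eqP; apply: eq_Rintegral => y _; rewrite ger0_norm// cabs_ge0.
Qed.

End ComplexTonelli.

Section GammaBound.
Variable R : realType.
Local Notation leb := (@lebesgue_measure R).
Implicit Types (s t x tau : R) (c z : R[i]).

Lemma ccont_cmeas (f : R -> R[i]) : ccont f -> cmeas f.
Proof. by move=> [c1 c2]; split; exact: continuous_measurable_fun. Qed.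

Lemma ccont_cabs (f : R -> R[i]) : ccont f -> continuous (fun s => cabs (f s)).
Proof.
move=> [c1 c2] s.
rewrite (_ : (fun s => _) = Num.sqrt \o (fun s => CRe (f s) ^+ 2 + CIm (f s) ^+ 2)); last first.
  by apply/funext => t; rewrite cabsE.
apply: continuous_comp; last exact: sqrt_continuous.
by apply: cvgD; apply: cvgM; (exact: c1 || exact: c2).
Qed.

Lemma convolution (f1 f2 : R -> R[i]) : ccont f1 -> cin leb f1 -> cin leb f2 ->
  cin leb (fun v => cI leb (fun t => f1 (v + t) * f2 t)) /\
  cI leb (fun v => cI leb (fun t => f1 (v + t) * f2 t)) = cI leb f1 * cI leb f2.
Proof.
move=> c1 i1 i2.
(* The sheared product: integration over the second variable first removes the shift, and
   integration over the first variable gives the convolution. *)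
pose K (z : R * R) := f1 (z.2 + z.1) * f2 z.1.
have mK : cmeas K.
  apply: cmeasM.
    apply: (cmeas_comp (ccont_cmeas c1) (h := fun z : R * R => z.2 + z.1)).
    by apply: measurable_funD; [exact: measurable_snd|exact: measurable_fst].
  by apply: (cmeas_comp (cin_meas i2) (h := fst)); exact: measurable_fst.
have ia := cin_cabs i1; have ca := ccont_cabs c1.
have iK : cin (leb \x leb)%E K.
  apply: (@cin_prod12 _ _ _ _ _ leb leb K (fun t => \int[leb]_s cabs (f1 s) * cabs (f2 t))) => //.
  - move=> t; under [X in rint _ X]funext do rewrite /K/= cabsM mulrC.
    by apply: rintZ; case: (rint_shift t ca ia).
  - move=> t; under eq_Rintegral do rewrite /K/= cabsM mulrC.
    have [j1 e1] := rint_shift t ca ia.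
    by rewrite (rI_Z _ j1) e1 mulrC.
  - by apply: rintZ; exact: cin_cabs.
have [_ e1] := cfubini1 iK; have [j2 e2] := cfubini2 iK.
split; first exact: j2.
rewrite [LHS]e2 -e1 /K/=.
transitivity (cI leb (fun t => cI leb f1 * f2 t)); last by rewrite cI_Z.
apply: eq_cI => t; have [j3 e3] := cin_shift t c1 i1.
rewrite -e3 mulrC -cI_Z//; apply: eq_cI => s; exact: mulrC.
Qed.

(** Euler's Beta integral, with [v] the difference of the two logarithmic variables; the inner
    integral is that of [gam (c1 + c2)] rescaled by 1 + exp v. *)
Lemma gamM c1 c2 : 2^-1 <= CRe c1 -> 2^-1 <= CRe c2 ->
  cin leb (fun v => cexp (c1 * v%:C - (c1 + c2) * (ln (1 + expR v))%:C) * gam (c1 + c2)) /\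
  gam c1 * gam c2 = cI leb (fun v => cexp (c1 * v%:C - (c1 + c2) * (ln (1 + expR v))%:C) * gam (c1 + c2)).
Proof.
move=> h1 h2.
have [i e] := convolution (ccont_mexp0 1 0 c1) (cin_gam ltr01 h1) (cin_gam ltr01 h2).
rewrite /gam -/(gam _) -e.
suff E v : cI leb (fun t => mexp 1 0 c1 (v + t)%:C * mexp 1 0 c2 t%:C) =
   cexp (c1 * v%:C - (c1 + c2) * (ln (1 + expR v))%:C) * gam (c1 + c2).
  by split; [move: i; congr cin; exact/funext|exact: eq_cI].
have p0 : 0 < 1 + expR v by rewrite ltr_pwDl// expR_ge0.
have h3 : 2^-1 <= CRe (c1 + c2) by rewrite ReD; lra.
rewrite cexpB -mulrA -cexpN mulrA.
rewrite -mulrA -(gam_scale p0 h3) -cI_Z; last exact: cin_gam.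
apply: eq_cI => t; rewrite !mexpE0 -!cexpD; congr cexp.
rewrite !cexp_real expRD !realCD !realCM (_ : (1 : R)%:C = 1 :> R[i])//; ring.
Qed.

Lemma gam_conj c : 2^-1 <= CRe c -> gam c^* = (gam c)^*.
Proof.
move=> h; rewrite /gam -cI_conj; last exact: cin_gam.
apply: eq_cI => s; rewrite !mexpE0 -cexp_conj; congr cexp.
by rewrite !cexp_real; case: c h => a b _; apply: eqC => /=; ring.
Qed.

Lemma scale_int (f : R -> R) (k : R) : 0 < k -> continuous f ->
  rint leb (fun s => f (k * s)) -> rint leb f /\ \int[leb]_s f s = k * \int[leb]_s f (k * s).
Proof.
move=> k0 cf h.
have d x : is_derive x 1 ( *%R k) k by apply: is_derive_eq; rewrite /GRing.scale/= mulr1.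
have inc : {homo ( *%R k) : x y / x < y} by move=> x y; rewrite ltr_pM2l.
have cov : setT = \bigcup_n `[k * - n%:R, k * n%:R]%classic :> set R.
  rewrite eqEsubset; split => // x _; have [N /(_ N (leqnn _))] := itvn_cover (x / k).
  rewrite in_itv/= => /andP[h1 h2]; exists N => //=; rewrite in_itv/=.
  by rewrite mulrC -ler_pdivlMr// h1 mulrC -ler_pdivrMr.
have h' : rint leb (fun s => f (k * s) * k) by under [X in rint _ X]funext do rewrite mulrC; exact: rintZ.
have [i e] := subst_rint d (fun _ => cvg_cst _) inc cov (fun x _ => cf x) h'.
split => //; rewrite e -(rI_Z _ h); apply: eq_Rintegral => s _; exact: mulrC.
Qed.

Lemma oneD_expR (v : R) : 1 + expR v = 2 * expR (2^-1 * v) * cosh (2^-1 * v).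
Proof.
have -> : expR v = expR (2^-1 * v) ^+ 2 by rewrite -expRM_natl; congr expR; field.
have e1 : expR (2^-1 * v) * expR (- (2^-1 * v)) = 1 by rewrite -expRD subrr expR0.
by rewrite /cosh; field: e1.
Qed.

(** The Beta function at (1/2 + i tau, 1/2) has modulus at most its value pi at (1/2, 1/2): the
    modulus of the integrand is sech(v/2) / 2. *)
Lemma gam_half_lower tau :
  cabs (gam (2^-1%:C + 'i * tau%:C)) * cabs (gam 2^-1%:C) <= pi * cabs (gam (1 + 'i * tau%:C)).
Proof.
have h1 : 2^-1 <= CRe (2^-1%:C + 'i * tau%:C :> R[i]) by rewrite !ReImE/=; lra.
have h2 : 2^-1 <= CRe (2^-1%:C : R[i]) by [].
have E : 2^-1%:C + 'i * tau%:C + 2^-1%:C = 1 + 'i * tau%:C :> R[i].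
  by apply: eqC => /=; field.
rewrite -cabsM; have [i e] := gamM h1 h2; rewrite E in i e; rewrite e.
apply: le_trans (cabs_cI i) _.
have h0 : 0 < 2^-1 :> R by rewrite invr_gt0.
have [iS eS] := sech_int h0.
have -> : pi * cabs (gam (1 + 'i * tau%:C)) =
   \int[leb]_s (2^-1 * cabs (gam (1 + 'i * tau%:C)) * (cosh (2^-1 * s))^-1).
  by rewrite (rI_Z _ iS) eS; field.
apply: rI_le; [exact: cin_cabs|exact: rintZ|move=> v].
rewrite cabsM cabs_cexp le_eqVlt; apply/orP; left; apply/eqP.
rewrite mulrAC; congr (_ * _).
have p0 : 0 < 1 + expR v by rewrite ltr_pwDl// expR_ge0.
have -> : CRe ((2^-1%:C + 'i * tau%:C) * v%:C - (1 + 'i * tau%:C) * (ln (1 + expR v))%:C) =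
    2^-1 * v - ln (1 + expR v) by rewrite !ReImE/=; ring.
rewrite expRD expRN lnK ?posrE// oneD_expR; field.
by rewrite cosh_neq0 gt_eqF ?expR_gt0.
Qed.

(** The reflection formula on the line Re c = 1/2. Conjugate parameters have sum 1, so their Beta
    integral is a Fourier transform of sech. *)
Lemma gam_half_sq tau : cabs (gam (2^-1%:C + 'i * tau%:C)) ^+ 2 = pi / cosh (pi * tau).
Proof.
have h1 : 2^-1 <= CRe (2^-1%:C + 'i * tau%:C :> R[i]) by rewrite !ReImE/=; lra.
have ec : (2^-1%:C + 'i * tau%:C)^* = 2^-1%:C - 'i * tau%:C :> R[i].
  by apply: eqC => /=; ring.
have h2 : 2^-1 <= CRe ((2^-1%:C + 'i * tau%:C)^* : R[i]) by rewrite ec !ReImE/=; lra.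
have [i e] := gamM h1 h2.
have e1 : 2^-1%:C + 'i * tau%:C + (2^-1%:C + 'i * tau%:C)^* = 1 :> R[i].
  by apply: eqC => /=; field.
rewrite e1 gam1 in i e.
have -> : cabs (gam (2^-1%:C + 'i * tau%:C)) ^+ 2 =
   CRe (gam (2^-1%:C + 'i * tau%:C) * gam (2^-1%:C + 'i * tau%:C)^*).
  by rewrite (gam_conj h1) ReIm_sq; case: (gam _) => a b /=; ring.
rewrite e.
transitivity (\int[leb]_s (2^-1 * (cos (tau * s) / cosh (2^-1 * s)))).
  apply: eq_Rintegral => v _; rewrite mulr1 mul1r.
  have -> : (2^-1%:C + 'i * tau%:C) * v%:C - (ln (1 + expR v))%:C =
     (2^-1 * v - ln (1 + expR v)) +i* (tau * v) by apply: eqC => /=; ring.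
  have p0 : 0 < 1 + expR v by rewrite ltr_pwDl// expR_ge0.
  rewrite /cexp/= expRD expRN lnK ?posrE// oneD_expR; field.
  by rewrite cosh_neq0 gt_eqF ?expR_gt0.
have cf : continuous (fun s => cos (tau * s) / cosh (2^-1 * s)).
  move=> s; apply: cvgM.
    by apply: continuous_comp; [exact: mulrl_continuous|exact: continuous_cos].
  apply: cvgV; first exact: cosh_neq0.
  by apply: continuous_comp; [exact: mulrl_continuous|exact: continuous_cosh].
have E s : cos (tau * (2 * s)) / cosh (2^-1 * (2 * s)) = cos ((2 * tau) * s) / cosh s.
  by congr (cos _ / cosh _); field.
have [||i2 e2] := @scale_int (fun s => cos (tau * s) / cosh (2^-1 * s)) 2 _ cf.
- by [].
- by under [X in rint _ X]funext do rewrite E; exact: rint_cos_sech.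
rewrite (rI_Z _ i2) e2; under eq_Rintegral do rewrite E.
rewrite sech_fourier mulrA mulVf// mul1r; congr (_ / cosh _); by field.
Qed.

Lemma gam_nat_lower tau n :
  n`!%:R * cabs (gam (1 + 'i * tau%:C)) <= cabs (gam (n%:R + 1 + 'i * tau%:C)).
Proof.
elim: n => [|n ih]; first by rewrite mul1r add0r.
rewrite -[n.+1%:R]natr1.
have -> : n%:R + 1 + 1 + 'i * tau%:C = (n%:R + 1 + 'i * tau%:C) + 1 :> R[i] by ring.
have Re1 : CRe (n%:R + 1 + 'i * tau%:C : R[i]) = n%:R + 1.
  by rewrite -realCn !ReImE/=; ring.
rewrite gamS; last by rewrite Re1; have := ler0n R n; lra.
rewrite cabsM factS natrM -mulrA; apply: ler_pM => //.
- by rewrite mulr_ge0// cabs_ge0.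
- apply: le_trans (Re_le_cabs _); rewrite Re1 natr1; exact: ler_norm.
Qed.

(** Squaring [gam_half_lower] and inserting the values of [gam_half_sq] at [tau] and 0 gives
    |Gamma(1 + i tau)|^2 >= 1 / cosh(pi tau). The recurrence then contributes the factors |k + 1 + i
    tau| >= k + 1. *)
Lemma gam_lower tau n :
  n`!%:R <= cabs (gam (n%:R + 1 + 'i * tau%:C)) * Num.sqrt (cosh (pi * tau)).
Proof.
suff h : 1 <= cabs (gam (1 + 'i * tau%:C)) * Num.sqrt (cosh (pi * tau)).
  apply: (@le_trans _ _ (n`!%:R * cabs (gam (1 + 'i * tau%:C)) * Num.sqrt (cosh (pi * tau)))).
    by rewrite -mulrA ler_peMr.
  by rewrite ler_wpM2r ?sqrtr_ge0// gam_nat_lower.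
have e1 := gam_half_sq tau; have e0 := gam_half_sq 0.
rewrite !mulr0 cosh0 divr1 addr0 in e0.
have h := gam_half_lower tau.
have c0 := cosh_gt0 (pi * tau).
rewrite -(@ler_pXn2r _ 2)// ?nnegrE ?mulr_ge0 ?cabs_ge0 ?sqrtr_ge0//.
rewrite expr1n exprMn [Num.sqrt (cosh _) ^+ 2]sqr_sqrtr ?(ltW c0)//.
have p0 := @pi_gt0 R.
have h2 : (pi / cosh (pi * tau)) * pi <= pi ^+ 2 * cabs (gam (1 + 'i * tau%:C)) ^+ 2.
  rewrite -e1 -[X in _ * X]e0 -!exprMn lerXn2r// ?nnegrE ?mulr_ge0 ?cabs_ge0//.
  exact: ltW.
rewrite -ler_pdivrMr//.
rewrite -(@ler_pM2l _ (pi ^+ 2)) ?exprn_gt0//.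
by apply: le_trans h2; rewrite le_eqVlt; apply/orP; left; apply/eqP; rewrite expr2; ring.
Qed.

Lemma GammaE c : 2^-1 <= CRe c -> Gamma c = gam c.
Proof.
move=> h.
have E s : rcpow (expR s) (c - 1) * (expR (- expR s))%:C * (expR s)%:C = mexp 1 0 c s%:C.
  rewrite /rcpow expRK mexpE0 -!cexp_real -!cexpD; congr cexp.
  by rewrite cexp_real realCN (_ : (1 : R)%:C = 1 :> R[i])//; ring.
have d x : 0 < x -> cder (fun t => rcpow t (c - 1) * (expR (- t))%:C) x
    ((c - 1) * (x^-1)%:C * rcpow x (c - 1) * (expR (- x))%:C + rcpow x (c - 1) * (- expR (- x))%:C).
  move=> x0; apply: cderM; last exact: (cder_real (is_derive_expRN x)).
  exact: (cder_cexp (cderZ (c - 1) (cder_real (is_derive1_ln x0)))).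
have ci : cin leb (fun s => rcpow (expR s) (c - 1) * (expR (- expR s))%:C * (expR s)%:C).
  by under [X in cin _ X]funext do rewrite E; exact: cin_gam.
have [_ e] := csubst_expR d ci.
rewrite [LHS]e; exact: eq_cI.
Qed.

End GammaBound.

(** * Integrals of odd and even functions *)

Section Symmetry.
Variable R : realType.
Local Notation leb := (@lebesgue_measure R).
Implicit Types (f : R -> R).

Let eqN0 (a : R) : a = - a -> a = 0.
Proof. by move=> h; lra. Qed.

Lemma odd_int f : continuous f -> (forall x, f (- x) = - f x) -> rint leb f ->
  \int[leb]_x f x = 0.
Proof.
move=> cf odd hf.
have z n : \int[leb]_(x in `[- n%:R, n%:R]) f x = 0.
  have i : leb.-integrable `[- n%:R, n%:R] (EFin \o f) by apply: integrableS hf.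
  have h : - n%:R <= n%:R :> R by rewrite -subr_ge0 opprK addr_ge0.
  have e : (\int[leb]_(x in `[(- n%:R)%R, (n%:R)%R]) (f x)%:E =
      \int[leb]_(x in `[(- n%:R)%R, (n%:R)%R]) (f (- x))%:E)%E.
    have := @integration_by_substitution_oppr R f _ _ h.
    by rewrite opprK; apply; exact: continuous_subspaceT.
  have e2 : \int[leb]_(x in `[- n%:R, n%:R]) f x = - \int[leb]_(x in `[- n%:R, n%:R]) f x.
    rewrite {1}/Rintegral e -/(Rintegral _ _ _).
    transitivity (\int[leb]_(x in `[- n%:R, n%:R]) (-1 * f x)).
      by rewrite /Rintegral; congr fine; apply: eq_integral => x _; rewrite odd mulN1r.
    by rewrite RintegralZl// mulN1r.
  exact: eqN0.
apply: (cvgn_uniq (cvg_int_itv hf)).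
rewrite (_ : (fun n => _) = (fun=> 0)); [exact: cvg_cst|exact/funext].
Qed.

Let even_half0 f : (forall x, 0 <= f x) -> continuous f -> (forall x, f (- x) = f x) ->
  rint leb f ->
  leb.-integrable `[0, +oo[ (EFin \o f) /\
  \int[leb]_x f x = 2 * \int[leb]_(x in `[0, +oo[) f x.
Proof.
move=> f0 cf even hf.
have i : leb.-integrable `[0, +oo[ (EFin \o f) by apply: integrableS hf.
split => //.
rewrite {1}/Rintegral ge0_symfun_integralT//; last by move=> x /=; rewrite even.
by rewrite -set_itvcy fineM//; exact: integrable_fin_num.
Qed.

Lemma even_half f : continuous f -> (forall x, f (- x) = f x) -> rint leb f ->
  leb.-integrable `[0, +oo[ (EFin \o f) /\
  \int[leb]_(x in `[0, +oo[) f x = 2^-1 * \int[leb]_x f x.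
Proof.
move=> cf even hf.
have cp : continuous (fun x => Num.max (f x) 0).
  by move=> x; apply: (@continuous_max _ _ f (cst 0)); [exact: cf|exact: cvg_cst].
have cn : continuous (fun x => Num.max (- f x) 0).
  by move=> x; apply: (@continuous_max _ _ (- f) (cst 0)); [apply: cvgN; exact: cf|exact: cvg_cst].
have bp a : 0 <= Num.max a 0 :> R by rewrite le_max lexx orbT.
have ip : rint leb (fun x => Num.max (f x) 0).
  apply: rint_dom (rint_abs hf); first exact: continuous_measurable_fun.
  by move=> x; rewrite ger0_norm// ge_max ler_norm normr_ge0.
have in_ : rint leb (fun x => Num.max (- f x) 0).
  apply: rint_dom (rint_abs hf); first exact: continuous_measurable_fun.
  by move=> x; rewrite ger0_norm// ge_max -normrN ler_norm normr_ge0.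
have [jp ep] := even_half0 (fun x => bp (f x)) cp (fun x => congr1 (fun a => Num.max a 0) (even x)) ip.
have [jn en] := even_half0 (fun x => bp (- f x)) cn (fun x => congr1 (fun a => Num.max (- a) 0) (even x)) in_.
have fE x : f x = Num.max (f x) 0 - Num.max (- f x) 0.
  by rewrite /Num.max !ltNge; case: (lerP 0 (f x)) => h; case: (lerP 0 (- f x)) => h' /=; lra.
split; first by apply: integrableS hf.
under eq_Rintegral do rewrite fE.
under [in RHS]eq_Rintegral do rewrite fE.
by rewrite RintegralB// (rI_B ip in_) ep en; field.
Qed.

End Symmetry.

(** * Bessel functions *)

Section BesselK.
Variable R : realType.
Local Notation leb := (@lebesgue_measure R).
Implicit Types (s t x tau : R) (c z al be : R[i]).

Definition omega : R[i] := cexp ('i * (pi / 4)%:C).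

Lemma omegaE : omega = cos (pi / 4) +i* sin (pi / 4).
Proof.
have e : 'i * (pi / 4)%:C = 0 +i* (pi / 4) :> R[i] by apply: eqC => /=; ring.
by rewrite /omega e /cexp/= expR0 !mul1r.
Qed.

Definition omJ : R[i] := cos (pi / 4) -i* sin (pi / 4).

Lemma omegaV : omega^-1 = omJ.
Proof.
have -> : omJ = omega^* by rewrite omegaE.
rewrite /omega -cexpN -cexp_conj; congr cexp; apply: eqC => /=; ring.
Qed.

Lemma cabs_omega : cabs omega = 1.
Proof. by rewrite cabs_cexp !ReImE/= mul0r mulr0 subrr expR0. Qed.

Lemma pi4_bound : -1 < (pi / 4 : R) < 1.
Proof. by have := @pihalf_lt2 R; have := @pi_gt0 R; lra. Qed.

Lemma Re_omega : 2^-1 <= CRe omega.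
Proof. by rewrite omegaE; exact: cos_ge_half pi4_bound. Qed.

Lemma omega_sq : omega ^+ 2 = 'i.
Proof.
rewrite /omega -cexpMn.
have -> : ('i * (pi / 4)%:C) *+ 2 = 0 +i* (pi / 2) :> R[i] by apply: eqC => /=; field.
by rewrite /cexp/= expR0 cos_pihalf sin_pihalf mulr0 mulr1.
Qed.

(** Macdonald's integrand over the whole line. Separate coefficients of exp(s) and exp(- s) allow a
    translation to move all dependence on x into the second one. *)
Definition kexp al be tau s :=
  cexp (- (al * (expR s)%:C) - be * (expR (- s))%:C - 'i * (tau * s)%:C).

Lemma is_derive_expRid s : is_derive s 1 (@expR R) (expR s).
Proof. exact: is_derive_expR. Qed.

Lemma ccont_kexp al be tau : ccont (kexp al be tau).
Proof.
have h s : is_derive s 1 (fun s => tau * s) tau.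
  by apply: is_derive_eq; rewrite /GRing.scale/= mulr1.
exact: (cder_ccont (fun s => cder_cexp (cderD (cderD
  (cderN (cderZ al (cder_real (is_derive_expRid s))))
  (cderN (cderZ be (cder_real (is_derive_expRN s)))))
  (cderN (cderZ 'i (cder_real (h s))))))).
Qed.

Lemma cabs_kexp al be tau s :
  cabs (kexp al be tau s) = expR (- (CRe al * expR s + CRe be * expR (- s))).
Proof. by rewrite cabs_cexp; congr expR; rewrite !ReImE/=; ring. Qed.

Lemma rint_dexp a b : 0 < a -> 0 < b ->
  rint leb (fun s => expR (- (a * expR s + b * expR (- s)))).
Proof.
move=> a0 b0; have [C hC] := mdom_pos a0 b0.
apply: (@rint_dom _ _ _ leb _ (fun s => C * bsech s)).
- apply: measurable_funexpR; apply: measurable_funN; apply: measurable_funD.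
    apply: measurable_funM; first exact: measurable_cst; exact: measurable_expR.
  apply: measurable_funM; first exact: measurable_cst.
  by apply: measurable_funexpR; exact: measurable_funN.
- move=> s; rewrite ger0_norm ?expR_ge0//; apply: le_trans (hC s).
  rewrite mul0r addr0; set X := _ + _.
  have X0 : 0 <= X by rewrite addr_ge0// mulr_ge0 ?expR_ge0// ltW.
  apply: (@le_trans _ _ (expR (- (2^-1 * X)))); first by rewrite ler_expR; lra.
  by rewrite ler_peMl ?expR_ge0// lerDl.
- exact: rintZ (@rint_bsech R).
Qed.

Lemma cin_kexp al be tau : 0 < CRe al -> 0 < CRe be -> cin leb (kexp al be tau).
Proof.
move=> ha hb.
apply: (@cin_dom _ _ _ leb _ (fun s => expR (- (CRe al * expR s + CRe be * expR (- s))))).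
- exact/ccont_cmeas/ccont_kexp.
- by move=> s; rewrite cabs_kexp.
- exact: rint_dexp.
Qed.

(** Translation by [ln l] moves both factors [l] onto exp(- s). For [l] proportional to sqrt(x) the
    exponent becomes linear in x, as Weber's integral requires. *)
Lemma kexp_shift al be tau (l : R) : 0 < l -> 0 < CRe al -> 0 < CRe be ->
  cI leb (kexp (l%:C * al) (l%:C * be) tau) =
  cexp ('i * (tau * ln l)%:C) * cI leb (kexp al (l%:C ^+ 2 * be) tau).
Proof.
move=> l0 ha hb.
have hb' : 0 < CRe (l%:C ^+ 2 * be) by rewrite -realC_expr ReZ mulr_gt0// exprn_gt0.
have [_ <-] := cin_shift (ln l) (ccont_kexp al (l%:C ^+ 2 * be) tau) (cin_kexp tau ha hb').
rewrite -cI_Z.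
  apply: eq_cI => s; rewrite -cexpD; congr cexp.
  rewrite opprD expRD (expRD (- s)) !expRN lnK ?posrE// !realCM !realCV realCD.
  have l0' : l%:C != 0 by rewrite fmorph_eq0 gt_eqF.
  have s0 : (expR s)%:C != 0 :> R[i] by rewrite fmorph_eq0 gt_eqF ?expR_gt0.
  by field; rewrite ?l0' ?s0.
by case: (cin_shift (ln l) (ccont_kexp al (l%:C ^+ 2 * be) tau) (cin_kexp tau ha hb')).
Qed.

Lemma expR_cosh s : expR s + expR (- s) = 2 * cosh s.
Proof. by rewrite /cosh mulrC divfK. Qed.

Lemma besselK0E al : 0 < CRe al ->
  besselK 0 (2 * al) = 2^-1%:C * cI leb (kexp al al 0).
Proof.
move=> ha.
have E s : cexp (- (2 * al) * (cosh s)%:C) * ccosh (0 * s%:C) = kexp al al 0 s.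
  have -> : ccosh (0 * s%:C) = 1 :> R[i].
    by rewrite mul0r /ccosh oppr0 cexp0; field.
  rewrite mulr1.
  rewrite /kexp mul0r mulr0 subr0; congr cexp.
  have -> : - (al * (expR s)%:C) - al * (expR (- s))%:C = - (al * (expR s + expR (- s))%:C).
    by rewrite realCD; ring.
  by rewrite expR_cosh realCM realCn; ring.
have [c1 c2] := ccont_kexp al al 0; have [i1 i2] := cin_kexp 0 ha ha.
have ev s : kexp al al 0 (- s) = kexp al al 0 s.
  by rewrite /kexp opprK !mul0r; congr cexp; ring.
have [_ e1] := even_half c1 (fun s => congr1 CRe (ev s)) i1.
have [_ e2] := even_half c2 (fun s => congr1 CIm (ev s)) i2.
apply: eqC; rewrite ?ReZ ?ImZ.
- rewrite -[CRe (cI _ _)]/(\int[leb]_s (CRe \o kexp al al 0) s) -e1.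
  by apply: eq_Rintegral => s _; rewrite [RHS]/comp -E.
- rewrite -[CIm (cI _ _)]/(\int[leb]_s (CIm \o kexp al al 0) s) -e2.
  by apply: eq_Rintegral => s _; rewrite [RHS]/comp -E.
Qed.

Lemma besselKiE a tau : 0 < a ->
  besselK ('i * tau%:C) (2 * a)%:C = 2^-1%:C * cI leb (kexp a%:C a%:C tau).
Proof.
move=> a0.
have E s : cexp (- (2 * a)%:C * (cosh s)%:C) * ccosh ('i * tau%:C * s%:C) =
    (CRe (kexp a%:C a%:C tau s))%:C.
  have -> : - (2 * a)%:C * (cosh s)%:C = (- (a * (expR s + expR (- s))))%:C :> R[i].
    by rewrite expR_cosh -realCN -realCM; congr (_%:C); ring.
  have -> : 'i * tau%:C * s%:C = cpt 0 (tau * s).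
    by rewrite /cpt realCM add0r mulrA.
  rewrite cexp_real ReIm_ccosh cosh0 sinh0 mul1r mul0r -[_ +i* 0]/((cos (tau * s))%:C) -realCM.
  congr (_%:C); rewrite /kexp.
  have -> : - (a%:C * (expR s)%:C) - a%:C * (expR (- s))%:C - 'i * (tau * s)%:C =
     (- (a * (expR s + expR (- s)))) +i* (- (tau * s)) by apply: eqC => /=; ring.
  by rewrite /cexp/= cosN.
have [c1 c2] := ccont_kexp a%:C a%:C tau; have [i1 i2] := @cin_kexp a%:C a%:C tau a0 a0.
have ev s : kexp a%:C a%:C tau (- s) = (kexp a%:C a%:C tau s)^*.
  rewrite /kexp -cexp_conj opprK; congr cexp; apply: eqC => /=; ring.
have ev1 s : CRe (kexp a%:C a%:C tau (- s)) = CRe (kexp a%:C a%:C tau s).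
  by rewrite ev; case: kexp.
have ev2 s : CIm (kexp a%:C a%:C tau (- s)) = - CIm (kexp a%:C a%:C tau s).
  by rewrite ev; case: kexp.
have [_ e1] := even_half c1 ev1 i1.
have e2 := odd_int c2 ev2 i2.
apply: eqC; rewrite ?ReZ ?ImZ.
- rewrite -[CRe (cI _ _)]/(\int[leb]_s (CRe \o kexp a%:C a%:C tau) s) -e1.
  by apply: eq_Rintegral => s _; rewrite [RHS]/comp -[CRe (kexp _ _ _ _)]/(CRe (CRe (kexp a%:C a%:C tau s))%:C) -E.
- rewrite -[CIm (cI _ _)]/(\int[leb]_s (CIm \o kexp a%:C a%:C tau) s) e2 mulr0.
  transitivity (\int[leb]_(s in `[0, +oo[) (0 : R)); last by rewrite /Rintegral integral0.
  by apply: eq_Rintegral => s _; rewrite -[RHS]/(CIm (CRe (kexp a%:C a%:C tau s))%:C) -E.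
Qed.

End BesselK.

Section BesselX.
Variable R : realType.
Local Notation leb := (@lebesgue_measure R).
Implicit Types (s t x tau : R) (c z al be : R[i]).

Lemma Re_omegaJ : CRe (omJ R) = CRe (omega R).
Proof. by rewrite omegaE. Qed.

Lemma Re_omega_gt0 : 0 < CRe (omega R).
Proof. by apply: lt_le_trans (Re_omega R); rewrite invr_gt0. Qed.

Lemma Re_omegaJ_gt0 : 0 < CRe (omJ R).
Proof. by rewrite Re_omegaJ Re_omega_gt0. Qed.

(** Lowering the line by pi/4 multiplies the coefficients of exp(s) and exp(- s) by [omJ R] and
    [omega R]; the translation then leaves a^2 on [omega R] alone, the direction that K_0 has in
    [besselK0_x]. *)
Lemma kexp_rot (a : R) tau : 0 < a ->
  cI leb (kexp a%:C a%:C tau) =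
  cexp (- (tau * (pi / 4))%:C + 'i * (tau * ln a)%:C) *
    cI leb (kexp (omJ R) (a%:C ^+ 2 * omega R) tau).
Proof.
move=> a0.
have c0 : CRe (- ('i * tau%:C) : R[i]) = 0 by rewrite !ReImE/=; ring.
have dom : mdom a a (CRe (- ('i * tau%:C) : R[i])) by rewrite c0; exact: mdom_pos.
have ht : -1 < (- (pi / 4) : R) < 1 by have := pi4_bound R; lra.
have := mexp_rot a0 (ltW a0) dom ht => rot.
have e1 s : mexp a a (- ('i * tau%:C)) s%:C = kexp a%:C a%:C tau s.
  by rewrite /mexp /kexp -realCN !cexp_real; congr cexp; rewrite realCM; ring.
have e2 s : mexp a a (- ('i * tau%:C)) (cpt s (- (pi / 4))) =
   cexp (- (tau * (pi / 4))%:C) * kexp (a%:C * (omJ R)) (a%:C * omega R) tau s.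
  rewrite /kexp -cexpD /mexp; congr cexp.
  have -> : cexp (cpt s (- (pi / 4))) = (expR s)%:C * (omJ R).
    rewrite -omegaV /cpt cexpD cexp_real /omega -cexpN; congr (_ * cexp _).
    by rewrite realCN; ring.
  have -> : cexp (- cpt s (- (pi / 4))) = (expR (- s))%:C * omega R.
    rewrite /cpt opprD cexpD -realCN cexp_real /omega; congr (_ * cexp _).
    by rewrite realCN; ring.
  have -> : - ('i * tau%:C) * cpt s (- (pi / 4)) =
      - (tau * (pi / 4))%:C - 'i * (tau * s)%:C.
    by apply: eqC; rewrite /cpt /=; ring.
  ring.
have J0 := Re_omegaJ_gt0; have W0 := Re_omega_gt0.
have ci : cin leb (kexp (a%:C * (omJ R)) (a%:C * omega R) tau).
  by apply: cin_kexp; rewrite ReZ mulr_gt0.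
rewrite -(eq_cI leb e1) -rot (eq_cI leb e2) (cI_Z _ ci) (kexp_shift tau a0 J0 W0).
by rewrite cexpD mulrA.
Qed.

Lemma besselK0_x (c x : R) : 0 < c -> 0 < x ->
  besselK 0 (4 * omega R * (Num.sqrt c)%:C * (Num.sqrt x)%:C) =
  2^-1%:C * cI leb (kexp (omega R) ((4 * c * x)%:C * omega R) 0).
Proof.
move=> c0 x0; pose l := 2 * Num.sqrt c * Num.sqrt x.
have l0 : 0 < l by rewrite !mulr_gt0 ?sqrtr_gt0.
have -> : 4 * omega R * (Num.sqrt c)%:C * (Num.sqrt x)%:C = 2 * (l%:C * omega R).
  by rewrite /l !realCM -[4]/(2 * 2)%:R natrM realCn; ring.
rewrite besselK0E; last by rewrite ReZ mulr_gt0// Re_omega_gt0.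
rewrite (kexp_shift 0 l0 Re_omega_gt0 Re_omega_gt0) mul0r.
have -> : 'i * 0%:C = 0 :> R[i] by rewrite mulr0.
rewrite cexp0 mul1r.
suff -> : l%:C ^+ 2 = (4 * c * x)%:C :> R[i] by [].
by rewrite -realC_expr; congr (_%:C); rewrite /l !exprMn !sqr_sqrtr ?(ltW c0) ?(ltW x0)//; ring.
Qed.

Lemma besselKi_x tau x : 0 < x ->
  besselK ('i * tau%:C) (2 * Num.sqrt (2 * x))%:C =
  2^-1%:C * (cexp (- (tau * (pi / 4))%:C + 'i * (tau * ln (Num.sqrt (2 * x)))%:C) *
    cI leb (kexp (omJ R) ((2 * x)%:C * omega R) tau)).
Proof.
move=> x0; have s0 : 0 < Num.sqrt (2 * x) by rewrite sqrtr_gt0 mulr_gt0.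
by rewrite besselKiE// kexp_rot// -realC_expr sqr_sqrtr// mulr_ge0// ltW.
Qed.

(** This is K_0(2 sqrt(2x)), written after the translation that makes the exponent linear in x. *)
Definition kap x : R := 2^-1 * \int[leb]_s expR (- (expR s + 2 * x * expR (- s))).

Lemma besselKi_le tau x : 0 < x ->
  cabs (besselK ('i * tau%:C) (2 * Num.sqrt (2 * x))%:C) <= kap x.
Proof.
move=> x0; have s0 : 0 < Num.sqrt (2 * x) by rewrite sqrtr_gt0 mulr_gt0.
have h1 : 0 < CRe (1 : R[i]) by rewrite /=.
rewrite besselKiE// -[X in kexp X X]mulr1 (kexp_shift tau s0 h1 h1).
rewrite !cabsM cabs_cexp cabs_real ger0_norm ?invr_ge0//.
have -> : CRe ('i * (tau * ln (Num.sqrt (2 * x)))%:C : R[i]) = 0 by rewrite !ReImE/=; ring.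
rewrite expR0 mul1r mulr1 ler_wpM2l ?invr_ge0//.
have h2 : 0 < CRe ((Num.sqrt (2 * x))%:C ^+ 2 : R[i]) by rewrite -realC_expr exprn_gt0.
apply: le_trans (cabs_cI (cin_kexp tau h1 h2)) _.
rewrite le_eqVlt; apply/orP; left; apply/eqP; apply: eq_Rintegral => s _.
by rewrite cabs_kexp -realC_expr/= mul1r sqr_sqrtr// mulr_ge0// ltW.
Qed.

End BesselX.

(** * Convergence of complex sequences and series *)

Section ComplexSeries.
Variable R : realType.
Implicit Types (u v : nat -> R[i]) (l w : R[i]) (b : nat -> R).

Definition ccvg u l :=
  (fun n => CRe (u n)) @ \oo --> CRe l /\ (fun n => CIm (u n)) @ \oo --> CIm l.

Lemma cabs_cvg0_ccvg u l : (fun n => cabs (u n - l)) @ \oo --> 0 -> ccvg u l.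
Proof.
move=> h; split; apply/cvgrPdist_lt => e e0; move/cvgrPdist_lt: h => /(_ _ e0);
  apply: filterS => n; rewrite sub0r normrN ger0_norm ?cabs_ge0// => hn;
  apply: le_lt_trans hn; rewrite distrC.
- by rewrite -ReN -ReD Re_le_cabs.
- by rewrite -ImN -ImD Im_le_cabs.
Qed.

Lemma ccvg_cabs u l : ccvg u l -> (fun n => cabs (u n - l)) @ \oo --> 0.
Proof.
move=> [/subr_cvg0/cvg_norm h1 /subr_cvg0/cvg_norm h2]; rewrite normr0 in h1 h2.
have h : (fun n => `|CRe (u n) - CRe l| + `|CIm (u n) - CIm l|) @ \oo --> (0 : R).
  by rewrite -[0]addr0; apply: cvgD.
apply: (squeeze_cvgr _ (cvg_cst 0) h); apply: nearW => n.
by rewrite cabs_ge0/= -ReN -ReD -ImN -ImD cabs_le.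
Qed.

Lemma ccvg_lim u l : ccvg u l -> (u : nat -> R[i]^o) @ \oo --> (l : R[i]^o).
Proof.
move=> /ccvg_cabs/cvgrPdist_lt h; apply/cvgrPdist_lt => -[e e'].
rewrite ltcE/= => /andP[/eqP -> e0]; move: (h _ e0); apply: filterS => n.
by rewrite sub0r normrN ger0_norm ?cabs_ge0// distrC cabsC ltcE/= eqxx.
Qed.

Lemma ccvgZ u l w : ccvg u l -> ccvg (fun n => w * u n) (w * l).
Proof.
move=> /ccvg_cabs h; apply: cabs_cvg0_ccvg.
rewrite -(mulr0 (cabs w)); under eq_fun do rewrite -mulrBr cabsM.
exact: cvgMl_tmp.
Qed.

Lemma ccvg_conj u l : ccvg u l -> ccvg (fun n => (u n)^*) l^*.
Proof.
move=> [h1 h2]; split.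
- have e z : CRe z^* = CRe z :> R by case: z.
  by under eq_fun do rewrite e; rewrite e.
- have e z : CIm z^* = - CIm z :> R by case: z.
  by under eq_fun do rewrite e; rewrite e; exact: cvgN.
Qed.

Lemma ccvg_uniq u l w : ccvg u l -> ccvg u w -> l = w.
Proof. by move=> [h1 h2] [k1 k2]; apply: eqC; [apply: cvgn_uniq h1 k1|apply: cvgn_uniq h2 k2]. Qed.

Lemma ccvg_le u l (B : R) : ccvg u l -> (forall n, cabs (u n) <= B) -> cabs l <= B.
Proof.
move=> /ccvg_cabs h le_uB.
have h' : (fun n => B + cabs (u n - l)) @ \oo --> B + 0 by apply: cvgD => //; exact: cvg_cst.
rewrite -[B]addr0; apply: (ler_cvg_to (cvg_cst (cabs l)) h'); apply: nearW => n.
rewrite -[in leLHS](subKr (u n) l); apply: le_trans (cabsB _ _) _.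
by rewrite lerD2r.
Qed.

Definition csumto m v l := ccvg (fun N => \sum_(m <= n < N) v n) l.

Lemma csumto_csum m v l : csumto m v l -> csummable m v /\ csum m v = l.
Proof.
move=> /ccvg_lim h; split; first by apply/cvg_ex; exists l.
exact: (cvg_lim (@norm_hausdorff _ _) h).
Qed.

Lemma nondecreasing_sum_nat m b : (forall n, 0 <= b n) ->
  nondecreasing_seq (fun N => \sum_(m <= n < N) b n).
Proof.
move=> b0; apply/nondecreasing_seqP => N; case: (leqP m N) => mN.
  by rewrite big_nat_recr//= lerDl.
by rewrite !big_geq// ltnW.
Qed.

(** The series of [b] and of [b + v] both have nonnegative terms and bounded partial sums, and that
    of [v] is their difference. *)
Lemma real_abs_cvg m (v b : nat -> R) (B : R) : (forall n, `|v n| <= b n) ->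
  (forall N, \sum_(m <= n < N) b n <= B) -> cvgn (fun N => \sum_(m <= n < N) v n).
Proof.
move=> vb bB; have b0 n : 0 <= b n by apply: le_trans (vb n).
have vb1 n : - b n <= v n <= b n by rewrite -ler_norml.
have c1 : cvgn (fun N => \sum_(m <= n < N) b n).
  apply: nondecreasing_is_cvgn; first exact: nondecreasing_sum_nat.
  by exists B => _ [N _ <-].
have c2 : cvgn (fun N => \sum_(m <= n < N) (b n + v n)).
  apply: nondecreasing_is_cvgn.
    by apply: nondecreasing_sum_nat => n; have := vb1 n; lra.
  exists (B + B) => _ [N _ <-]; apply: le_trans (lerD (bB N) (bB N)).
  by rewrite -big_split; apply: ler_sum => n _; have := vb1 n; rewrite /=; lra.
rewrite (_ : (fun N => _) = (fun N => \sum_(m <= n < N) (b n + v n)) \- (fun N => \sum_(m <= n < N) b n)).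
  exact: is_cvgB.
by apply/funext => N; rewrite [RHS]/= big_split/= addrAC subrr add0r.
Qed.

Lemma csumto_abs m v b (B : R) : (forall n, cabs (v n) <= b n) ->
  (forall N, \sum_(m <= n < N) b n <= B) -> csumto m v (csum m v) /\ csummable m v.
Proof.
move=> vb bB.
have h1 : cvgn (fun N => \sum_(m <= n < N) CRe (v n)).
  by apply: real_abs_cvg bB => n; apply: le_trans (vb n); exact: Re_le_cabs.
have h2 : cvgn (fun N => \sum_(m <= n < N) CIm (v n)).
  by apply: real_abs_cvg bB => n; apply: le_trans (vb n); exact: Im_le_cabs.
have h : csumto m v (limn (fun N => \sum_(m <= n < N) CRe (v n)) +i*
                     limn (fun N => \sum_(m <= n < N) CIm (v n))).
  by split => /=; [under eq_fun do rewrite Re_sum|under eq_fun do rewrite Im_sum].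
by have [h3 ->] := csumto_csum h.
Qed.

End ComplexSeries.

(** * The exponential series *)

Section ExpSeries.
Variable R : realType.
Implicit Types (x y : R) (w z : R[i]).

Lemma fact_double_le k : ((2 * k)`! <= 4 ^ k * k`! ^ 2)%N.
Proof.
elim: k => [//|k IH]; rewrite mulnS !addSn add0n !factS expnS expnMn.
rewrite [leqRHS](_ : _ = (4 * k.+1 ^ 2) * (4 ^ k * k`! ^ 2))%N; last by ring.
rewrite mulnA leq_mul//; apply: (@leq_trans ((2 * k).+2 * (2 * k).+2)); first by rewrite leq_mul.
by rewrite [leqLHS](_ : _ = 4 * k.+1 ^ 2)%N //; ring.
Qed.

Lemma expR_sum_ge y M : 0 <= y -> \sum_(0 <= j < M) y ^+ j / j`!%:R <= expR y.
Proof.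
move=> y0; rewrite (_ : \sum_(0 <= j < M) _ = series (exp_coeff y) M); last first.
  by apply: eq_bigr => j _; rewrite exp_coeffE mulrC.
apply: nondecreasing_cvgn_le; last exact: is_cvg_series_exp_coeff.
by apply: nondecreasing_sum_nat => n; exact: exp_coeff_ge0.
Qed.

(** The left side is a partial sum of I_0(y). By [fact_double_le] its terms are at most y^(2k) /
    (2k)!, the terms of even index in the exponential series. *)
Lemma sum_bessel_le y N : 0 <= y ->
  \sum_(0 <= k < N) (y ^+ 2 / 4) ^+ k / k`!%:R ^+ 2 <= expR y.
Proof.
move=> y0; apply: le_trans (expR_sum_ge (2 * N) y0).
elim: N => [|N IH]; first by rewrite muln0 !big_geq.
rewrite mulnS !addSn add0n !big_nat_recr//= -addrA lerD//.
rewrite -[leLHS]addr0 lerD//; last by rewrite divr_ge0 ?exprn_ge0.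
rewrite expr_div_n -exprM -mulrA ler_wpM2l ?exprn_ge0// -invfM lef_pV2 ?posrE ?mulr_gt0 ?exprn_gt0 ?ltr0n ?fact_gt0//.
by rewrite -!natrX -natrM ler_nat fact_double_le.
Qed.

Lemma natC_neq0 n : (n.+1%:R : R[i]) != 0.
Proof. by rewrite pnatr_eq0. Qed.

Lemma cderX (f : R -> R[i]) t (l : R[i]) n : cder f t l ->
  cder (fun t => f t ^+ n) t (n%:R * l * f t ^+ n.-1).
Proof.
move=> hf; case: n => [|n].
  by apply: (cder_eq (cder_ext _ (cder_cst 1 t))) => [s|]; rewrite ?expr0// !mul0r.
elim: n => [|n IH].
  by apply: (cder_eq (cder_ext (fun s => esym (expr1 _)) hf)); rewrite expr0; ring.
apply: (cder_eq (cder_ext (fun s => esym (exprS _ _)) (cderM hf IH))).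
by rewrite -[in n.+2%:R]addn1 natrD !exprS /=; ring.
Qed.

Lemma cder_expterm w n t : cder (fun t : R => (t%:C * w) ^+ n.+1 / n.+1`!%:R) t
  (w * ((t%:C * w) ^+ n / n`!%:R)).
Proof.
have hid : cder (fun t : R => t%:C * w) t w.
  have h := cderM (cder_real (is_derive_id t (1 : R))) (cder_cst w t).
  by apply: (cder_eq h); rewrite /=; ring.
have hh := cderM (cderX n.+1 hid) (cder_cst (n.+1`!%:R^-1 : R[i]) t).
apply: (cder_eq hh); rewrite factS natrM invfM.
rewrite mulr0 addr0 [LHS](_ : _ = (n.+1%:R / n.+1%:R) * (w * ((t%:C * w) ^+ n / n`!%:R))); last by ring.
by rewrite divff ?natC_neq0// mul1r.
Qed.

(* By induction on [N] the sum [S_N(t)] satisfies [S_(N+1)' = w S_N], so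
   [S_N(t) cexp (- t w)] has derivative [- w (t w)^(N-1) / (N-1)! cexp (- t w)]. *)
Lemma cder_expsum w N t :
  cder (fun t : R => (\sum_(0 <= j < N.+1) (t%:C * w) ^+ j / j`!%:R) * cexp (- (t%:C * w))) t
    (- (w * ((t%:C * w) ^+ N / N`!%:R)) * cexp (- (t%:C * w))).
Proof.
have hid : cder (fun t : R => t%:C * w) t w.
  have h := cderM (cder_real (is_derive_id t (1 : R))) (cder_cst w t).
  by apply: (cder_eq h); rewrite /=; ring.
have hs : cder (fun t : R => \sum_(0 <= j < N.+1) (t%:C * w) ^+ j / j`!%:R) t
    (w * \sum_(0 <= j < N) (t%:C * w) ^+ j / j`!%:R).
  elim: N => [|N IH].
    apply: (cder_eq (cder_ext _ (cder_cst 1 t))) => [s|].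
      by rewrite big_nat1 expr0 fact0 divr1.
    by rewrite big_geq// mulr0.
  apply: (cder_eq (cder_ext _ (cderD IH (cder_expterm w N t)))) => [s|].
    by rewrite [RHS]big_nat_recr.
  by rewrite [in RHS]big_nat_recr//=; ring.
apply: (cder_eq (cderM hs (cder_cexp (cderN hid)))).
by rewrite [in X in _ + X]big_nat_recr//=; ring.
Qed.

Lemma cexp_series w : csumto 0 (fun j => w ^+ j / j`!%:R) (cexp w).
Proof.
pose h N (t : R) := (\sum_(0 <= j < N.+1) (t%:C * w) ^+ j / j`!%:R) * cexp (- (t%:C * w)).
pose h' N (t : R) := - (w * ((t%:C * w) ^+ N / N`!%:R)) * cexp (- (t%:C * w)).
pose C := cabs w * expR (cabs w).
have h'le N t : 0 <= t <= 1 -> cabs (h' N t) <= C * exp_coeff (cabs w) N.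
  move=> /andP[t0 t1]; rewrite /h' cabsM cabsN !cabsM cabsX cabs_cexp exp_coeffE.
  rewrite [cabs N`!%:R^-1]cabsV -realCn cabs_real ger0_norm ?ler0n//.
  have tw : cabs (t%:C * w) <= cabs w.
    by rewrite cabsM cabs_real ger0_norm// ler_piMl// cabs_ge0.
  rewrite /C -mulrA -[leRHS]mulrA ler_wpM2l ?cabs_ge0// mulrC ler_pM ?mulr_ge0 ?invr_ge0 ?exprn_ge0 ?cabs_ge0 ?expR_ge0//.
    rewrite ler_expR; apply: le_trans tw; apply: le_trans (Re_le_cabs _).
    by rewrite ReN -normrN ler_norm.
  by rewrite [leRHS]mulrC ler_wpM2r ?invr_ge0// lerXn2r// ?nnegrE ?cabs_ge0.
(* The mean value theorem is applied to the real and the imaginary part separately, hence the factor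
   2. *)
have key N : cabs (h N 1 - 1) <= 2 * (C * exp_coeff (cabs w) N).
  have h0 : h N 0 = 1.
    rewrite /h mul0r oppr0 cexp0 mulr1 big_nat_recl// expr0 fact0 divr1.
    by rewrite big1 ?addr0// => j _; rewrite expr0n mul0r.
  have mvt (P : R[i] -> R) : (forall t : R, is_derive t 1 (P \o h N) (P (h' N t))) ->
      (forall z, `|P z| <= cabs z) -> `|P (h N 1) - P (h N 0)| <= C * exp_coeff (cabs w) N.
    move=> dP leP.
    have [|c] := @MVT R (P \o h N) (fun t => P (h' N t)) 0 1 ltr01 (fun t _ => dP t).
    - by apply: derivable_within_continuous => t _; have := dP t => -[].
    rewrite in_itv/= subr0 mulr1 => /andP[/ltW c0 /ltW c1] ->.
    by apply: le_trans (leP _) _; apply: h'le; rewrite c0 c1.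
  have d t : cder (h N) t (h' N t) by exact: cder_expsum.
  have m1 := mvt _ (fun t => (d t).1) (@Re_le_cabs R).
  have m2 := mvt _ (fun t => (d t).2) (@Im_le_cabs R).
  have -> : h N 1 - 1 = h N 1 - h N 0 by rewrite h0.
  apply: le_trans (cabs_le _) _; rewrite ReD ReN ImD ImN.
  by rewrite mulr_natl mulr2n lerD.
have c1 : (fun N => cabs (h N 1 - 1)) @ \oo --> 0.
  have k0 : (fun N => 2 * (C * exp_coeff (cabs w) N)) @ \oo --> 2 * (C * 0).
    by apply: cvgMl_tmp; apply: cvgMl_tmp; exact: cvg_exp_coeff.
  rewrite !mulr0 in k0; apply: (squeeze_cvgr _ (cvg_cst 0) k0).
  by apply: nearW => N; rewrite cabs_ge0 key.
have /(ccvgZ (cexp w)) c2 := cabs_cvg0_ccvg c1.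
rewrite /csumto; rewrite mulr1 in c2.
have e N : cexp w * h N 1 = \sum_(0 <= j < N.+1) w ^+ j / j`!%:R.
  by rewrite /h mul1r mulrCA -cexpD subrr cexp0 mulr1.
move: c2 => [c3 c4]; split; rewrite -cvg_shiftS/=.
- by under eq_fun do rewrite -e.
- by under eq_fun do rewrite -e.
Qed.

End ExpSeries.

(** * Integrals over the half-line *)

Section HalfLine.
Variable R : realType.
Local Notation leb := (@lebesgue_measure R).
Implicit Types (x : R) (f : R -> R[i]).

(** As a factor it turns half-line integrals into integrals over the line and discards the points x
    <= 0, where [ln] and [Num.sqrt] take default values. *)
Definition pos x : R := \1_(`]0, +oo[%classic) x.

Lemma pos_gt0 x : 0 < x -> pos x = 1.
Proof. by move=> x0; rewrite /pos indicE mem_set//= in_itv/= x0. Qed.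

Lemma pos_le0 x : x <= 0 -> pos x = 0.
Proof. by move=> x0; rewrite /pos indicE memNset//= in_itv/= andbT; apply/negP; rewrite -leNgt. Qed.

Lemma pos_ge0 x : 0 <= pos x.
Proof. by rewrite /pos indicE. Qed.

Lemma measurable_pos : measurable_fun setT pos.
Proof. exact: measurable_indic. Qed.

Lemma cinT f : cintegrable `]0, +oo[ f <-> cin leb (fun x => f x * (pos x)%:C).
Proof.
have h1 : CRe \o (fun x => f x * (pos x)%:C) = fun x => CRe (f x) * pos x.
  by apply/funext => x; rewrite [LHS]/comp ReM/= mulr0 subr0.
have h2 : CIm \o (fun x => f x * (pos x)%:C) = fun x => CIm (f x) * pos x.
  by apply/funext => x; rewrite [LHS]/comp ImM/= mulr0 add0r.
by rewrite /cintegrable /cin h1 h2; split=> -[? ?]; split; apply/rintT.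
Qed.

Lemma cIT f : cintegral `]0, +oo[ f = cI leb (fun x => f x * (pos x)%:C).
Proof.
rewrite /cintegral !RintT; apply: eqC => /=; apply: eq_Rintegral => x _.
  by rewrite ReM/= mulr0 subr0.
by rewrite ImM/= mulr0 add0r.
Qed.

Lemma cmeas_pos : cmeas (fun x => (pos x)%:C).
Proof. exact: cmeas_real measurable_pos. Qed.

Lemma cmeas_lim d (T : measurableType d) (f_ : nat -> T -> R[i]) (f : T -> R[i]) :
  (forall n, cmeas (f_ n)) -> (forall t, ccvg (f_ ^~ t) (f t)) -> cmeas f.
Proof.
move=> mf h; split.
- by apply: (@measurable_fun_cvg _ _ _ _ (fun n => CRe \o f_ n)); [move=> n; exact: (mf n).1|move=> t _; exact: (h t).1].
- by apply: (@measurable_fun_cvg _ _ _ _ (fun n => CIm \o f_ n)); [move=> n; exact: (mf n).2|move=> t _; exact: (h t).2].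
Qed.

Lemma cmeas_sum d (T : measurableType d) (I : Type) (r : seq I) (F : I -> T -> R[i]) :
  (forall k, cmeas (F k)) -> cmeas (fun t => \sum_(k <- r) F k t).
Proof.
move=> mF; elim: r => [|k r IH].
  by under eq_fun do rewrite big_nil; exact: cmeas_cst.
by under eq_fun do rewrite big_cons; exact: cmeasD.
Qed.

Lemma cmeasX d (T : measurableType d) (f : T -> R[i]) n : cmeas f -> cmeas (fun t => f t ^+ n).
Proof.
move=> mf; elim: n => [|n IH]; first by under eq_fun do rewrite expr0; exact: cmeas_cst.
by under eq_fun do rewrite exprS; exact: cmeasM.
Qed.

End HalfLine.

(** * The power series of the Bessel function of imaginary order *)

Section BesselJ.
Variable R : realType.
Local Notation leb := (@lebesgue_measure R).
Implicit Types (x tau : R).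

(** The terms of J_(i tau)(2 sqrt(2x)) without the common power (2x)^(i tau / 2). As (y/2)^2 = 2x,
    they are monomials in x. *)
Definition jterm tau x k : R[i] :=
  (-1) ^+ k * (2 * x)%:C ^+ k / (k`!%:R * gam (k%:R + 1 + 'i * tau%:C)).

Definition jser tau x := csum 0 (jterm tau x).

Definition bcst tau : R := Num.sqrt (cosh (pi * tau)).

Lemma jterm_le tau x k :
  cabs (jterm tau x k) <= ((2 * Num.sqrt (2 * `|x|)) ^+ 2 / 4) ^+ k / k`!%:R ^+ 2 * bcst tau.
Proof.
have -> : (2 * Num.sqrt (2 * `|x|)) ^+ 2 / 4 = `|2 * x|.
  rewrite exprMn sqr_sqrtr ?mulr_ge0// normrM (ger0_norm (ler0n _ 2)); by field.
rewrite /jterm !cabsM cabsV !cabsM !cabsX cabs_real cabsN cabs1 expr1n mul1r.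
rewrite -realCn cabs_real [`|k`!%:R|]ger0_norm ?ler0n// -[leRHS]mulrA ler_wpM2l ?exprn_ge0//.
have f0 : 0 < k`!%:R :> R by rewrite ltr0n fact_gt0.
have := gam_lower tau k; rewrite -/(bcst tau); set g := cabs _ => hg.
have g0 : 0 < g.
  rewrite lt_neqAle cabs_ge0 andbT; apply/eqP => g0.
  by move: hg; rewrite -g0 mul0r leNgt f0.
rewrite invfM expr2 invfM -mulrA ler_wpM2l ?invr_ge0 ?(ltW f0)//.
by rewrite ler_pdivlMl// ler_pdivrMr// mulrC.
Qed.

Lemma sum_jterm_le tau x N :
  \sum_(0 <= k < N) ((2 * Num.sqrt (2 * `|x|)) ^+ 2 / 4) ^+ k / k`!%:R ^+ 2 * bcst tau
  <= expR (2 * Num.sqrt (2 * `|x|)) * bcst tau.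
Proof.
rewrite -mulr_suml ler_wpM2r ?sqrtr_ge0// sum_bessel_le// mulr_ge0 ?sqrtr_ge0.
Qed.

Lemma jser_csumto tau x : csumto 0 (jterm tau x) (jser tau x).
Proof. by have [] := csumto_abs (jterm_le tau x) (sum_jterm_le tau x). Qed.

Lemma jpart_le tau x N :
  cabs (\sum_(0 <= k < N) jterm tau x k) <= expR (2 * Num.sqrt (2 * `|x|)) * bcst tau.
Proof.
apply: le_trans (cabs_sum _ _ _) _; apply: le_trans (sum_jterm_le tau x N).
by apply: ler_sum => k _; exact: jterm_le.
Qed.

Lemma jser_le tau x : cabs (jser tau x) <= expR (2 * Num.sqrt (2 * `|x|)) * bcst tau.
Proof. exact: ccvg_le (jser_csumto tau x) (jpart_le tau x). Qed.

Lemma cmeas_jterm tau k : cmeas (fun x => jterm tau x k).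
Proof.
apply: cmeasM; last exact: cmeas_cst.
apply: cmeasM; first exact: cmeas_cst.
by apply: cmeasX; apply: cmeas_real; apply: measurable_funM => //; exact: measurable_cst.
Qed.

Lemma cmeas_jser tau : cmeas (jser tau).
Proof.
apply: (@cmeas_lim _ _ _ (fun N x => \sum_(0 <= k < N) jterm tau x k)) => [N|x].
  by apply: cmeas_sum => k; exact: cmeas_jterm.
exact: jser_csumto.
Qed.

Lemma besselJ_x tau x : 0 < x -> besselJ ('i * tau%:C) (2 * Num.sqrt (2 * x)) =
  cexp ('i * (tau * ln (Num.sqrt (2 * x)))%:C) * jser tau x.
Proof.
move=> x0; have s0 : 0 < Num.sqrt (2 * x) by rewrite sqrtr_gt0 mulr_gt0.
suff h : csumto 0 (fun k : nat => (-1) ^+ k * rcpow (2 * Num.sqrt (2 * x) / 2)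
    ('i * tau%:C + (2 * k)%:R) / ((k`!)%:R * Gamma ('i * tau%:C + k%:R + 1)))
    (cexp ('i * (tau * ln (Num.sqrt (2 * x)))%:C) * jser tau x).
  by have [_ <-] := csumto_csum h.
have := ccvgZ (cexp ('i * (tau * ln (Num.sqrt (2 * x)))%:C)) (jser_csumto tau x).
suff e k : (-1) ^+ k * rcpow (2 * Num.sqrt (2 * x) / 2) ('i * tau%:C + (2 * k)%:R) /
   ((k`!)%:R * Gamma ('i * tau%:C + k%:R + 1)) =
   cexp ('i * (tau * ln (Num.sqrt (2 * x)))%:C) * jterm tau x k.
  rewrite /csumto; under [in X in X -> _]eq_fun do rewrite mulr_sumr.
  by under [in X in _ -> X]eq_fun do (under eq_bigr do rewrite e).
have -> : 2 * Num.sqrt (2 * x) / 2 = Num.sqrt (2 * x) by field.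
rewrite /rcpow mulrDl cexpD GammaE; last first.
  rewrite -realCn !ReImE/= mul0r mulr0 subr0 add0r.
  by have := ler0n R k; lra.
rewrite (_ : (2 * k)%:R * _ = (ln (Num.sqrt (2 * x)))%:C *+ (2 * k)); last first.
  by rewrite mulr_natl.
rewrite cexpMn cexp_real lnK ?posrE// exprM -realC_expr sqr_sqrtr ?mulr_ge0 ?(ltW x0)//.
rewrite /jterm (_ : 'i * tau%:C + k%:R + 1 = k%:R + 1 + 'i * tau%:C); last by ring.
have -> : 'i * tau%:C * (ln (Num.sqrt (2 * x)))%:C = 'i * (tau * ln (Num.sqrt (2 * x)))%:C by rewrite realCM mulrA.
set q := cexp _; set g := gam _; set f := k`!%:R; ring.
Qed.

Lemma jser_conj tau x : jser (- tau) x = (jser tau x)^*.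
Proof.
apply: ccvg_uniq (jser_csumto (- tau) x) _.
have := ccvg_conj (jser_csumto tau x).
suff e N : \sum_(0 <= k < N) jterm (- tau) x k = (\sum_(0 <= k < N) jterm tau x k)^*.
  by rewrite /csumto; under [in X in _ -> X]eq_fun do rewrite e.
suff ek k : jterm (- tau) x k = (jterm tau x k)^*.
  by rewrite rmorph_sum; apply: eq_bigr => k _; exact: ek.
pose cj (z : R[i]) : R[i] := CRe z -i* CIm z.
have cjE z : z^* = cj z by case: z.
have cjM z w : cj (z * w) = cj z * cj w by rewrite /cj; apply: eqC => /=; rewrite ?ReM ?ImM; ring.
have cjV z : cj z^-1 = (cj z)^-1 by case: z => p q; rewrite /cj; apply: eqC => /=; rewrite ?sqrrN ?mulNr.
have cjX z n : cj (z ^+ n) = cj z ^+ n.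
  elim: n => [|n IH]; first by apply: eqC; rewrite /= ?oppr0.
  by rewrite !exprS cjM IH.
have cjR (y : R) : cj y%:C = y%:C by apply: eqC; rewrite /= ?oppr0.
rewrite cjE /jterm !cjM cjV cjM !cjX cjR -[k`!%:R]realCn cjR.
rewrite (_ : cj (gam _) = gam (cj (k%:R + 1 + 'i * tau%:C))); last first.
  rewrite -!cjE; symmetry; apply: gam_conj.
  by rewrite -realCn !ReImE/=; have := ler0n R k; lra.
have -> : cj (-1) = -1 by rewrite /cj; apply: eqC; rewrite /= ?oppr0.
have -> // : cj (k%:R + 1 + 'i * tau%:C) = k%:R + 1 + 'i * (- tau)%:C.
by rewrite -!realCn /cj; apply: eqC => /=; ring.
Qed.

End BesselJ.

(** * Weber's integral and the triple integral *)

Section Weber.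
Variable R : realType.
Local Notation leb := (@lebesgue_measure R).
Implicit Types (x y tau z : R).

Lemma gam_nat_neq0 tau k : gam (k%:R + 1 + 'i * tau%:C : R[i]) != 0.
Proof.
rewrite -cabs_gt0 lt_neqAle cabs_ge0 andbT; apply/eqP => g0.
by have := gam_lower tau k; rewrite -g0 mul0r leNgt ltr0n fact_gt0.
Qed.

(** The inequality between the arithmetic and geometric means with a free weight [z]: the growth
    exp(2 sqrt(2x)) is beaten by any decay exp(- k x). *)
Lemma sqrt2_le z x : 0 < z -> 0 <= x -> 2 * Num.sqrt (2 * x) <= 2 / z + z * x.
Proof.
move=> z0 x0; have hx : Num.sqrt (2 * x) ^+ 2 = 2 * x by rewrite sqr_sqrtr ?mulr_ge0.
set y := Num.sqrt (2 * x) in hx *.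
have -> : x = y ^+ 2 / 2 by rewrite hx; field.
rewrite -subr_ge0 (_ : _ - _ = (z * y - 2) ^+ 2 / (2 * z)); last by field; rewrite gt_eqF.
by rewrite divr_ge0 ?sqr_ge0// mulr_ge0// ltW.
Qed.

(** Half of the power (2x)^(i tau) belongs to J; the other half comes from the translation in
    [besselKi_x]. *)
Definition wterm tau z k x : R[i] :=
  cexp ('i * (tau * ln (2 * x))%:C) * x%:C ^+ k * cexp (- (omega R * (z * x)%:C)).

Lemma wterm_int tau z k : 0 < z ->
  cin leb (fun x => wterm tau z k x * (pos x)%:C) /\
  cI leb (fun x => wterm tau z k x * (pos x)%:C) =
  cexp ('i * (tau * ln 2)%:C) *
  (cexp (- ((k%:R + 1 + 'i * tau%:C) * ((ln z)%:C + 'i * (pi / 4)%:C))) * gam (k%:R + 1 + 'i * tau%:C)).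
Proof.
move=> z0; set c := k%:R + 1 + 'i * tau%:C.
have hc : 2^-1 <= CRe c.
  by rewrite /c -realCn !ReImE/=; have := ler0n R k; lra.
have [h1 h2] := gam_ray z0 hc (pi4_bound R).
have e s : wterm tau z k (expR s) * (expR s)%:C =
    cexp ('i * (tau * ln 2)%:C) * cexp (c * s%:C - (z * expR s)%:C * cexp ('i * (pi / 4)%:C)).
  rewrite /wterm lnM ?posrE ?expR_gt0// expRK -!cexp_real -cexpMn -!cexpD.
  congr cexp; rewrite /c -/(omega R) -mulr_natl !realCM !realCD; ring.
have hG x : 0 < x -> exists l, cder (wterm tau z k) x l.
  move=> x0.
  have d1 : is_derive x 1 (fun x : R => 2 * x) 2.
    by apply: is_derive_eq; rewrite /GRing.scale/= mulr1.
  have p2 : 0 < 2 * x by rewrite mulr_gt0.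
  have d2 : is_derive x 1 (fun x : R => ln (2 * x)) (2 / (2 * x)).
    by apply: (is_derive_eq (is_derive1_comp (is_derive1_ln p2) d1)); rewrite mulrC.
  have d3 : is_derive x 1 (fun x : R => tau * ln (2 * x)) (tau * (2 / (2 * x))).
    exact: is_deriveZ.
  have d4 : is_derive x 1 (fun x : R => z * x) z.
    by apply: is_derive_eq; rewrite /GRing.scale/= mulr1.
  have dX := cderX k (cder_real (is_derive_id x (1 : R))).
  by eexists; exact: (cderM (cderM (cder_cexp (cderZ 'i (cder_real d3))) dX)
    (cder_cexp (cderN (cderZ (omega R) (cder_real d4))))).
have [l hl] : exists l, forall x, 0 < x -> cder (wterm tau z k) x (l x).
  (* The derivative is known to exist at each positive point; choice makes it a function of the
     point, with default value 0. *)
  exists (fun x => xget 0 [set l | cder (wterm tau z k) x l]) => x /hG[l hl].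
  by have := xgetPex 0 (ex_intro _ l hl : exists l, [set l | cder (wterm tau z k) x l] l).
have hci : cin leb (fun s => wterm tau z k (expR s) * (expR s)%:C).
  by under eq_fun do rewrite e; exact: cinZ.
have [/cinT h3 h4] := csubst_expR hl hci; split => //.
by rewrite -cIT h4 (eq_cI leb e) cI_Z// h2.
Qed.

Lemma weber_dom_int (k : R) : 0 < k ->
  rint leb (fun x => expR (2 * Num.sqrt (2 * `|x|)) * expR (- (k * x)) * pos x).
Proof.
move=> k0; have k2 : 0 < k / 2 by rewrite divr_gt0.
apply: (rint_dom _ _ (rintZ (expR (2 / (k / 2))) (exp_int k2).1)).
  apply: measurable_funM; last exact: measurable_pos.
  apply: measurable_funM; apply: measurable_funexpR.
    apply: measurable_funM; first exact: measurable_cst.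
    apply: (measurableT_comp (continuous_measurable_fun (@sqrt_continuous R))).
    by apply: measurable_funM; [exact: measurable_cst|exact: (continuous_measurable_fun (@norm_continuous _ R^o))].
  by apply: measurableT_comp => //; apply: measurable_funM => //; exact: measurable_cst.
move=> x; case: (ltP 0 x) => x0; last first.
  by rewrite pos_le0// [\1__ _]pos_le0// !mulr0 normr0.
rewrite pos_gt0// [\1__ _]pos_gt0// !mulr1 ger0_norm ?mulr_ge0 ?expR_ge0//.
rewrite -!expRD ler_expR ger0_norm ?(ltW x0)//.
by have := sqrt2_le k2 (ltW x0); lra.
Qed.

(* Weber's integral of [x^(nu/2) J_nu(2 sqrt(2x)) exp(- omega z x)], term by term. *)
Lemma weber tau z : 0 < z ->
  let f := fun x => cexp ('i * (tau * ln (2 * x))%:C) * jser tau x *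
    cexp (- (omega R * (z * x)%:C)) * (pos x)%:C in
  cin leb f /\ cI leb f =
  cexp ('i * (tau * ln 2)%:C) * cexp (- ((1 + 'i * tau%:C) * ((ln z)%:C + 'i * (pi / 4)%:C))) *
    cexp (- (2 * omJ R / z%:C)).
Proof.
move=> z0 f; set L := (ln z)%:C + 'i * (pi / 4)%:C.
pose C k : R[i] := (-1) ^+ k * 2%:C ^+ k / (k`!%:R * gam (k%:R + 1 + 'i * tau%:C)).
pose f_ N x := \sum_(0 <= k < N) C k * (wterm tau z k x * (pos x)%:C).
have f_E N x : f_ N x = (\sum_(0 <= k < N) jterm tau x k) *
    (cexp ('i * (tau * ln (2 * x))%:C) * cexp (- (omega R * (z * x)%:C)) * (pos x)%:C).
  rewrite mulr_suml; apply: eq_bigr => k _.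
  by rewrite /C /wterm /jterm [(2 * x)%:C]realCM exprMn; ring.
have cf_ N : cin leb (f_ N).
  by apply: cin_sum => k; apply: cinZ; exact: (wterm_int tau k z0).1.
have conv x : ccvg (f_ ^~ x) (f x).
  under eq_fun do rewrite f_E mulrC.
  rewrite (_ : f x = (cexp ('i * (tau * ln (2 * x))%:C) * cexp (- (omega R * (z * x)%:C)) * (pos x)%:C) * jser tau x).
    by apply: ccvgZ; exact: jser_csumto.
  by rewrite /f; ring.
have k0 : 0 < CRe (omega R) * z by rewrite mulr_gt0// Re_omega_gt0.
have dom := rintZ (bcst tau) (weber_dom_int k0).
have le_f N x : cabs (f_ N x) <=
    bcst tau * (expR (2 * Num.sqrt (2 * `|x|)) * expR (- (CRe (omega R) * z * x)) * pos x).
  rewrite f_E !cabsM !cabs_cexp cabs_real [`|pos x|]ger0_norm ?pos_ge0//.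
  rewrite [CRe ('i * _)](_ : _ = 0); last by rewrite !ReImE/=; ring.
  rewrite [CRe (- _)](_ : _ = - (CRe (omega R) * z * x)); last by rewrite ReN mulrC ReZ; ring.
  rewrite expR0 mul1r; set b := expR (- _).
  rewrite [leRHS](_ : _ = expR (2 * Num.sqrt (2 * `|x|)) * bcst tau * (b * pos x)); last by ring.
  by apply: ler_wpM2r; rewrite ?mulr_ge0 ?expR_ge0 ?pos_ge0 ?jpart_le.
have [h1 h2 h3] := cdct (fun N => cin_meas (cf_ N)) (fun x => (conv x).1) (fun x => (conv x).2) dom le_f.
split => //; apply: (@ccvg_uniq _ (fun N => cI leb (f_ N))) => //.
have eL : cexp (- L) = omJ R / z%:C.
  rewrite /L opprD cexpD -realCN cexp_real expRN lnK ?posrE// cexpN -/(omega R) omegaV realCV.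
  by rewrite mulrC.
(* The Gamma value produced by each integral cancels the one in the coefficient, which leaves the
   partial sums of an exponential series. *)
have e N : cI leb (f_ N) = cexp ('i * (tau * ln 2)%:C) * cexp (- ((1 + 'i * tau%:C) * L)) *
    \sum_(0 <= k < N) (- (2 * omJ R / z%:C)) ^+ k / k`!%:R.
  rewrite cI_sum; last by move=> k; apply: cinZ; exact: (wterm_int tau k z0).1.
  rewrite mulr_sumr; apply: eq_bigr => k _.
  rewrite cI_Z; last exact: (wterm_int tau k z0).1.
  rewrite (wterm_int tau k z0).2 -/L.
  have -> : - ((k%:R + 1 + 'i * tau%:C) * L) = - ((1 + 'i * tau%:C) * L) + (- L) *+ k.
    by rewrite -mulr_natl; ring.
  rewrite cexpD cexpMn eL /C.
  have -> : - (2 * omJ R / z%:C) = -1 * 2%:C * (omJ R / z%:C) by rewrite -realCn; ring.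
  rewrite !exprMn; have := gam_nat_neq0 tau k; set g := gam _ => g0.
  rewrite invfM; set u := cexp _; set v := cexp _; set w := (omJ R) ^+ k.
  transitivity (g^-1 * g * (u * v * ((-1) ^+ k * 2%:C ^+ k * (w * z%:C^-1 ^+ k) / k`!%:R))).
    by ring.
  by rewrite mulVf// mul1r.
have := ccvgZ (cexp ('i * (tau * ln 2)%:C) * cexp (- ((1 + 'i * tau%:C) * L))) (cexp_series (- (2 * omJ R / z%:C))).
by under [in X in X -> _]eq_fun do rewrite -e.
Qed.

End Weber.

(** * Dominating functions for the triple integral *)

Section Dominators.
Variable R : realType.
Local Notation leb := (@lebesgue_measure R).
Implicit Types (x y p q : R).

(** What [exponent_le] can spare: of each weight 1/2 it spends 5/12 on the growth of J, and 5/12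
    (7/5 + 1) = 1. *)
Let eta : R := 12^-1.

Definition dexp x p : R := expR (- (eta * expR p + eta * x * expR (- p))).

Definition dint x : R := \int[leb]_p dexp x p.

Let w p : R := expR (- (eta * expR p)) * expR (2^-1 * p).

Let rint_w : rint leb w.
Proof.
have e0 : 0 < eta by rewrite /eta.
have h : 2^-1 <= CRe (2^-1%:C : R[i]) by [].
apply: (rint_dom _ _ (cin_cabs (cin_gam e0 h))).
  by apply: measurable_funM; apply: measurable_funexpR; [apply: measurable_funN|];
    apply: measurable_funM => //; exact: measurable_expR.
move=> p; rewrite ger0_norm ?mulr_ge0 ?expR_ge0// /w -expRD mexpE0 cabs_cexp cexp_real.
by rewrite ler_expR !ReImE/=; lra.
Qed.

Lemma dexp_ge0 x p : 0 <= dexp x p.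
Proof. exact: expR_ge0. Qed.

Lemma rint_dexp_x x : 0 < x -> rint leb (dexp x).
Proof. by move=> x0; apply: rint_dexp; rewrite ?mulr_gt0 ?invr_gt0. Qed.

Lemma measurable_dexp : measurable_fun setT (fun z : R * R => dexp z.1 z.2).
Proof.
apply: measurable_funexpR; apply: measurable_funN; apply: measurable_funD.
  apply: measurable_funM; first exact: measurable_cst.
  by apply: measurable_funexpR; exact: measurable_snd.
apply: measurable_funM.
  by apply: measurable_funM; [exact: measurable_cst|exact: measurable_fst].
by apply: measurable_funexpR; apply: measurable_funN; exact: measurable_snd.
Qed.

Lemma measurable_dint : measurable_fun setT dint.
Proof. exact: (measurable_param leb measurable_dexp). Qed.

Lemma measurable_dexp1 p : measurable_fun setT (fun x => dexp x p).
Proof. exact: (measurableT_comp measurable_dexp (pair2_measurable p)). Qed.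

Lemma dint_ge0 x : 0 <= dint x.
Proof. by apply: Rintegral_ge0 => p _; exact: dexp_ge0. Qed.

Lemma measurable_pos_fst : measurable_fun setT (fun z : R * R => pos z.1).
Proof. by apply: (measurableT_comp (f := @pos R)); [exact: measurable_pos|exact: measurable_fst]. Qed.

(** The integral over x produces 1 / (exp(- p) + exp(- q)), at most half of exp(p/2) exp(q/2). This
    separates the variables, and the weight [w] is integrable as an Euler integrand at 1/2. *)
Let dexp2_x p q : rint leb (fun x => dexp x p * dexp x q * pos x) /\
  \int[leb]_x (dexp x p * dexp x q * pos x) <= (2 * eta)^-1 * (w p * w q).
Proof.
have e0 : 0 < eta by rewrite /eta.
pose k := eta * (expR (- p) + expR (- q)).
have k0 : 0 < k by rewrite mulr_gt0// addr_gt0 ?expR_gt0.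
have E x : dexp x p * dexp x q * pos x =
    expR (- (eta * expR p)) * expR (- (eta * expR q)) * (expR (- (k * x)) * pos x).
  by rewrite mulrA -!expRD; congr (expR _ * _); rewrite /k; ring.
have [h1 h2] := exp_int k0.
split; first by under [X in rint _ X]funext do rewrite E; exact: rintZ.
under eq_Rintegral do rewrite E.
rewrite rI_Z// h2 /w [leRHS](_ : _ = expR (- (eta * expR p)) * expR (- (eta * expR q)) *
   ((2 * eta)^-1 * (expR (2^-1 * p) * expR (2^-1 * q)))); last by ring.
rewrite ler_wpM2l ?mulr_ge0 ?expR_ge0//.
set a := expR (2^-1 * p); set b := expR (2^-1 * q).
have a0 : 0 < a by exact: expR_gt0. have b0 : 0 < b by exact: expR_gt0.
have ea : expR (- p) = a^-1 ^+ 2 by rewrite /a -expRN -expRM_natl; congr expR; field.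
have eb : expR (- q) = b^-1 ^+ 2 by rewrite /b -expRN -expRM_natl; congr expR; field.
rewrite /k ea eb -[a * b]invrK -invfM lef_pV2 ?posrE ?mulr_gt0 ?addr_gt0 ?invr_gt0 ?exprn_gt0 ?invr_gt0 ?mulr_gt0//.
rewrite invfM [leLHS](_ : _ = eta * (2 * (a^-1 / b))); last by ring.
rewrite ler_wpM2l ?(ltW e0)// -subr_ge0.
by rewrite (_ : _ - _ = (a^-1 - b^-1) ^+ 2) ?sqr_ge0//; ring.
Qed.

Let W := \int[leb]_p w p.

Lemma dexp2_prod p : rint (leb \x leb)%E (fun z : R * R => dexp z.1 p * dexp z.1 z.2 * pos z.1).
Proof.
apply: (@rint_prod21 _ _ _ _ _ leb leb _ (fun q => (2 * eta)^-1 * (w p * w q))).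
- apply: measurable_funM.
    apply: measurable_funM measurable_dexp.
    by apply: (measurableT_comp (f := dexp^~ p)); [exact: measurable_dexp1|exact: measurable_fst].
  exact: measurable_pos_fst.
- by move=> q; exact: (dexp2_x p q).1.
- move=> q; apply: le_trans (dexp2_x p q).2; rewrite le_eqVlt; apply/orP; left; apply/eqP.
  by apply: eq_Rintegral => x _; rewrite ger0_norm// !mulr_ge0 ?dexp_ge0 ?pos_ge0.
- by apply: rintZ; apply: rintZ; exact: rint_w.
Qed.

Let dexp_dint p : rint leb (fun x => dexp x p * dint x * pos x) /\
  \int[leb]_x (dexp x p * dint x * pos x) <= (2 * eta)^-1 * (W * w p).
Proof.
have [h1 e1] := rfubini1 (dexp2_prod p); have [h2 e2] := rfubini2 (dexp2_prod p).
have E x : \int[leb]_q (dexp x p * dexp x q * pos x) = dexp x p * dint x * pos x.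
  case: (ltP 0 x) => x0; last first.
    by rewrite pos_le0// mulr0; under eq_Rintegral do rewrite mulr0; exact: rI_0.
  under eq_Rintegral do rewrite mulrAC.
  by rewrite (rI_Z _ (rint_dexp_x x0)) mulrAC.
split; first by under [X in rint _ X]funext do rewrite -E.
under eq_Rintegral do rewrite -E.
rewrite e1 -e2 [W * _]mulrC mulrA -rI_Z; last exact: rint_w.
apply: rI_le => //; first by apply: rintZ; exact: rint_w.
by move=> q; rewrite -mulrA; exact: (dexp2_x p q).2.
Qed.

Lemma dexp_dint_prod : rint (leb \x leb)%E (fun z : R * R => dexp z.1 z.2 * dint z.1 * pos z.1).
Proof.
apply: (@rint_prod21 _ _ _ _ _ leb leb _ (fun p => (2 * eta)^-1 * (W * w p))).
- apply: measurable_funM.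
    by apply: measurable_funM measurable_dexp _; apply: (measurableT_comp (f := dint)); [exact: measurable_dint|exact: measurable_fst].
  exact: measurable_pos_fst.
- by move=> q; exact: (dexp_dint q).1.
- move=> q; apply: le_trans (dexp_dint q).2; rewrite le_eqVlt; apply/orP; left; apply/eqP.
  by apply: eq_Rintegral => x _; rewrite ger0_norm// !mulr_ge0 ?dexp_ge0 ?pos_ge0 ?dint_ge0.
- by apply: rintZ; apply: rintZ; exact: rint_w.
Qed.

Lemma dint_sq : rint leb (fun x => dint x * dint x * pos x).
Proof.
have [h1 _] := rfubini1 dexp_dint_prod.
suff E x : \int[leb]_p (dexp x p * dint x * pos x) = dint x * dint x * pos x.
  by under [X in rint _ X]funext do rewrite -E.
case: (ltP 0 x) => x0; last first.
  by rewrite pos_le0// mulr0; under eq_Rintegral do rewrite mulr0; exact: rI_0.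
under eq_Rintegral do rewrite -mulrA mulrC.
by rewrite (rI_Z _ (rint_dexp_x x0)) mulrAC.
Qed.

(* With [y = 2 sqrt(2x)], AM-GM bounds the two exponents below by [1.4 y] and [y]. *)
Lemma exponent_le (k c x p q : R) : 2^-1 <= k -> 1 <= c -> 0 < x ->
  2 * Num.sqrt (2 * x) - k * (expR q + 4 * c * x * expR (- q)) -
    k * (expR p + 2 * x * expR (- p)) <=
  - (eta * expR p + eta * x * expR (- p)) - (eta * expR q + eta * x * expR (- q)).
Proof.
move=> k2 c1 x0; set y := 2 * Num.sqrt (2 * x).
have y2 : y ^+ 2 = 8 * x by rewrite /y exprMn sqr_sqrtr ?mulr_ge0 ?(ltW x0)//; ring.
have y0 : 0 <= y by rewrite mulr_ge0 ?sqrtr_ge0.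
have amgm (A B Y : R) : 0 <= Y -> 0 <= A -> 0 <= B -> Y ^+ 2 <= 4 * (A * B) -> Y <= A + B.
  move=> Y0 A0 B0 h; rewrite -ler_sqr ?nnegrE ?addr_ge0//.
  apply: le_trans h _; rewrite -subr_ge0 (_ : _ - _ = (A - B) ^+ 2) ?sqr_ge0//; ring.
have inv (s : R) : expR s * expR (- s) = 1 by rewrite -expRD subrr expR0.
have ep (s : R) := expR_ge0 s.
(* The means give the lower bound 4 sqrt(x) = sqrt(2) y, and 7/5 is a rational number just below
   sqrt(2). *)
have hq : 7 / 5 * y <= expR q + 4 * x * expR (- q).
  apply: amgm => //; [by rewrite mulr_ge0|by rewrite !mulr_ge0 ?(ltW x0) ?expR_ge0|].
  rewrite exprMn y2 (_ : expR q * _ = 4 * x * (expR q * expR (- q))); last by ring.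
  by rewrite inv; lra.
have hp : y <= expR p + 2 * x * expR (- p).
  apply: amgm => //; first by rewrite !mulr_ge0 ?(ltW x0) ?expR_ge0.
  rewrite y2 (_ : expR p * _ = 2 * x * (expR p * expR (- p))); last by ring.
  by rewrite inv; lra.
have hc : 4 * x * expR (- q) <= 4 * c * x * expR (- q).
  rewrite ler_wpM2r// ler_wpM2r ?(ltW x0)//; lra.
have xp : 0 <= x * expR (- p) by rewrite mulr_ge0// ltW.
have xq : 0 <= x * expR (- q) by rewrite mulr_ge0// ltW.
set P := expR p + 2 * x * expR (- p) in hp *.
set Q := expR q + 4 * c * x * expR (- q).
have hQ : 7 / 5 * y <= Q by rewrite /Q; lra.
have kP : 2^-1 * P <= k * P by rewrite ler_wpM2r//; lra.
have kQ : 2^-1 * Q <= k * Q by rewrite ler_wpM2r//; lra.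
have eP : eta * expR p + eta * x * expR (- p) <= 12^-1 * P.
  by rewrite /P /eta; have := ep p; lra.
have eQ : eta * expR q + eta * x * expR (- q) <= 12^-1 * Q.
  by rewrite /Q /eta; have := ep q; lra.
lra.
Qed.

End Dominators.

(** * The Laplace integral 1 / H in a logarithmic variable *)

Section RayIntegral.
Variable R : realType.
Local Notation leb := (@lebesgue_measure R).
Implicit Types (q : R) (H : R[i]).

Lemma cmeas_kexp2 al om (a tau : R) :
  cmeas (fun z : R * R => kexp al ((a * z.1)%:C * om) tau z.2).
Proof.
apply: cmeas_cexp; apply: cmeasD; [apply: cmeasD|]; [apply: cmeasN|apply: cmeasN|apply: cmeasN].
- apply: cmeasM; first exact: cmeas_cst.
  by apply: cmeas_real; apply: measurable_funexpR; exact: measurable_snd.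
- apply: cmeasM; last by apply: cmeas_real; apply: measurable_funexpR; apply: measurable_funN; exact: measurable_snd.
  apply: cmeasM; last exact: cmeas_cst.
  by apply: cmeas_real; apply: measurable_funM; [exact: measurable_cst|exact: measurable_fst].
- apply: cmeasM; first exact: cmeas_cst.
  by apply: cmeas_real; apply: measurable_funM; [exact: measurable_cst|exact: measurable_snd].
Qed.

Lemma expexp_int (k : R) : 0 < k ->
  rint leb (fun q => expR q * expR (- (k * expR q))) /\
  \int[leb]_q (expR q * expR (- (k * expR q))) = k^-1.
Proof.
move=> k0; have h : 2^-1 <= CRe (1 : R[i]) by rewrite /=; lra.
have E q : mexp k 0 1 q%:C = (expR q * expR (- (k * expR q)))%:C.
  by rewrite mexpE0 mul1r cexp_real -realCM -realCN -realCD cexp_real expRD.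
have [h1 _] := cin_gam k0 h; have := gam_scale k0 h.
rewrite (eq_cI leb E) cI_real gam1 mulr1 mul1r -realCN cexp_real expRN lnK// => -[e].
split => //.
have e2 : CRe \o (fun s : R => mexp k 0 1 s%:C) = fun q => expR q * expR (- (k * expR q)).
  by apply/funext => q; rewrite [LHS]/comp E.
by rewrite -e2.
Qed.

Lemma ray_int H : 0 < CRe H ->
  cin leb (fun q => (expR q)%:C * cexp (- ((expR q)%:C * H))) /\
  cI leb (fun q => (expR q)%:C * cexp (- ((expR q)%:C * H))) = H^-1.
Proof.
move=> H0; have Hn : H != 0.
  by apply/eqP => h; move: H0; rewrite h ltxx.
pose F q := - (H^-1 * cexp (- ((expR q)%:C * H))).
have dE q : cder (fun q => - ((expR q)%:C * H)) q (- ((expR q)%:C * H)).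
  apply: (cder_eq (cderN (cderM (cder_real (is_derive_expRid q)) (cder_cst H q)))).
  by rewrite mulr0 addr0.
have dF q : cder F q ((expR q)%:C * cexp (- ((expR q)%:C * H))).
  apply: (cder_eq (cderN (cderZ H^-1 (cder_cexp (dE q))))).
  by rewrite mulNr mulrN opprK mulrA mulrCA mulVf// mulr1.
have cf : ccont (fun q => (expR q)%:C * cexp (- ((expR q)%:C * H))).
  by apply: cder_ccont => q; exact: (cderM (cder_real (is_derive_expRid q)) (cder_cexp (dE q))).
have ci : cin leb (fun q => (expR q)%:C * cexp (- ((expR q)%:C * H))).
  apply: (@cin_dom _ _ _ leb _ (fun q => expR q * expR (- (CRe H * expR q)))).
  - exact: ccont_cmeas.
  - by move=> q; rewrite cabsM cabs_cexp cabs_real ger0_norm ?expR_ge0// ReN ReZ [CRe H * _]mulrC.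
  - exact: (expexp_int H0).1.
split => //.
have l1 : ccvg (fun n => F n%:R) 0.
  rewrite -oppr0 -(mulr0 H^-1) -mulrN.
  under eq_fun do rewrite /F -mulrN.
  apply: ccvgZ; apply: cabs_cvg0_ccvg.
  apply: (squeeze_cvgr _ (cvg_cst 0) (cvg_expRNn H0)); apply: nearW => n.
  rewrite cabs_ge0 oppr0 subr0 cabsN cabs_cexp ler_expR ReN ReZ mulrN lerN2 mulrC ler_wpM2r ?(ltW H0)//.
  by apply: le_trans (expR_ge1Dx _); rewrite lerDr.
have l2 : ccvg (fun n => F (- n%:R)) (- H^-1).
  have cE : ccont (fun t : R => - (H^-1 * cexp (- (t%:C * H)))).
    apply: cder_ccont => t; exact: (cderN (cderZ H^-1 (cder_cexp (cderN
      (cderM (cder_real (is_derive_id t (1 : R))) (cder_cst H t)))))).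
  have h0 : (fun n => expR (- n%:R)) @ \oo --> (0 : R).
    by have := @cvg_expRNn R _ ltr01; under eq_fun do rewrite mul1r.
  have e0 : - H^-1 = - (H^-1 * cexp (- ((0 : R)%:C * H))) by rewrite mul0r oppr0 cexp0 mulr1.
  by rewrite e0; split; [exact: (cvg_comp _ _ h0 (cE.1 0))|exact: (cvg_comp _ _ h0 (cE.2 0))].
have [c1 c2] := cf; have [i1 i2] := ci.
apply: eqC => /=.
- by rewrite (ftc_R i1 c1 (fun q => (dF q).1) l1.1 l2.1) ReN sub0r opprK.
- by rewrite (ftc_R i2 c2 (fun q => (dF q).2) l1.2 l2.2) ImN sub0r opprK.
Qed.

End RayIntegral.

(** * The triple integral and its inner integral over x *)

Section Triple.
Variable R : realType.
Local Notation leb := (@lebesgue_measure R).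
Variables (c tau : R).
Hypothesis c1 : 1 <= c.
Implicit Types (x p q r z : R).
Local Notation kR := (CRe (omega R)).

(* Up to an elementary factor, [jpos x] times the integrals of [k0 x] and [k1 x]
   is the product of the three Bessel functions, see [triple_prod]. *)
Definition jpos x : R[i] := cexp ('i * (tau * ln (2 * x))%:C) * jser tau x * (pos x)%:C.
Definition k0 x q := kexp (omega R) ((4 * c * x)%:C * omega R) 0 q.
Definition k1 x p := kexp (omJ R) ((2 * x)%:C * omega R) tau p.

Let c0 : 0 < c. Proof. exact: lt_le_trans c1. Qed.

Lemma cmeas_jpos : cmeas jpos.
Proof.
apply: cmeasM; last exact: cmeas_pos.
apply: cmeasM; last exact: cmeas_jser.
apply: cmeas_cexp; apply: cmeasM; first exact: cmeas_cst.
apply: cmeas_real; apply: measurable_funM; first exact: measurable_cst.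
by apply: measurable_funln; apply: measurable_funM => //; exact: measurable_cst.
Qed.

Let jpos0 x : x <= 0 -> jpos x = 0.
Proof. by move=> x0; rewrite /jpos pos_le0// mulr0. Qed.

Lemma jpos_le x : cabs (jpos x) <= expR (2 * Num.sqrt (2 * `|x|)) * bcst tau * pos x.
Proof.
rewrite !cabsM cabs_cexp cabs_real [`|pos x|]ger0_norm ?pos_ge0//.
rewrite (_ : CRe _ = 0) ?expR0 ?mul1r; last by rewrite !ReImE/=; ring.
by rewrite ler_wpM2r ?pos_ge0// jser_le.
Qed.

Let f2_le x q p : cabs (jpos x * k0 x q * k1 x p) <= bcst tau * (dexp x p * dexp x q * pos x).
Proof.
have b0 : 0 <= bcst tau by exact: sqrtr_ge0.
rewrite 2!cabsM; case: (ltP 0 x) => x0; last first.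
  by rewrite jpos0// cabs0 !mul0r pos_le0// !mulr0.
apply: (@le_trans _ _ (expR (2 * Num.sqrt (2 * `|x|)) * bcst tau * pos x * cabs (k0 x q) * cabs (k1 x p))).
  by rewrite !ler_wpM2r ?cabs_ge0// jpos_le.
rewrite pos_gt0// !mulr1 ger0_norm ?(ltW x0)// /k0 /k1 !cabs_kexp !ReZ Re_omegaJ.
rewrite [leLHS](_ : _ = bcst tau * (expR (2 * Num.sqrt (2 * x)) *
  expR (- (kR * expR q + 4 * c * x * kR * expR (- q))) *
  expR (- (kR * expR p + 2 * x * kR * expR (- p))))); last by ring.
rewrite ler_wpM2l// /dexp -!expRD ler_expR.
apply: le_trans (exponent_le p q (Re_omega R) c1 x0).
by rewrite le_eqVlt; apply/orP; left; apply/eqP; ring.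
Qed.

Local Notation K0 x := (cI leb (k0 x)).
Local Notation K1 x := (cI leb (k1 x)).

Let cin_k0 x : 0 < x -> cin leb (k0 x).
Proof.
by move=> x0; apply: cin_kexp; [exact: Re_omega_gt0|rewrite ReZ; apply: mulr_gt0; [by rewrite !mulr_gt0|exact: Re_omega_gt0]].
Qed.

Let cin_k1 x : 0 < x -> cin leb (k1 x).
Proof.
by move=> x0; apply: cin_kexp; [exact: Re_omegaJ_gt0|rewrite ReZ; apply: mulr_gt0; [by rewrite !mulr_gt0|exact: Re_omega_gt0]].
Qed.

Let cmeas_k1 : cmeas (fun z : R * R => k1 z.1 z.2).
Proof. exact: cmeas_kexp2. Qed.

Let cmeas_k0 : cmeas (fun z : R * R => k0 z.1 z.2).
Proof. exact: cmeas_kexp2. Qed.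

Let f2I x q : cI leb (fun p => jpos x * k0 x q * k1 x p) = jpos x * K1 x * k0 x q.
Proof.
case: (ltP 0 x) => x0; last first.
  rewrite jpos0// !mul0r; under eq_cI do rewrite !mul0r.
  by apply: eqC; rewrite /= rI_0.
by rewrite (cI_Z _ (cin_k1 x0)) mulrAC.
Qed.

Let f1I x : cI leb (fun q => jpos x * K1 x * k0 x q) = jpos x * K1 x * K0 x.
Proof.
case: (ltP 0 x) => x0; last first.
  rewrite jpos0// !mul0r; under eq_cI do rewrite !mul0r.
  by apply: eqC; rewrite /= rI_0.
by rewrite (cI_Z _ (cin_k0 x0)).
Qed.

Let f1_le x q : cabs (jpos x * K1 x * k0 x q) <= bcst tau * (dexp x q * dint x * pos x).
Proof.
case: (ltP 0 x) => x0; last first.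
  by rewrite jpos0// !mul0r cabs0 pos_le0// !mulr0.
rewrite -f2I; apply: le_trans (cabs_cI (cinZ _ (cin_k1 x0))) _.
have h := rintZ (bcst tau * (dexp x q * pos x)) (rint_dexp_x x0).
rewrite [leRHS](_ : _ = bcst tau * (dexp x q * pos x) * dint x); last by ring.
rewrite /dint -(rI_Z _ (rint_dexp_x x0)); apply: rI_le => //.
  by apply: cin_cabs; exact: cinZ (cin_k1 x0).
by move=> p; apply: le_trans (f2_le x q p) _; rewrite le_eqVlt; apply/orP; left; apply/eqP; ring.
Qed.

Let f1_cin : cin (leb \x leb)%E (fun z : R * R => jpos z.1 * K1 z.1 * k0 z.1 z.2).
Proof.
apply: (@cin_dom _ _ _ (leb \x leb)%E _ (fun z : R * R => bcst tau * (dexp z.1 z.2 * dint z.1 * pos z.1))).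
- apply: cmeasM cmeas_k0; apply: cmeasM.
    by apply: (cmeas_comp cmeas_jpos (h := fst)); exact: measurable_fst.
  by apply: (cmeas_comp (cmeas_param leb cmeas_k1) (h := fst)); exact: measurable_fst.
- by move=> z; exact: f1_le.
- by apply: rintZ; exact: dexp_dint_prod.
Qed.

Let f2_cin q : cin (leb \x leb)%E (fun z : R * R => jpos z.1 * k0 z.1 q * k1 z.1 z.2).
Proof.
apply: (@cin_dom _ _ _ (leb \x leb)%E _ (fun z : R * R => bcst tau * (dexp z.1 q * dexp z.1 z.2 * pos z.1))).
- apply: cmeasM cmeas_k1; apply: cmeasM.
    by apply: (cmeas_comp cmeas_jpos (h := fst)); exact: measurable_fst.
  by apply: (cmeas_comp cmeas_k0 (h := fun z : R * R => (z.1, q))); apply: measurable_fun_pair => //; exact: measurable_fst.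
- by move=> z; apply: le_trans (f2_le _ _ _) _; rewrite [dexp z.1 z.2 * _]mulrC.
- by apply: rintZ; exact: dexp2_prod.
Qed.

Definition wb z : R[i] := cexp ('i * (tau * ln 2)%:C) *
  cexp (- ((1 + 'i * tau%:C) * ((ln z)%:C + 'i * (pi / 4)%:C))) * cexp (- (2 * omJ R / z%:C)).

Definition pq q p : R[i] := cexp (- (omega R * (expR q)%:C) - omJ R * (expR p)%:C - 'i * (tau * p)%:C).

(** The coefficient of [- omega R * x] in the sum of the exponents of [k0 x q] and [k1 x p]; it
    becomes the parameter z of Weber's integral. *)
Definition zqp q p : R := 4 * c * expR (- q) + 2 * expR (- p).

Let zqp_gt0 q p : 0 < zqp q p.
Proof. by rewrite addr_gt0// ?mulr_gt0// ?expR_gt0. Qed.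

Definition Gqp q p := pq q p * wb (zqp q p).

Let f2_x q p : cI leb (fun x => jpos x * k0 x q * k1 x p) = Gqp q p.
Proof.
have [h e] := weber tau (zqp_gt0 q p).
rewrite /Gqp /wb -e -cI_Z//; apply: eq_cI => x; rewrite /jpos.
have -> : k1 x p = pq q p * cexp (- (omega R * (zqp q p * x)%:C)) / k0 x q.
  rewrite /k0 /k1 /pq /kexp -cexpD -cexpB; congr cexp.
  by rewrite /zqp !realCM !realCD !realCM; ring.
have kn : k0 x q != 0 by exact: cexp_neq0.
by field.
Qed.

(** Two successive exchanges: x with q while p is integrated out, then x with p at fixed q. Only
    functions of two variables need a dominator. *)
Lemma triple_qp : cI leb (fun x => jpos x * K1 x * K0 x) = cI leb (fun q => cI leb (Gqp q)) /\
  cin leb (fun x => jpos x * K1 x * K0 x).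
Proof.
have [h1 e1] := cfubini1 f1_cin; have [h2 e2] := cfubini2 f1_cin.
split; last by under [fun x => _]funext do rewrite -f1I; exact: h1.
rewrite -(eq_cI leb f1I) [LHS]e1 -[LHS]e2; apply: eq_cI => q /=.
have [h3 e3] := cfubini1 (f2_cin q); have [h4 e4] := cfubini2 (f2_cin q).
rewrite -(eq_cI leb (fun x => f2I x q)) [LHS]e3 -[LHS]e4.
by apply: eq_cI => p; rewrite /= f2_x.
Qed.

Lemma cin_Gqp q : cin leb (Gqp q).
Proof.
have [h4 e4] := cfubini2 (f2_cin q).
by under [Gqp q]funext do rewrite -f2_x; exact: h4.
Qed.

End Triple.

(** * Reduction of the remaining double integral to a single one *)

Section TripleShift.
Variable R : realType.
Local Notation leb := (@lebesgue_measure R).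
Variables (c tau : R).
Hypothesis c1 : 1 <= c.
Implicit Types (x p q r z : R).
Local Notation kR := (CRe (omega R)).
Local Notation G := (Gqp c tau).

Let c0 : 0 < c. Proof. exact: lt_le_trans c1. Qed.

Let zqp_gt0 q p : 0 < zqp c q p.
Proof. by rewrite addr_gt0// ?mulr_gt0// ?expR_gt0. Qed.

(* The substitution [p = q + r] gives [zqp q p = 2 exp (- q) exp (- r) gr r]; the
   integral over [q] becomes that of [exp q exp (- Hr r exp q)], namely [1 / Hr r]. *)
Definition gr r : R := 1 + 2 * c * expR r.

Lemma gr_gt1 r : 1 < gr r.
Proof. by rewrite ltrDl !mulr_gt0// expR_gt0. Qed.

Let gr0 r : 0 < gr r. Proof. exact: lt_trans (gr_gt1 r). Qed.

Definition Hr r : R[i] := omega R + omJ R * (expR r)%:C + omJ R * (expR r)%:C / (gr r)%:C.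

Let zqp_r q r : zqp c q (q + r) = 2 * expR (- q) * expR (- r) * gr r.
Proof.
rewrite /zqp /gr opprD expRD.
have : expR r * expR (- r) = 1 by rewrite -expRD subrr expR0.
move: (expR (- r)) (expR r) (expR (- q)) => a b d h.
rewrite [RHS](_ : _ = 4 * c * d * (b * a) + 2 * (d * a)); last by ring.
by rewrite h; ring.
Qed.

(** With z = [zqp c q (q + r)], the phase of z^(- i tau) cancels exp(- i tau (q + r)), and 1/z
    supplies the factor exp q. So q enters only through exp q, and the angle pi/4 in Weber's value
    contributes exp(tau pi/4). *)
Let Gqp_r q r : G q (q + r) = cexp (tau * (pi / 4))%:C *
  (cexp (- ('i * (tau * ln (gr r))%:C)) * (omJ R * (expR r)%:C / (2 * (gr r)%:C))) *
  ((expR q)%:C * cexp (- ((expR q)%:C * Hr r))).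
Proof.
have e0 (s : R) : 0 < expR s by exact: expR_gt0.
have nz (s : R) : 0 < s -> s%:C != 0 :> R[i] by move=> s0; rewrite fmorph_eq0 gt_eqF.
have eL : cexp (- ((ln (zqp c q (q + r)))%:C + 'i * (pi / 4)%:C)) = omJ R / (zqp c q (q + r))%:C.
  rewrite opprD cexpD -realCN cexp_real expRN lnK ?posrE// cexpN -/(omega R) omegaV realCV.
  by rewrite mulrC.
rewrite /Gqp /wb.
have -> : - ((1 + 'i * tau%:C) * ((ln (zqp c q (q + r)))%:C + 'i * (pi / 4)%:C)) =
    - ((ln (zqp c q (q + r)))%:C + 'i * (pi / 4)%:C) + ((tau * (pi / 4))%:C
      - 'i * (tau * ln (zqp c q (q + r)))%:C).
  have i2 : 'i * 'i = -1 :> R[i] by rewrite -expr2 sqr_i.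
  rewrite !realCM -[RHS]addr0 -(subrr (tau%:C * (pi / 4)%:C)).
  rewrite [LHS](_ : _ = - ((ln (zqp c q (q + r)))%:C + 'i * (pi / 4)%:C) -
    'i * tau%:C * (ln (zqp c q (q + r)))%:C - ('i * 'i) * tau%:C * (pi / 4)%:C); last by ring.
  by rewrite i2 realCM; ring.
rewrite cexpD eL cexpD.
have lnz : ln (zqp c q (q + r)) = ln 2 - q - r + ln (gr r).
  by rewrite zqp_r !lnM ?posrE ?mulr_gt0// !expRK.
rewrite lnz zqp_r.
have zi : (2 * expR (- q) * expR (- r) * gr r)%:C^-1 =
    2^-1 * (expR q)%:C * (expR r)%:C / (gr r)%:C :> R[i].
  rewrite -!realCV -realCn -realCV -!realCM; congr (_%:C).
  by rewrite !invfM -!expRN !opprK.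
rewrite zi /pq expRD /Hr.
have E : cexp (- (omega R * (expR q)%:C) - omJ R * (expR q * expR r)%:C - 'i * (tau * (q + r))%:C) *
    cexp ('i * (tau * ln 2)%:C) * cexp (- ('i * (tau * (ln 2 - q - r + ln (gr r)))%:C)) *
    cexp (- (2 * omJ R * (2^-1 * (expR q)%:C * (expR r)%:C / (gr r)%:C))) =
    cexp (- ('i * (tau * ln (gr r))%:C)) * cexp (- ((expR q)%:C *
      (omega R + omJ R * (expR r)%:C + omJ R * (expR r)%:C / (gr r)%:C))).
  rewrite -!cexpD; congr cexp.
  move: (omJ R) (omega R) ((gr r)%:C^-1) (ln (gr r)) => oj o gi lg.
  by rewrite !realCM !realCD !realCN; field.
move: E; set a1 := cexp _; set a2 := cexp _; set a3 := cexp _; set a4 := cexp _.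
set a5 := cexp _; set a6 := cexp _ => E.
set v := cexp _.
transitivity (a1 * a2 * a3 * a4 * (omJ R * (2^-1 * (expR q)%:C * (expR r)%:C / (gr r)%:C)) * v).
  by ring.
by rewrite E invfM; ring.
Qed.

(** Equal to gr r * Hr r / (omJ R * exp r), since 'i * omJ R = omega R; division by [Hr r] thus
    absorbs the prefactor of [Gqp_r]. *)
Definition Dr r : R[i] := (gr r + 1)%:C + 'i * (expR (- r) + 2 * c)%:C.

Let ReH r : CRe (Hr r) = kR * (1 + expR r + expR r / gr r).
Proof.
rewrite /Hr 2!ReD -[_ / (gr r)%:C]mulrA -realCV -realCM ![omJ R * _]mulrC !ReZ Re_omegaJ.
by ring.
Qed.

Let ReH_ge r : 2^-1 * (1 + expR r) <= CRe (Hr r).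
Proof.
rewrite ReH; have k2 := Re_omega R; have e0 := expR_gt0 r.
have e1 : 0 <= expR r / gr r by rewrite divr_ge0// ltW.
apply: (@le_trans _ _ (kR * (1 + expR r))).
  by rewrite ler_wpM2r// addr_ge0// ltW.
by rewrite ler_wpM2l// ?lerDl//; lra.
Qed.

Let ReH_gt0 r : 0 < CRe (Hr r).
Proof. by apply: lt_le_trans (ReH_ge r); rewrite mulr_gt0// addr_gt0// expR_gt0. Qed.

Let cder_gr r : is_derive r 1 gr (2 * c * expR r).
Proof.
have h : is_derive r 1 (fun r => 2 * c * expR r) (2 * c * expR r).
  exact: (is_deriveZ (2 * c) (is_derive_expRid r)).
have h2 : is_derive r 1 (cst 1 + (fun r => 2 * c * expR r)) (0 + 2 * c * expR r) by exact: is_deriveD.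
by rewrite add0r in h2.
Qed.

Let nzC (s : R) : 0 < s -> s%:C != 0 :> R[i].
Proof. by move=> s0; rewrite fmorph_eq0 gt_eqF. Qed.

Let ccont_G q : ccont (G q).
Proof.
pose f r := cexp (tau * (pi / 4))%:C *
  (cexp (- ('i * (tau * ln (gr r))%:C)) * (omJ R * (expR r)%:C / (2 * (gr r)%:C))) *
  ((expR q)%:C * cexp (- ((expR q)%:C * Hr r))).
have [c2 c3] : ccont f.
  suff [l hl] : exists l, forall r, cder f r (l r) by exact: cder_ccont hl.
  have hG r : exists l, cder f r l.
    have d1 : is_derive r 1 (fun r => tau * ln (gr r)) (tau * (2 * c * expR r / gr r)).
      apply: (is_derive_eq (is_deriveZ tau (is_derive1_comp (is_derive1_ln (gr0 r)) (cder_gr r)))).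
      by rewrite mulrC.
    have d2 := cderZ (omJ R) (cder_real (is_derive_expRid r)).
    have d3 := cder_real (cder_gr r).
    have n2 : 2 * (gr r)%:C != 0 by rewrite mulf_neq0 ?nzC// pnatr_eq0.
    have d4 := cderM d2 (cderV n2 (cderZ 2 d3)).
    have d5 := cderD (cderD (cder_cst (omega R) r) d2) (cderM d2 (cderV (f := fun t => (gr t)%:C) (nzC (gr0 r)) d3)).
    by eexists; exact: (cderM (cderZ _ (cderM (cder_cexp (cderN (cderZ 'i (cder_real d1)))) d4))
      (cderZ (expR q)%:C (cder_cexp (cderN (cderZ (expR q)%:C d5))))).
  exists (fun r => xget 0 [set l | cder f r l]) => r; have [l hl] := hG r.
  by have := xgetPex 0 (ex_intro _ l hl : exists l, [set l | cder f r l] l).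
have E p : G q p = f (p - q) by rewrite /f -Gqp_r addrCA subrr addr0.
have cs : continuous (fun p : R => p - q) by move=> p; apply: (@continuousB _ R^o); [exact: cvg_id|exact: cst_continuous].
split.
- rewrite (_ : _ \o _ = (CRe \o f) \o (fun p => p - q)); last by apply/funext => p; rewrite [LHS]/comp E.
  by move=> p; apply: continuous_comp; [exact: cs|exact: c2].
- rewrite (_ : _ \o _ = (CIm \o f) \o (fun p => p - q)); last by apply/funext => p; rewrite [LHS]/comp E.
  by move=> p; apply: continuous_comp; [exact: cs|exact: c3].
Qed.

Let pref r : R[i] := cexp (tau * (pi / 4))%:C *
  (cexp (- ('i * (tau * ln (gr r))%:C)) * (omJ R * (expR r)%:C / (2 * (gr r)%:C))).

Let cabs_omJ : cabs (omJ R) = 1.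
Proof. by rewrite -omegaV cabsV cabs_omega invr1. Qed.

Let cabs_pref r : cabs (pref r) = expR (tau * (pi / 4)) * (expR r / (2 * gr r)).
Proof.
rewrite /pref cabsM cabs_cexp; congr (_ * _); rewrite cabsM cabs_cexp.
rewrite (_ : CRe _ = 0) ?expR0 ?mul1r; last by rewrite !ReImE/=; ring.
rewrite cabsM cabsV cabsM cabs_omJ mul1r cabsM -realCn !cabs_real !ger0_norm ?expR_ge0 ?(ltW (gr0 r))//.
Qed.

(** Up to the factor exp(tau pi/4), the left side is the integral over q of the modulus of
    [G q (q + r)]. The bound rests on [gr r] being at least exp(r/2). *)
Let bnd_r r : expR r / (2 * gr r) / CRe (Hr r) <= bsech r.
Proof.
have e := oneD_expR r; set a := expR (2^-1 * r) in e *.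
have a0 : 0 < a by exact: expR_gt0.
have er : expR r = a ^+ 2 by rewrite /a -expRM_natl; congr expR; field.
have b0 := bsech_gt0 r.
have hb : bsech r * (1 + expR r) = 2 * a.
  by rewrite /bsech e [LHS]mulrC mulfK// cosh_neq0.
have hg : a <= gr r.
  have : 0 <= (a - 1) ^+ 2 by exact: sqr_ge0.
  have : a ^+ 2 <= c * a ^+ 2 by rewrite ler_peMl ?sqr_ge0.
  by rewrite /gr er; nra.
rewrite ler_pdivrMr//; apply: (@le_trans _ _ (bsech r * (2^-1 * (1 + expR r)))); last first.
  by rewrite ler_wpM2l// ltW.
rewrite mulrCA hb mulKf ?pnatr_eq0// ler_pdivrMr ?mulr_gt0// er expr2 ler_wpM2l ?(ltW a0)//.
by have := gr0 r; lra.
Qed.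

Lemma triple_val :
  cin leb (fun r => cexp (- ('i * (tau * ln (gr r))%:C)) / Dr r) /\
  cI leb (fun x => jpos tau x * cI leb (k1 tau x) * cI leb (k0 c x)) =
  cexp (tau * (pi / 4))%:C * 2^-1 * cI leb (fun r => cexp (- ('i * (tau * ln (gr r))%:C)) / Dr r).
Proof.
have ig r : 2^-1 * (cexp (- ('i * (tau * ln (gr r))%:C)) / Dr r) * cexp (tau * (pi / 4))%:C =
    pref r * (Hr r)^-1.
  have Hn : Hr r != 0 by apply/eqP => h; have := ReH_gt0 r; rewrite h ltxx.
  have Dn : Dr r != 0.
    apply/eqP => h; have : CRe (Dr r) = 0 by rewrite h.
    by rewrite /Dr !ReImE/=; have := gr0 r; lra.
  have gn := nzC (gr0 r).
  have iJ : 'i * omJ R = omega R.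
    transitivity (omega R ^+ 2 / omega R); last by rewrite expr2 mulfK// cexp_neq0.
    by rewrite -omegaV; congr (_ / _); exact: esym (omega_sq R).
  have key : omJ R * (expR r)%:C * Dr r = (gr r)%:C * Hr r.
    rewrite /Dr /Hr -iJ.
    have ee : (expR r)%:C * (expR (- r))%:C = 1 :> R[i] by rewrite -realCM -expRD subrr expR0.
    have gE : (gr r)%:C = 1 + 2 * c%:C * (expR r)%:C by rewrite /gr realCD !realCM realCn.
    have -> : (gr r + 1)%:C = (gr r)%:C + 1 :> R[i] by rewrite realCD.
    have -> : (expR (- r) + 2 * c)%:C = (expR (- r))%:C + 2 * c%:C :> R[i] by rewrite realCD realCM realCn.
    move: (omJ R) ee gE gn; move: ((gr r)%:C) ((expR r)%:C) ((expR (- r))%:C) => g e e' oj ee gE gn.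
    rewrite [LHS](_ : _ = oj * e * g + oj * e + 'i * oj * (e * e') + 'i * oj * (2 * c%:C * e)); last by ring.
    rewrite [RHS](_ : _ = g * ('i * oj) + oj * e * g + oj * e * (g / g)); last by ring.
    by rewrite divff// ee gE; ring.
  rewrite /pref; set V := cexp _; set U := cexp _.
  have -> : omJ R * (expR r)%:C / (2 * (gr r)%:C) = 2^-1 * (Hr r / Dr r).
    have -> : omJ R * (expR r)%:C = (gr r)%:C * Hr r / Dr r by rewrite -key mulfK.
    rewrite invfM [LHS](_ : _ = 2^-1 * (Hr r / Dr r) * ((gr r)%:C / (gr r)%:C)); last by ring.
    by rewrite divff// mulr1.
  rewrite [RHS](_ : _ = 2^-1 * (V / Dr r) * U * (Hr r / Hr r)); last by ring.
  by rewrite divff// mulr1.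
have rc r := ray_int (ReH_gt0 r).
have Ge q r : G q (q + r) = pref r * ((expR q)%:C * cexp (- ((expR q)%:C * Hr r))) by exact: Gqp_r.
have shq q : cI leb (G q) = cI leb (fun r => G q (q + r)) /\ cin leb (fun r => G q (q + r)).
  have [s1 s2] := cin_shift q (ccont_G q) (cin_Gqp tau c1 q).
  by rewrite -s2; split; [apply: eq_cI => r|under [fun r => _]funext do rewrite addrC]; rewrite ?[r + q]addrC.
have [e0 _] := triple_qp tau c1.
have mG : cmeas (fun z : R * R => G z.1 (z.1 + z.2)).
  have m1 : measurable_fun setT (fun z : R * R => z.1) by exact: measurable_fst.
  have m2 : measurable_fun setT (fun z : R * R => z.1 + z.2).
    by apply: measurable_funD; [exact: measurable_fst|exact: measurable_snd].
  have mE (f : R * R -> R) : measurable_fun setT f -> cmeas (fun z : R * R => (expR (f z))%:C).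
    by move=> mf; apply: cmeas_real; exact: measurable_funexpR.
  have mc (k : R) : measurable_fun setT (fun _ : R * R => k) by exact: measurable_cst.
  have mZ : measurable_fun setT (fun z : R * R => zqp c z.1 (z.1 + z.2)).
    by apply: measurable_funD; (apply: measurable_funM; first exact: mc);
      apply: measurable_funexpR; exact: measurable_funN.
  apply: cmeasM; last apply: cmeasM; [|apply: cmeasM|]; (try exact: cmeas_cst); apply: cmeas_cexp.
  - apply: cmeasD; [apply: cmeasD|]; apply: cmeasN; (apply: cmeasM; first exact: cmeas_cst).
    + exact: mE.
    + exact: mE.
    + by apply: cmeas_real; apply: measurable_funM.
  - apply: cmeasN; apply: cmeasM; first exact: cmeas_cst.
    apply: cmeasD; last exact: cmeas_cst.
    by apply: cmeas_real; exact: measurable_funln.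
  - apply: cmeasN; apply: cmeasM; first exact: cmeas_cst.
    by apply: cmeasV; exact: cmeas_real.
have cq r : cin leb (fun q => G q (q + r)).
  by rewrite (funext (Ge^~ r)); exact: cinZ (rc r).1.
(* [triple_qp] provides an iterated integral only. Joint integrability is obtained in the variables
   q and r, from [bnd_r]. *)
have iG : cin (leb \x leb)%E (fun z : R * R => G z.1 (z.1 + z.2)).
  apply: (@cin_prod21 _ _ _ _ _ leb leb _ (fun r => expR (tau * (pi / 4)) * bsech r)) => //.
  - by move=> r; exact: cin_cabs (cq r).
  - move=> r; have [j1 j2] := expexp_int (ReH_gt0 r).
    rewrite (_ : \int[leb]_q _ = \int[leb]_q (cabs (pref r) * (expR q * expR (- (CRe (Hr r) * expR q))))).
      by rewrite (rI_Z _ j1) j2 cabs_pref -mulrA ler_wpM2l ?expR_ge0.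
    apply: eq_Rintegral => q _; rewrite Ge cabsM; congr (_ * _).
    by rewrite cabsM cabs_cexp cabs_real ger0_norm ?expR_ge0// ReN ReZ [CRe _ * expR q]mulrC.
  - by apply: rintZ; exact: rint_bsech.
have [i1 e1] := cfubini1 iG; have [i2 e2] := cfubini2 iG.
have e3 r : cI leb (fun q => G q (q + r)) =
    cexp (tau * (pi / 4))%:C * 2^-1 * (cexp (- ('i * (tau * ln (gr r))%:C)) / Dr r).
  by rewrite (eq_cI leb (Ge^~ r)) (cI_Z _ (rc r).1) (rc r).2 -ig; ring.
pose K : R[i] := cexp (tau * (pi / 4))%:C * 2^-1.
have Kn : K != 0 by rewrite mulf_neq0 ?cexp_neq0// invr_neq0// pnatr_eq0.
have ih : cin leb (fun r => cexp (- ('i * (tau * ln (gr r))%:C)) / Dr r).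
  have := cinZ K^-1 i2; under [fun y => _]funext do rewrite /= e3 mulKf//.
  by [].
split => //; rewrite e0 -(cI_Z _ ih) -(eq_cI leb e3) [RHS]e2 -[RHS]e1.
by apply: eq_cI => q; exact: (shq q).1.
Qed.

End TripleShift.

(** * Symmetry in the order and the real triple product *)

Section BesselSymmetry.
Variable R : realType.
Local Notation leb := (@lebesgue_measure R).
Implicit Types (x tau c : R).

Definition Kx tau x := besselK ('i * tau%:C) (2 * Num.sqrt (2 * x))%:C.
Definition Jx tau x := besselJ ('i * tau%:C) (2 * Num.sqrt (2 * x)).
Definition K0x c x := besselK 0 (4 * omega R * (Num.sqrt c)%:C * (Num.sqrt x)%:C).

Lemma KxN tau x : Kx (- tau) x = Kx tau x.
Proof.
rewrite /Kx /besselK; congr cintegral; apply/funext => t; congr (_ * _).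
have -> : 'i * (- tau)%:C * t%:C = - ('i * tau%:C * t%:C) by rewrite realCN; ring.
by rewrite /ccosh opprK addrC.
Qed.

(** Replacing [tau] by [- tau] conjugates the value, but also leaves it unchanged because the
    hyperbolic cosine is even. *)
Lemma Im_Kx tau x : 0 < x -> CIm (Kx tau x) = 0.
Proof.
move=> x0; set a := Num.sqrt (2 * x).
have a0 : 0 < a by rewrite sqrtr_gt0 mulr_gt0.
have aC : 0 < CRe (a%:C : R[i]) by [].
have : Kx (- tau) x = (Kx tau x)^*.
  rewrite /Kx !besselKiE//.
  have -> : kexp a%:C a%:C (- tau) = fun s => (kexp a%:C a%:C tau s)^*.
    apply/funext => s; rewrite /kexp -cexp_conj; congr cexp.
    by apply: eqC => /=; ring.
  rewrite (cI_conj (cin_kexp tau aC aC)).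
  by move: (cI _ _) => z; apply: eqC; rewrite /= !ReImE/=; case: z => p q /=; ring.
rewrite KxN => /(congr1 (fun z => CIm z)).
by move: (Kx tau x) => [p q] /= h; lra.
Qed.

Lemma JxN tau x : 0 < x -> Jx (- tau) x = (Jx tau x)^*.
Proof.
move=> x0; rewrite /Jx !besselJ_x// jser_conj.
have -> : 'i * (- tau * ln (Num.sqrt (2 * x)))%:C = ('i * (tau * ln (Num.sqrt (2 * x)))%:C)^* :> R[i].
  by apply: eqC => /=; ring.
rewrite cexp_conj; move: (cexp _) (jser _ _) => z w.
by case: z => p q; case: w => r s; apply: eqC => /=; ring.
Qed.

(** Re K_0 Im J is not the imaginary part of a single product, so both J and its conjugate are
    needed. The conjugate is J of the opposite order, hence the triple integral is used at [tau] and
    [- tau]. *)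
Lemma Im_triple (k0 J K : R[i]) : CIm K = 0 ->
  CRe k0 * CIm J * CRe K = 2^-1 * (CIm (k0 * (J * K)) - CIm (k0 * (J^* * K))).
Proof.
by case: k0 => a b; case: J => p q; case: K => r s /= ->; field.
Qed.

Lemma triple_prod c tau x : 0 < c -> 0 < x ->
  K0x c x * (Jx tau x * Kx tau x) =
  4^-1 * cexp (- (tau * (pi / 4))%:C) *
    (cexp ('i * (tau * ln (2 * x))%:C) * jser tau x * cI leb (k1 tau x) * cI leb (k0 c x)).
Proof.
move=> c0 x0; rewrite /K0x /Jx /Kx besselK0_x// besselJ_x// besselKi_x//.
rewrite -/(k0 c x) -/(k1 tau x).
have p2 : 0 < 2 * x by rewrite mulr_gt0.
have s0 : 0 < Num.sqrt (2 * x) by rewrite sqrtr_gt0.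
have e : ln (2 * x) = 2 * ln (Num.sqrt (2 * x)).
  by rewrite -{1}[2 * x]sqr_sqrtr ?(ltW p2)// expr2 lnM ?posrE//; ring.
have -> : 'i * (tau * ln (2 * x))%:C =
    'i * (tau * ln (Num.sqrt (2 * x)))%:C + 'i * (tau * ln (Num.sqrt (2 * x)))%:C :> R[i].
  by rewrite e !realCM realCn; ring.
rewrite realCV realCn !cexpD; move: (cI _ _) (cI _ _) (cexp _) (cexp _) => z w t v.
by field.
Qed.

End BesselSymmetry.

Section RealTriple.
Variable R : realType.
Local Notation leb := (@lebesgue_measure R).
Variables (c tau : R).
Hypothesis c1 : 1 <= c.
Implicit Types (x r : R).
Let c0 : 0 < c. Proof. exact: lt_le_trans c1. Qed.

Let hr t r : R[i] := cexp (- ('i * (t * ln (gr c r))%:C)) / Dr c r.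

Let T t x : R[i] := K0x c x * (Jx t x * Kx t x) * (pos x)%:C.

(** The factor exp(- t pi/4) from the rotation of K cancels exp(t pi/4) from Weber's integral. The
    constant is 1/4, from the halves in the two K integrals, times 1/2 from [triple_val]. *)
Let T_int t : cin leb (T t) /\ cI leb (T t) = 8^-1 * cI leb (hr t).
Proof.
have [_ h1] := triple_qp t c1; have [_ h2] := triple_val t c1.
have e x : T t x = 4^-1 * cexp (- (t * (pi / 4))%:C) * (jpos t x * cI leb (k1 t x) * cI leb (k0 c x)).
  rewrite /T; case: (ltP 0 x) => x0; last by rewrite /jpos pos_le0// !(mulr0, mul0r).
  by rewrite triple_prod// /jpos pos_gt0// !mulr1.
split; first by rewrite (funext e : T t = _); exact: cinZ.
rewrite (eq_cI leb e) (cI_Z _ h1) h2 -/(hr t).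
have e1 : cexp (- (t * (pi / 4))%:C) * cexp (t * (pi / 4))%:C = 1 :> R[i].
  by rewrite -cexpD addNr cexp0.
rewrite [LHS](_ : _ = cexp (- (t * (pi / 4))%:C) * cexp (t * (pi / 4))%:C * (4^-1 * 2^-1 * cI leb (hr t))); last by ring.
by rewrite e1 mul1r; congr (_ * _); field.
Qed.

(** The pull-back under t = ln(gr r) of sin(tau t) sinh t / (2 (sinh^2 t + c^2)), see [GtS]; the
    line is mapped onto t > 0. *)
Definition Sr r : R := sin (tau * ln (gr c r)) * (gr c r + 1) /
  ((gr c r + 1) ^+ 2 + (expR (- r) + 2 * c) ^+ 2).

Let hr_Im r : CIm (hr tau r) - CIm (hr (- tau) r) = - 2 * Sr r.
Proof.
have e t : cexp (- ('i * (t * ln (gr c r))%:C)) =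
    cos (t * ln (gr c r)) -i* sin (t * ln (gr c r)) :> R[i].
  rewrite (_ : - _ = 0 -i* (t * ln (gr c r))); last by apply: eqC => /=; ring.
  by rewrite /cexp /= expR0 !mul1r cosN sinN.
have d : Dr c r = (gr c r + 1) +i* (expR (- r) + 2 * c) by apply: eqC; rewrite /Dr /=; ring.
rewrite /hr !e d !ImM ReV ImV /= [- tau * _]mulNr cosN sinN /Sr.
by ring.
Qed.

Lemma bessel_triple :
  [/\ rint leb (fun x => CRe (K0x c x) * CIm (Jx tau x) * CRe (Kx tau x) * pos x),
    rint leb Sr &
    \int[leb]_x (CRe (K0x c x) * CIm (Jx tau x) * CRe (Kx tau x) * pos x) =
    - 8^-1 * \int[leb]_r Sr r].
Proof.
have [i1 e1] := T_int tau; have [i2 e2] := T_int (- tau).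
have [h1 _] := triple_val tau c1; have [h2 _] := triple_val (- tau) c1.
have ex x : CRe (K0x c x) * CIm (Jx tau x) * CRe (Kx tau x) * pos x =
    2^-1 * (CIm (T tau x) - CIm (T (- tau) x)).
  rewrite /T; case: (ltP 0 x) => x0; last by rewrite pos_le0// !mulr0 subrr mulr0.
  rewrite KxN (JxN tau x0) pos_gt0// mulr1.
  have m1 z : z * (1 : R)%:C = z :> R[i] by rewrite mulr1.
  by rewrite 2!m1; apply: Im_triple; exact: Im_Kx.
have er r : Sr r = - 2^-1 * (CIm (hr tau r) - CIm (hr (- tau) r)) by rewrite hr_Im; field.
split.
- by rewrite (funext ex); apply: rintZ; apply: rintB; [exact: i1.2|exact: i2.2].
- by rewrite (funext er); apply: rintZ; apply: rintB; [exact: h1.2|exact: h2.2].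
rewrite (funext ex) (funext er) !rI_Z; try (apply: rintB; [exact: i1.2|exact: i2.2]); try (apply: rintB; [exact: h1.2|exact: h2.2]).
rewrite (rI_B i1.2 i2.2) (rI_B h1.2 h2.2).
have e8 : 8^-1 = (8^-1)%:C :> R[i] by rewrite realCV realCn.
have f1 : \int[leb]_x CIm (T tau x) = 8^-1 * \int[leb]_x CIm (hr tau x).
  by move: e1; rewrite e8 => /(congr1 (fun z => CIm z)); rewrite ImZ.
have f2 : \int[leb]_x CIm (T (- tau) x) = 8^-1 * \int[leb]_x CIm (hr (- tau) x).
  by move: e2; rewrite e8 => /(congr1 (fun z => CIm z)); rewrite ImZ.
by rewrite f1 f2; move: (\int[leb]_x CIm (hr tau x)) (\int[leb]_x CIm (hr (- tau) x)) => a b; field.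
Qed.

End RealTriple.

(** * Evaluation of the sine integral *)

Section Sine.
Variable R : realType.
Local Notation leb := (@lebesgue_measure R).
Variables (u tau : R).
Implicit Types (r s t : R).
Let c := cosh u.

Let c1 : 1 <= c. Proof. exact: cosh_ge1. Qed.
Let c0 : 0 < c. Proof. exact: cosh_gt0. Qed.

Let Gt t := 2^-1 * (sin (tau * t) * sinh t / (sinh t ^+ 2 + c ^+ 2)).

Let den_gt0 t : 0 < sinh t ^+ 2 + c ^+ 2.
Proof. by rewrite ltr_wpDl ?sqr_ge0// exprn_gt0. Qed.

Let is_derive_lng r : is_derive r 1 (fun r => ln (gr c r)) (2 * c * expR r / gr c r).
Proof.
have g0 : 0 < gr c r by apply: lt_trans (gr_gt1 c1 r).
have h : is_derive r 1 (fun r => 2 * c * expR r) (2 * c * expR r).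
  exact: (is_deriveZ (2 * c) (is_derive_expRid r)).
have h2 : is_derive r 1 (cst 1 + (fun r => 2 * c * expR r)) (0 + 2 * c * expR r).
  exact: is_deriveD.
rewrite add0r in h2.
by apply: (is_derive_eq (is_derive1_comp (is_derive1_ln g0) h2)); rewrite mulrC.
Qed.

Let GtS r : Gt (ln (gr c r)) * (2 * c * expR r / gr c r) = Sr c tau r.
Proof.
have g0 : 0 < gr c r by apply: lt_trans (gr_gt1 c1 r).
have e0 := expR_gt0 r.
rewrite /Gt /Sr /sinh expRN lnK ?posrE// expRN; set s := sin _.
have g1 : 0 < gr c r - 1 by rewrite subr_gt0; exact: gr_gt1.
have eE : expR r = (gr c r - 1) / (2 * c).
  by rewrite /gr; field; rewrite gt_eqF.
rewrite eE; move: g0 g1; move: (gr c r) => g g0 g1.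
(* Both denominators are this polynomial up to elementary factors, see [d1] and [d2]. *)
pose Q := (g ^+ 2 - 1) ^+ 2 + 4 * c ^+ 2 * g ^+ 2.
have Q0 : 0 < Q.
  by rewrite ltr_wpDl ?sqr_ge0//; apply: mulr_gt0; [apply: mulr_gt0 => //|]; exact: exprn_gt0.
have gn : g != 0 by rewrite gt_eqF. have g1n : g - 1 != 0 by rewrite gt_eqF.
have cn : c != 0 by rewrite gt_eqF. have Qn : Q != 0 by rewrite gt_eqF.
have d1 : ((g - g^-1) / 2) ^+ 2 + c ^+ 2 = Q / (4 * g ^+ 2) by rewrite /Q; field.
have d2 : (g + 1) ^+ 2 + (((g - 1) / (2 * c))^-1 + 2 * c) ^+ 2 = Q / (g - 1) ^+ 2.
  by rewrite /Q; field; rewrite g1n cn.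
rewrite d1 d2; clear d1 d2 Q0; move: Q Qn => P Pn.
by field; rewrite gn g1n cn Pn.
Qed.

(** The denominator factors as cosh(t - u) cosh(t + u), and the difference of these two factors is a
    multiple of sinh t sinh u. *)
Lemma sech_diff t : sinh u * (sinh t / (sinh t ^+ 2 + c ^+ 2)) =
  2^-1 * ((cosh (t - u))^-1 - (cosh (t + u))^-1).
Proof.
have h1 := cosh_neq0 (t - u); have h2 := cosh_neq0 (t + u); have h3 := den_gt0 t.
have e1 : cosh (t - u) * cosh (t + u) = sinh t ^+ 2 + c ^+ 2.
  have : expR t * expR (- t) = 1 by rewrite -expRD subrr expR0.
  have : expR u * expR (- u) = 1 by rewrite -expRD subrr expR0.
  rewrite /c /cosh /sinh !opprD !opprK !expRD.
  move: (expR t) (expR (- t)) (expR u) (expR (- u)) => a a' b b' hb ha.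
  rewrite [LHS](_ : _ = 4^-1 * (a ^+ 2 * (b * b') + a' ^+ 2 * (b * b') + (a * a') * (b ^+ 2 + b' ^+ 2))); last by field.
  rewrite [RHS](_ : _ = 4^-1 * (a ^+ 2 + a' ^+ 2 - 2 * (a * a') + b ^+ 2 + b' ^+ 2 + 2 * (b * b'))); last by field.
  by rewrite ha hb; ring.
have e2 : cosh (t + u) - cosh (t - u) = 2 * (sinh t * sinh u).
  by rewrite /cosh /sinh !opprD !opprK !expRD; field.
rewrite -e1; transitivity (2^-1 * ((cosh (t + u) - cosh (t - u)) / (cosh (t - u) * cosh (t + u)))).
  by rewrite e2; field; rewrite h1 h2.
by congr (_ * _); field; rewrite h1 h2.
Qed.

Let ht t := sin (tau * t) * ((cosh (t - u))^-1 - (cosh (t + u))^-1).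

Lemma rint_sin_sech a : rint leb (fun s => sin (tau * (s + a)) / cosh s).
Proof.
have [h _] := @sech_int R 1 ltr01.
have h' : rint leb (fun s => (cosh s)^-1) by under [X in rint _ X]funext do rewrite -[X in cosh X]mul1r.
apply: (rint_dom _ _ h').
  apply: measurable_funM; last exact: (rint_meas h').
  apply: (measurableT_comp (@measurable_sin R)).
  by apply: measurable_funM => //; apply: measurable_funD => //; exact: measurable_cst.
move=> s; rewrite normrM [`|(cosh s)^-1|]ger0_norm ?invr_ge0 ?(ltW (cosh_gt0 s))//.
by rewrite ler_piMl ?invr_ge0 ?(ltW (cosh_gt0 s))// ler_norml sin_geN1 sin_le1.
Qed.

Let fa a s := sin (tau * (s + a)) / cosh s.

Let cont_fa a : continuous (fa a).
Proof.
move=> s; apply: cvgM.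
  apply: (@continuous_comp _ _ _ (fun s => tau * (s + a)) (@sin R)); last exact: continuous_sin.
  by apply: cvgMl_tmp; apply: cvgD; [exact: cvg_id|exact: cvg_cst].
by apply: cvgV; [exact: cosh_neq0|exact: continuous_cosh].
Qed.

Let htE t : ht t = fa u (t + - u) - fa (- u) (t + u).
Proof. by rewrite /ht /fa subrK addrK mulrBr. Qed.

Let cont_ht : continuous ht.
Proof.
move=> t; apply: cvgM.
  apply: (@continuous_comp _ _ _ (fun s => tau * s) (@sin R)); last exact: continuous_sin.
  by apply: cvgMl_tmp; exact: cvg_id.
have h a : {for t, continuous (fun t => (cosh (t + a))^-1)}.
  apply: cvgV; first exact: cosh_neq0.
  apply: (@continuous_comp _ _ _ (fun s => s + a) (@cosh R)); last exact: continuous_cosh.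
  by apply: cvgD; [exact: cvg_id|exact: cvg_cst].
by apply: cvgB; exact: h.
Qed.

(** Translating the two terms by [u] in opposite directions leaves sin(tau (s + u)) - sin(tau (s -
    u)) = 2 cos(tau s) sin(tau u) over cosh s, to which [sech_fourier] applies. *)
Let ht_int : rint leb ht /\ \int[leb]_t ht t = 2 * sin (tau * u) * (pi / cosh (tau * (pi / 2))).
Proof.
have [i1 e1] := rint_shift (- u) (@cont_fa u) (rint_sin_sech u).
have [i2 e2] := rint_shift u (@cont_fa (- u)) (rint_sin_sech (- u)).
rewrite (funext htE : ht = _); split; first exact: rintB.
rewrite (rI_B i1 i2) e1 e2 -(rI_B (rint_sin_sech u) (rint_sin_sech (- u))) -sech_fourier.
rewrite -(rI_Z _ (rint_cos_sech tau)); apply: eq_Rintegral => s _.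
by rewrite /fa !mulrDr mulrN !sinD cosN sinN; ring.
Qed.

Lemma sinh_Sr_int : sinh u * \int[leb]_r Sr c tau r = pi / 4 * (sin (tau * u) / cosh (tau * (pi / 2))).
Proof.
have [_ iS _] := bessel_triple tau c1.
have cG (t : R) : `]0, +oo[%classic t -> {for t, continuous Gt}.
  move=> _; apply: cvgMl_tmp; apply: cvgM.
    apply: cvgM; last exact: continuous_sinh.
    apply: (@continuous_comp _ _ _ (fun s => tau * s) (@sin R)); last exact: continuous_sin.
    by apply: cvgMl_tmp; exact: cvg_id.
  apply: cvgV; first by rewrite gt_eqF// den_gt0.
  apply: cvgD; last exact: cvg_cst.
  by rewrite expr2; under eq_fun do rewrite expr2; apply: cvgM; exact: continuous_sinh.
have g0 r : 0 < gr c r by apply: lt_trans (gr_gt1 c1 r).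
have lnpos r : 0 < ln (gr c r) by rewrite ln_gt0// gr_gt1.
have lninc : {homo (fun r => ln (gr c r)) : x y / x < y}.
  move=> x y xy; rewrite ltr_ln ?posrE//; rewrite ltrD2l ltr_pM2l; first by rewrite ltr_expR.
  exact: mulr_gt0.
have lnsur y : 0 < y -> exists z, ln (gr c z) = y.
  move=> y0; have h : 0 < (expR y - 1) / (2 * c).
    by apply: divr_gt0; [rewrite subr_gt0 -[X in X < _]expR0 ltr_expR|exact: mulr_gt0].
  exists (ln ((expR y - 1) / (2 * c))); rewrite /gr lnK ?posrE// mulrC divfK; last by rewrite gt_eqF// mulr_gt0.
  by rewrite addrC subrK expRK.
have cF' : continuous (fun r => 2 * c * expR r / gr c r).
  move=> r; apply: cvgM.
    by apply: cvgMl_tmp; exact: continuous_expR.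
  apply: cvgV; first by rewrite gt_eqF.
  by apply: cvgD; [exact: cvg_cst|apply: cvgMl_tmp; exact: continuous_expR].
have iG : rint leb (fun r => Gt (ln (gr c r)) * (2 * c * expR r / gr c r)).
  by rewrite (funext GtS).
have [iG' e] := subst_rint is_derive_lng cF' lninc (cover_pos lnpos lninc lnsur) cG iG.
under [in LHS]eq_Rintegral do rewrite -GtS.
rewrite -e.
have [iht eht] := ht_int.
have htN t : ht (- t) = ht t.
  have e1 : cosh (- t - u) = cosh (t + u) by rewrite -opprD coshN.
  have e2 : cosh (- t + u) = cosh (t - u) by rewrite -[- t + u]opprK opprD opprK coshN.
  by rewrite /ht e1 e2 mulrN sinN; ring.
have [_ e3] := even_half cont_ht htN iht.
(* One factor 1/2 is in [Gt], the other in [sech_diff]. Restricting the even function [ht] to the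
   half-line gives a third. *)
have e4 t : Gt t * sinh u = 4^-1 * ht t.
  rewrite /Gt /ht [LHS](_ : _ = 2^-1 * sin (tau * t) * (sinh u * (sinh t / (sinh t ^+ 2 + c ^+ 2)))); last by ring.
  by rewrite sech_diff; field; rewrite !cosh_neq0.
have i4 : leb.-integrable `]0, +oo[ (EFin \o ht) by apply: integrableS iht.
have e5 : \int[leb]_(t in `]0, +oo[) ht t = \int[leb]_(t in `[0, +oo[) ht t.
  exact: (Rintegral_itv_obnd_cbnd i4).
rewrite RintT -(rI_Z _ (proj1 (rintT _) iG')).
transitivity (\int[leb]_t (4^-1 * (ht t * \1_(`]0, +oo[%classic) t))).
  by apply: eq_Rintegral => t _; rewrite [LHS]mulrA [sinh u * Gt t]mulrC e4 -[LHS]mulrA.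
rewrite (rI_Z _ (proj1 (rintT _) i4)) -RintT e5 e3 eht.
by move: (sin _) (cosh _)^-1 => x y; field.
Qed.

End Sine.

(** * Uniform bounds and the limit in the number of terms *)

Section UniformBounds.
Variable R : realType.
Local Notation leb := (@lebesgue_measure R).
Implicit Types (x c p q : R) (m : nat).
Local Notation kR := (CRe (omega R)).

(** The divisor sinh(pi m/2) of the series compensates exactly the loss in [gam_lower]: with a = pi
    m/2, cosh(2a) = 1 + 2 sinh(a)^2 <= 4 sinh(a)^2, since sinh a >= a >= 1 for positive m. *)
Lemma bcst_le m : (0 < m)%N -> bcst (m%:R : R) <= 2 * sinh (pi * m%:R / 2).
Proof.
move=> m0; set a := pi * m%:R / 2.
have a1 : 1 <= a.
  have h1 : 2 <= pi :> R by exact: pi_ge2.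
  have h2 : 1 <= m%:R :> R by rewrite ler1n.
  by rewrite /a ler_pdivlMr// mul1r; nra.
have s1 : 1 <= sinh a by apply: (le_trans a1); apply: sinh_ge; exact: le_trans ler01 a1.
have e : cosh (pi * m%:R) = 1 + 2 * sinh a ^+ 2.
  have -> : pi * m%:R = a + a by rewrite /a; field.
  rewrite /cosh /sinh opprD !expRD.
  have : expR a * expR (- a) = 1 by rewrite -expRD subrr expR0.
  move: (expR a) (expR (- a)) => b b' h.
  rewrite [RHS](_ : _ = 1 + 2^-1 * (b * b + b' * b' - 2 * (b * b'))); last by field.
  by rewrite h; field.
rewrite /bcst -[leRHS]ger0_norm; last by rewrite mulr_ge0//; lra.
by rewrite -sqrtr_sqr ler_wsqrtr// e; nra.
Qed.

(** The factor of [a m] in the series, see [f_term_x]. At m = 0 it vanishes by [0^-1 = 0], so that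
    its bounds hold for all m. *)
Definition Phi m x : R :=
  (sinh (pi * m%:R / 2))^-1 * CIm (Jx m%:R x) * CRe (Kx m%:R x) * pos x.

Lemma Phi_le m x : `|Phi m x| <= 2 * (expR (2 * Num.sqrt (2 * `|x|)) * kap x * pos x).
Proof.
rewrite /Phi; case: (ltP 0 x) => x0; last by rewrite pos_le0// !mulr0 normr0.
have kx : 0 <= kap x by apply: le_trans (besselKi_le 0 x0); exact: cabs_ge0.
rewrite pos_gt0// !mulr1 !normrM.
have hK : `|CRe (Kx m%:R x)| <= kap x.
  by apply: le_trans (Re_le_cabs _) (besselKi_le m%:R x0).
have hJ : `|CIm (Jx m%:R x)| <= expR (2 * Num.sqrt (2 * `|x|)) * bcst m%:R.
  apply: le_trans (Im_le_cabs _) _; rewrite /Jx besselJ_x// cabsM cabs_cexp.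
  rewrite (_ : CRe _ = 0) ?expR0 ?mul1r ?jser_le//.
  by rewrite !ReImE/=; ring.
case: m hK hJ => [|m] hK hJ.
  rewrite mulr0 mul0r sinh0 invr0 normr0 !mul0r.
  by rewrite mulr_ge0// mulr_ge0// expR_ge0.
have s0 : 0 < sinh (pi * m.+1%:R / 2) :> R.
  have := bcst_le (ltn0Sn m); have : 0 < bcst m.+1%:R :> R by rewrite sqrtr_gt0 cosh_gt0.
  lra.
rewrite mulrA ler_pM ?mulr_ge0//.
rewrite normfV [`|sinh _|]gtr0_norm// ler_pdivrMl//; apply: le_trans hJ _.
have := bcst_le (ltn0Sn m); have := expR_gt0 (2 * Num.sqrt (2 * `|x|)).
move: (expR _) (bcst _) (sinh _) => e b s e0 hb.
by rewrite [leRHS](_ : _ = e * (2 * s)) ?ler_wpM2l ?(ltW e0)//; ring.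
Qed.

Lemma Re_omega_le1 : kR <= 1.
Proof. by rewrite -(cabs_omega R); apply: le_trans (Re_le_cabs _); exact: ler_norm. Qed.

(** The unrotated exponent behind [kap] is first weakened by the factor Re(omega) <= 1, so that
    [exponent_le] applies to both integrands alike. *)
Lemma K0_kap_le c x : 1 <= c -> 0 < x ->
  `|CRe (K0x c x)| * (expR (2 * Num.sqrt (2 * `|x|)) * kap x) <= 4^-1 * (dint x * dint x).
Proof.
move=> c1 x0; have c0 : 0 < c by exact: lt_le_trans c1.
have k0 : 0 < kR := Re_omega_gt0 R.
pose E p := expR (- (expR p + 2 * x * expR (- p))).
pose E0 q := expR (- (kR * expR q + 4 * c * x * kR * expR (- q))).
have iE : rint leb E.
  have := @rint_dexp R 1 (2 * x) ltr01; rewrite mulr_gt0// => /(_ isT).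
  by rewrite /E; under [X in rint _ X -> _]funext do rewrite mul1r.
have iE0 : rint leb E0 by apply: rint_dexp => //; apply: mulr_gt0 => //; apply: mulr_gt0 => //; exact: mulr_gt0.
have hK0 : `|CRe (K0x c x)| <= 2^-1 * \int[leb]_q E0 q.
  apply: le_trans (Re_le_cabs _) _; rewrite /K0x besselK0_x// cabsM cabs_real ger0_norm ?invr_ge0//.
  rewrite ler_wpM2l ?invr_ge0//.
  have ck : cin leb (kexp (omega R) ((4 * c * x)%:C * omega R) 0).
    by apply: cin_kexp => //; rewrite ReZ; apply: mulr_gt0 => //; rewrite !mulr_gt0.
  apply: le_trans (cabs_cI ck) _; rewrite le_eqVlt; apply/orP; left; apply/eqP.
  by apply: eq_Rintegral => q _; rewrite cabs_kexp ReZ.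
set y := expR _.
have y0 : 0 <= y by exact: expR_ge0.
have Ege p : 0 <= E p by exact: expR_ge0.
have pt p q : y * E p * E0 q <= dexp x p * dexp x q.
  rewrite /y /E /E0 -!expRD ler_expR ger0_norm ?(ltW x0)//.
  apply: le_trans (exponent_le p q (Re_omega R) c1 x0).
  have h : kR * (expR p + 2 * x * expR (- p)) <= expR p + 2 * x * expR (- p).
    by rewrite ler_piMl ?Re_omega_le1// addr_ge0 ?expR_ge0// !mulr_ge0 ?expR_ge0// ltW.
  lra.
have i1 := rint_dexp_x x0.
have s1 q : y * (\int[leb]_p E p) * E0 q <= dint x * dexp x q.
  rewrite -(rI_Z _ iE) mulrC -(rI_Z _ (rintZ y iE)) [leRHS]mulrC /dint -(rI_Z _ i1).
  apply: rI_le; [by apply: rintZ; exact: rintZ|exact: rintZ|] => p.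
  by rewrite mulrC [leRHS]mulrC pt.
have s2 : y * (\int[leb]_p E p) * (\int[leb]_q E0 q) <= dint x * dint x.
  rewrite -(rI_Z _ iE0) [X in _ <= _ * X]/dint -(rI_Z _ i1).
  by apply: rI_le => //; exact: rintZ.
rewrite /kap -/E.
have kI : 0 <= \int[leb]_p E p by apply: Rintegral_ge0.
apply: (@le_trans _ _ (2^-1 * (\int[leb]_q E0 q) * (y * (2^-1 * \int[leb]_p E p)))).
  have h2 : 0 <= 2^-1 * \int[leb]_p E p by apply: mulr_ge0 => //; rewrite invr_ge0.
  exact: (ler_wpM2r (mulr_ge0 y0 h2) hK0).
rewrite [leLHS](_ : _ = 4^-1 * (y * (\int[leb]_p E p) * (\int[leb]_q E0 q))); last by field.
by rewrite ler_wpM2l// invr_ge0.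
Qed.

Definition dom x : R := 2^-1 * (dint x * dint x * pos x).

Lemma rint_dom_sq : rint leb dom.
Proof. by apply: rintZ; exact: dint_sq. Qed.

Lemma dom_ge0 x : 0 <= dom x.
Proof. by rewrite mulr_ge0 ?invr_ge0// !mulr_ge0 ?dint_ge0 ?pos_ge0. Qed.

Lemma K0_Phi_le c m x : 1 <= c -> `|CRe (K0x c x) * Phi m x| <= dom x.
Proof.
move=> c1; rewrite normrM; case: (ltP 0 x) => x0; last first.
  by rewrite /Phi pos_le0// mulr0 normr0 mulr0 dom_ge0.
apply: (@le_trans _ _ (`|CRe (K0x c x)| * (2 * (expR (2 * Num.sqrt (2 * `|x|)) * kap x * pos x)))).
  by rewrite ler_wpM2l// Phi_le.
have := K0_kap_le c1 x0; rewrite /dom pos_gt0// !mulr1.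
move: `|_| (_ * kap x) (dint x * dint x) => A B C; lra.
Qed.

Lemma f_term_x (a : nat -> R[i]) m x : 0 < x -> f_term a x m = a m * (Phi m x)%:C.
Proof.
move=> x0; rewrite /f_term -realCn /Phi pos_gt0// mulr1.
rewrite -[besselJ _ _]/(Jx m%:R x) -[besselK _ _]/(Kx m%:R x).
have -> : Kx m%:R x = (CRe (Kx m%:R x))%:C.
  by apply: eqC; [|rewrite Im_Kx].
by move: (sinh _) (CIm _) (CRe _) => s j k; rewrite !realCM realCV; ring.
Qed.

End UniformBounds.

(** * Orthogonality of the sines on [0, pi] *)

Section Orthogonality.
Variable R : realType.
Local Notation leb := (@lebesgue_measure R).
Implicit Types (u k : R) (n m : nat).

Lemma sin_natpi n : sin (n%:R * pi) = 0 :> R.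
Proof.
elim: n => [|n IH]; first by rewrite mul0r sin0.
by rewrite -addn1 natrD mulrDl mul1r sinDpi IH oppr0.
Qed.

Lemma is_derive_sinM k u : k != 0 -> is_derive u 1 (fun u => sin (k * u) / k) (cos (k * u)).
Proof.
move=> k0; have h : is_derive u 1 (fun u => k * u) k.
  by apply: is_derive_eq; rewrite /GRing.scale/= mulr1.
have h2 : is_derive u 1 (fun u => k^-1 * sin (k * u)) (k^-1 * (k * cos (k * u))).
  apply: (@is_deriveZ _ _ _ (fun u => sin (k * u))).
  by apply: (is_derive_eq (is_derive1_comp (is_derive_sin (k * u)) h)); rewrite mulrC.
rewrite mulKf// in h2.
by rewrite (_ : (fun u => _) = (fun u => k^-1 * sin (k * u)))//; apply/funext => v; rewrite mulrC.
Qed.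

Lemma sin_orth n m : (0 < n)%N -> (0 < m)%N ->
  \int[leb]_(u in `[0, pi]) (sin (n%:R * u) * sin (m%:R * u)) = (n == m)%:R * (pi / 2).
Proof.
move=> n0 m0.
have cs k : continuous (fun u => sin (k * u)).
  move=> u; apply: (@continuous_comp _ _ _ (fun s => k * s) (@sin R)); last exact: continuous_sin.
  by apply: cvgMl_tmp; exact: cvg_id.
have cc : continuous (fun u => sin (n%:R * u) * sin (m%:R * u)).
  by move=> u; apply: cvgM; exact: cs.
have e u : sin (n%:R * u) * sin (m%:R * u) =
    2^-1 * (cos ((n%:R - m%:R) * u) - cos ((n%:R + m%:R) * u)) :> R.
  by rewrite mulrBl mulrDl cosB cosD; field.
have spi : sin ((n%:R + m%:R) * pi) = 0 :> R by rewrite -natrD sin_natpi.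
have dpi : sin ((n%:R - m%:R) * pi) = 0 :> R.
  by rewrite mulrBl sinB !sin_natpi mul0r mulr0 subrr.
have k2 : n%:R + m%:R != 0 :> R by rewrite -natrD pnatr_eq0 addn_eq0 negb_and -!lt0n n0.
have d2 u := is_derive_sinM u k2.
case: (eqVneq n m) => [nm|nm].
  have d u : is_derive u 1 (fun u => 2^-1 * (u - sin ((n%:R + m%:R) * u) / (n%:R + m%:R)))
      (sin (n%:R * u) * sin (m%:R * u)).
    have nm0 : n%:R - m%:R = 0 :> R by rewrite nm subrr.
    have h := is_deriveB (is_derive_id u (1 : R)) (d2 u).
    by rewrite e nm0 mul0r cos0; exact: (is_deriveZ 2^-1 h).
  rewrite (ftc_itv (pi_gt0 R) cc d) spi mulr0 sin0 !mul0r !subr0 mulr0 subr0.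
  by rewrite mul1r mulrC.
have k1 : n%:R - m%:R != 0 :> R by rewrite subr_eq0 eqr_nat.
have d1 u := is_derive_sinM u k1.
have d u : is_derive u 1 (fun u => 2^-1 * (sin ((n%:R - m%:R) * u) / (n%:R - m%:R) -
     sin ((n%:R + m%:R) * u) / (n%:R + m%:R))) (sin (n%:R * u) * sin (m%:R * u)).
  by rewrite e; exact: (is_deriveZ 2^-1 (is_deriveB (d1 u) (d2 u))).
by rewrite (ftc_itv (pi_gt0 R) cc d) spi dpi !mulr0 sin0 !mul0r !subrr ?mulr0 ?subr0 ?mul0r.
Qed.

Lemma RintD (a b : R) (f : R -> R) :
  \int[leb]_(u in `[a, b]) f u = \int[leb]_u (f u * \1_(`[a, b]%classic) u).
Proof. by rewrite Rintegral_mkcond patch_indic. Qed.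

End Orthogonality.

(** * Integrals of the kernel against the terms of the series *)

Section OmegaIntegral.
Variable R : realType.
Local Notation leb := (@lebesgue_measure R).
Implicit Types (x u q : R) (n m : nat).

Let s u : R := \1_(`[0, pi]%classic) u.

Let rint_s : rint leb s.
Proof. exact: integrable_indic_itv. Qed.

Let s_ge0 u : 0 <= s u.
Proof. by rewrite /s indicE. Qed.

Lemma cexp_pi4 : cexp (pi / 4)*i = omega R.
Proof. by rewrite /omega; congr cexp; apply: eqC => /=; ring. Qed.

Lemma OmegaE n x : Omega n x =
  \int[leb]_u (CRe (K0x (cosh u) x) * sinh u * sin (n%:R * u) * s u).
Proof. by rewrite /Omega Rintegral_mkcond patch_indic /K0x -cexp_pi4. Qed.

(** A version of Re K_0 that is visibly measurable in both variables, being a parameter integral. It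
    agrees with [K0x] for x > 0; elsewhere the factor [Phi] vanishes. *)
Let V (z : R * R) : R := CRe (2^-1%:C * cI leb (k0 (cosh z.2) z.1)).

Let mV : measurable_fun setT V.
Proof.
suff [h _] : cmeas (fun z : R * R => 2^-1%:C * cI leb (k0 (cosh z.2) z.1)) by exact: h.
apply: cmeasM; first exact: cmeas_cst.
apply: (@cmeas_param _ _ _ _ _ leb (fun w : (R * R) * R => k0 (cosh w.1.2) w.1.1 w.2)).
apply: cmeas_cexp; apply: cmeasD; [apply: cmeasD|]; apply: cmeasN.
- apply: cmeasM; first exact: cmeas_cst.
  by apply: cmeas_real; apply: measurable_funexpR; exact: measurable_snd.
- apply: cmeasM; last by apply: cmeas_real; apply: measurable_funexpR; apply: measurable_funN; exact: measurable_snd.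
  apply: cmeasM; last exact: cmeas_cst.
  apply: cmeas_real; apply: measurable_funM; last first.
    by apply: (measurableT_comp (f := fst)); [exact: measurable_fst|exact: measurable_fst].
  apply: measurable_funM; first exact: measurable_cst.
  apply: (measurableT_comp (f := @cosh R)); first exact: (continuous_measurable_fun (@continuous_cosh R)).
  by apply: (measurableT_comp (f := snd)); [exact: measurable_snd|exact: measurable_fst].
- apply: cmeasM; first exact: cmeas_cst.
  by apply: cmeas_real; apply: measurable_funM; [exact: measurable_cst|exact: measurable_snd].
Qed.

Let V_E x u : 0 < x -> V (x, u) = CRe (K0x (cosh u) x).
Proof. by move=> x0; rewrite /K0x besselK0_x// cosh_gt0. Qed.

Let mPhi m : measurable_fun setT (@Phi R m).
Proof.
pose A x : R[i] := cexp ('i * (m%:R * ln (Num.sqrt (2 * x)))%:C) * jser m%:R x.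
pose B x : R[i] := 2^-1%:C * (cexp (- (m%:R * (pi / 4))%:C + 'i * (m%:R * ln (Num.sqrt (2 * x)))%:C) *
  cI leb (k1 m%:R x)).
have mln : cmeas (fun x : R => 'i * (m%:R * ln (Num.sqrt (2 * x)))%:C).
  apply: cmeasM; first exact: cmeas_cst.
  apply: cmeas_real; apply: measurable_funM; first exact: measurable_cst.
  apply: measurable_funln; apply: (measurableT_comp (f := @Num.sqrt R)).
    exact: (continuous_measurable_fun (@sqrt_continuous R)).
  by apply: measurable_funM => //; exact: measurable_cst.
have [_ mA] : cmeas A by apply: cmeasM; [exact: cmeas_cexp|exact: cmeas_jser].
have [mB _] : cmeas B.
  apply: cmeasM; first exact: cmeas_cst.
  apply: cmeasM; first by apply: cmeas_cexp; apply: cmeasD; [exact: cmeas_cst|exact: mln].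
  exact: (cmeas_param leb (cmeas_kexp2 _ _ _ _)).
rewrite (_ : @Phi R m = fun x => (sinh (pi * m%:R / 2))^-1 * CIm (A x) * CRe (B x) * pos x).
  apply: measurable_funM; last exact: measurable_pos.
  apply: measurable_funM; last exact: mB.
  by apply: measurable_funM; [exact: measurable_cst|exact: mA].
apply/funext => x; rewrite /Phi; case: (ltP 0 x) => x0; last by rewrite pos_le0// !mulr0.
by rewrite /A /B /Jx /Kx besselJ_x// besselKi_x.
Qed.

Let g n u := sinh u * sin (n%:R * u) * s u.

Let mg n : measurable_fun setT (g n).
Proof.
apply: measurable_funM; last exact: (rint_meas rint_s).
apply: measurable_funM; first exact: (continuous_measurable_fun (@continuous_sinh R)).
apply: (measurableT_comp (f := @sin R)); first exact: measurable_sin.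
by apply: measurable_funM => //; exact: measurable_cst.
Qed.

Let g_le n u : `|g n u| <= expR pi * s u.
Proof.
rewrite /g normrM (ger0_norm (s_ge0 u)); rewrite /s indicE.
case: (boolP (u \in _)) => hu; last by rewrite !mulr0.
rewrite !mulr1 normrM; move: hu; rewrite inE/= in_itv/= => /andP[u0 u1].
rewrite -[leRHS]mulr1 ler_pM//; last by rewrite ler_norml sin_geN1 sin_le1.
have h1 : expR u <= expR pi by rewrite ler_expR.
have h2 : expR (- u) <= expR pi by rewrite ler_expR; have := pi_gt0 R; lra.
have := expR_gt0 u; have := expR_gt0 (- u).
by rewrite /sinh ler_norml => ? ?; apply/andP; split; lra.
Qed.

Let W n m (z : R * R) := V z * Phi m z.1 * g n z.2.

Let W_le n m x u : `|W n m (x, u)| <= dom x * (expR pi * s u).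
Proof.
rewrite /W /= normrM; apply: ler_pM => //.
case: (ltP 0 x) => x0; last by rewrite /Phi pos_le0//= !mulr0 normr0 dom_ge0.
by rewrite V_E//; apply: K0_Phi_le; exact: cosh_ge1.
Qed.

Let mW n m : measurable_fun setT (W n m).
Proof.
apply: measurable_funM.
  apply: measurable_funM mV _.
  by apply: (measurableT_comp (f := @Phi R m)); [exact: mPhi|exact: measurable_fst].
by apply: (measurableT_comp (f := g n)); [exact: mg|exact: measurable_snd].
Qed.

Definition Mpi : R := expR pi * \int[leb]_u s u.

Let W_x n m x : rint leb (fun u => W n m (x, u)).
Proof.
apply: (@rint_dom _ _ _ leb _ (fun u => dom x * (expR pi * s u))).
- exact: (measurableT_comp (mW n m) (pair1_measurable x)).
- by move=> u; exact: W_le.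
- by apply: rintZ; apply: rintZ; exact: rint_s.
Qed.

Let W_xle n m x : \int[leb]_u `|W n m (x, u)| <= dom x * Mpi.
Proof.
rewrite /Mpi -(rI_Z _ rint_s) -(rI_Z _ (rintZ _ rint_s)); apply: rI_le.
- exact: rint_abs (W_x n m x).
- by apply: rintZ; apply: rintZ; exact: rint_s.
- by move=> u; exact: W_le.
Qed.

Let W_int n m : rint (leb \x leb)%E (W n m).
Proof.
apply: (@rint_prod12 _ _ _ _ _ leb leb _ (fun x => dom x * Mpi)).
- exact: mW.
- by move=> x; exact: W_x.
- by move=> x; exact: W_xle.
- by under [X in rint _ X]funext do rewrite mulrC; apply: rintZ; exact: rint_dom_sq.
Qed.

(** Taking [Phi] out of the integral needs an integrable integrand, and integrability is known for
    [W], which contains [Phi]. Where [Phi] is nonzero one divides by it; where it is zero both sides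
    vanish. *)
Let W_Omega n m x : \int[leb]_u W n m (x, u) = Omega n x * Phi m x.
Proof.
case: (eqVneq (Phi m x) 0) => [p0|p0].
  have e u : W n m (x, u) = 0 by rewrite /W /= p0 mulr0 mul0r.
  by rewrite p0 mulr0; under eq_Rintegral do rewrite e; exact: rI_0.
have x0 : 0 < x.
  by rewrite ltNge; apply/negP => x0; move: p0; rewrite /Phi pos_le0// mulr0 eqxx.
rewrite OmegaE mulrC -[LHS](mulVKf p0); congr (_ * _).
rewrite -(rI_Z _ (W_x n m x)); apply: eq_Rintegral => u _.
have eW : W n m (x, u) = CRe (K0x (cosh u) x) * Phi m x * g n u by rewrite -V_E.
by rewrite eW /g; move: (Phi m x) p0 (CRe _) => P P0 k; field.
Qed.

Lemma Omega_Phi_le n m x : `|Omega n x * Phi m x| <= dom x * Mpi.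
Proof.
rewrite -W_Omega; apply: le_trans (W_xle n m x).
by apply: le_normr_Rintegral => //; exact: W_x.
Qed.

Lemma rint_Omega_Phi n m : rint leb (fun x => Omega n x * Phi m x).
Proof.
have [h1 _] := rfubini1 (W_int n m).
by under [X in rint _ X]funext do rewrite -W_Omega; exact: h1.
Qed.

Lemma Omega_Phi_int n m : (0 < n)%N -> (0 < m)%N ->
  \int[leb]_x (Omega n x * Phi m x) = - (n == m)%:R * (pi ^+ 2 / 32 / sinh (pi * m%:R)).
Proof.
move=> n0 m0.
have [_ e1] := rfubini1 (W_int n m); have [_ e2] := rfubini2 (W_int n m).
under eq_Rintegral do rewrite -W_Omega.
rewrite [LHS]e1 -[LHS]e2.
have ch0 : cosh (m%:R * (pi / 2)) != 0 :> R by exact: cosh_neq0.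
have sn : sinh (pi * m%:R / 2) != 0 :> R.
  have h : 0 < pi * m%:R / 2 :> R by rewrite !mulr_gt0// ?pi_gt0 ?invr_gt0 ?ltr0n.
  by rewrite gt_eqF//; apply: (lt_le_trans h); apply: sinh_ge; exact: ltW.
(* Here 1/32 is 1/8 from [bessel_triple] times 1/4 from [sinh_Sr_int]. The duplication formula for
   sinh later merges sinh(pi m/2) and cosh(pi m/2) into sinh(pi m). *)
pose k : R := (sinh (pi * m%:R / 2))^-1 * (- 32^-1 * pi / cosh (m%:R * (pi / 2))).
have e u : \int[leb]_x W n m (x, u) = k * (sin (n%:R * u) * sin (m%:R * u) * s u).
  have [i1 i2 i3] := bessel_triple m%:R (cosh_ge1 u).
  transitivity (\int[leb]_x ((sinh (pi * m%:R / 2))^-1 * g n u *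
     (CRe (K0x (cosh u) x) * CIm (Jx m%:R x) * CRe (Kx m%:R x) * pos x))).
    apply: eq_Rintegral => x _; case: (ltP 0 x) => x0; last first.
      by rewrite /W /Phi /= pos_le0// !(mulr0, mul0r).
    have -> : W n m (x, u) = CRe (K0x (cosh u) x) * Phi m x * g n u by rewrite -V_E.
    by rewrite /Phi; move: (CRe (K0x _ _)) => k0; ring.
  rewrite (rI_Z _ i1) i3 /g.
  have := sinh_Sr_int u m%:R; move: (\int[leb]_r _) => I hI.
  rewrite [LHS](_ : _ = (sinh (pi * m%:R / 2))^-1 * sin (n%:R * u) * s u * - 8^-1 * (sinh u * I)); last by ring.
  by rewrite hI /k; move: (sinh _) (cosh _) sn ch0 => a b a0 b0; field; rewrite a0 b0.
under eq_Rintegral do rewrite e.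
have iss : rint leb (fun u => sin (n%:R * u) * sin (m%:R * u) * s u).
  apply: (rint_dom _ _ rint_s).
    apply: measurable_funM; last exact: (rint_meas rint_s).
    have ms (a : R) : measurable_fun setT (fun u => sin (a * u)).
      apply: (measurableT_comp (f := @sin R)); first exact: measurable_sin.
      by apply: measurable_funM => //; exact: measurable_cst.
    by apply: measurable_funM; exact: ms.
  have sl (a : R) : `|sin a| <= 1 by rewrite ler_norml sin_geN1 sin_le1.
  by move=> u; rewrite 2!normrM (ger0_norm (s_ge0 u)) ler_piMl// mulr_ile1.
rewrite (rI_Z _ iss) -RintD sin_orth// /k.
have sE : sinh (pi * m%:R) = 2 * sinh (pi * m%:R / 2) * cosh (m%:R * (pi / 2)) :> R.
  have -> : m%:R * (pi / 2) = pi * m%:R / 2 :> R by ring.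
  have {1}-> : pi * m%:R = pi * m%:R / 2 + pi * m%:R / 2 :> R by field.
  by rewrite /sinh /cosh opprD !expRD; field.
rewrite sE; move: (sinh _) (cosh _) sn ch0 => a b a0 b0.
by field; rewrite a0 b0.
Qed.

End OmegaIntegral.

(** * Recovery of the coefficients *)

Lemma l1_bound (R : realType) (a : nat -> R[i]) :
  (\sum_(1 <= n <oo) (CRe `|a n|)%:E < +oo)%E ->
  exists S : R, forall N, \sum_(1 <= n < N) cabs (a n) <= S.
Proof.
set L := (X in (X < _)%E) => hL.
have L0 : (0 <= L)%E by apply: nneseries_ge0 => n _ _; rewrite lee_fin; exact: cabs_ge0.
have Lfin : L \is a fin_num by rewrite ge0_fin_numE.
exists (fine L) => N; rewrite -lee_fin fineK// -sumEFin.
by apply: nneseries_lim_ge => n _ _; rewrite lee_fin; exact: cabs_ge0.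
Qed.

(** Pointwise convergence belongs to the conclusion because [csum] is a limit and takes a default
    value on divergent series. *)
Theorem theorem5 (R : realType) (a : nat -> R[i])
    (a_l1 : (\sum_(1 <= n <oo) (complex.Re `|a n|)%:E < +oo)%E) :
  (forall x : R, 0 < x -> csummable 1 (f_term a x)) /\
  (forall n : nat, (0 < n)%N ->
     cintegrable `]0, +oo[ (fun x : R => (Omega n x)%:C * f_series a x) /\
     a n = - (32 / pi ^+ 2 * sinh (pi * n%:R))%:C
             * cintegral `]0, +oo[ (fun x : R => (Omega n x)%:C * f_series a x)).
Proof.
have [S leS] := l1_bound a_l1.
have sumS (C : R) N : 0 <= C -> \sum_(1 <= m < N) cabs (a m) * C <= S * C.
  by move=> C0; rewrite -mulr_suml ler_wpM2r.
have fsum x : 0 < x -> csumto 1 (f_term a x) (f_series a x) /\ csummable 1 (f_term a x).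
  move=> x0; pose C := 2 * (expR (2 * Num.sqrt (2 * `|x|)) * kap x * pos x).
  have C0 : 0 <= C by apply: le_trans (Phi_le 0 x); exact: normr_ge0.
  apply: (csumto_abs (b := fun m => cabs (a m) * C) (B := S * C)) => [m|N]; last exact: sumS.
  by rewrite f_term_x// cabsM cabs_real ler_wpM2l ?cabs_ge0// Phi_le.
split => [x /fsum[]//|n n0].
pose F (x : R) : R[i] := (Omega n x)%:C * f_series a x * (pos x)%:C.
pose F_ N (x : R) : R[i] := \sum_(1 <= m < N) a m * (Omega n x * Phi m x)%:C.
have ci m : cin lebesgue_measure (fun x : R => a m * (Omega n x * Phi m x)%:C).
  by apply: cinZ; apply: cin_real; exact: rint_Omega_Phi.
have conv x : ccvg (F_ ^~ x) (F x).
  rewrite /F; case: (ltP 0 x) => x0; last first.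
    have e N : F_ N x = 0.
      by apply: big1 => m _; rewrite /Phi pos_le0// !mulr0.
    by rewrite pos_le0// mulr0; under eq_fun do rewrite e; split; exact: cvg_cst.
  have [/(ccvgZ (Omega n x)%:C) h _] := fsum _ x0.
  have e N : (Omega n x)%:C * (\sum_(1 <= m < N) f_term a x m) = F_ N x.
    rewrite mulr_sumr; apply: eq_bigr => m _; rewrite f_term_x// realCM; ring.
  by rewrite pos_gt0// mulr1; under eq_fun do rewrite -e.
have le_F N x : cabs (F_ N x) <= S * Mpi R * dom x.
  rewrite -mulrA; apply: le_trans (cabs_sum _ _ _) _.
  have d0 : 0 <= dom x * Mpi R by apply: le_trans (Omega_Phi_le n 1 x); exact: normr_ge0.
  rewrite [Mpi R * _]mulrC; apply: le_trans (sumS _ N d0); apply: ler_sum => m _.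
  by rewrite cabsM cabs_real ler_wpM2l ?cabs_ge0// Omega_Phi_le.
have [h1 h2 h3] := cdct (fun N => cin_meas (cin_sum (index_iota 1 N) ci))
  (fun x => (conv x).1) (fun x => (conv x).2) (rintZ (S * Mpi R) (@rint_dom_sq R)) le_F.
split; first exact/cinT.
pose K : R := pi ^+ 2 / 32 / sinh (pi * n%:R).
(* By orthogonality the sequence is constant as soon as n < N, the sums running over m < N. *)
have lim : ccvg (fun N => cI lebesgue_measure (F_ N)) (a n * (- K)%:C).
  have e N : (n < N)%N -> cI lebesgue_measure (F_ N) = a n * (- K)%:C.
    move=> nN; rewrite cI_sum//.
    rewrite (eq_big_nat _ _ (F2 := fun m => if m == n then a n * (- K)%:C else 0)); last first.
      move=> m /andP[m0 _]; rewrite cI_Z; last by apply: cin_real; exact: rint_Omega_Phi.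
      rewrite cI_real Omega_Phi_int// eq_sym; case: eqP => [->|_]; first by rewrite mulN1r.
      by rewrite oppr0 mul0r mulr0.
    by rewrite (bigD1_seq n) /= ?mem_index_iota ?n0 ?nN ?iota_uniq// eqxx big1 ?addr0// => m /negbTE ->.
  by split; apply: cvg_near_cst; near=> N; rewrite e//; near: N; exact: nbhs_infty_gt.
have -> : cintegral `]0, +oo[ (fun x : R => (Omega n x)%:C * f_series a x) = a n * (- K)%:C.
  by rewrite cIT; apply: ccvg_uniq lim; split.
have s0 : sinh (pi * n%:R) != 0 :> R.
  have h : 0 < pi * n%:R :> R by apply: mulr_gt0; [exact: pi_gt0|rewrite ltr0n].
  by rewrite gt_eqF//; apply: (lt_le_trans h); apply: sinh_ge; exact: ltW.
have p0 : pi != 0 :> R by rewrite gt_eqF// pi_gt0.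
rewrite mulrCA -realCN -realCM (_ : - (32 / pi ^+ 2 * _) * _ = 1) ?mulr1// /K.
by move: (pi : R) p0 s0 => p p0 s0; field; rewrite s0 p0.
Unshelve. all: by end_near.
Qed.
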